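(* Let $n\ge1$. The group of magnetomorphisms of $(\mathbb S^{2n+1},g,\mathrm d\alpha)$ is the group of unitary matrices (acting on $\mathbb S^{2n+1}\subset\mathbb C^{n+1}$ by restriction): \[ \mathrm{Mag}(\mathbb S^{2n+1},g,\mathrm d\alpha)=U(n+1). \] The lift of the action of this group to $T\mathbb S^{2n+1}$ (by $\Phi\mapsto(\Phi,\mathrm d\Phi)$) is Hamiltonian with respect to the twisted symplectic form $\omega_{\mathrm d\alpha}$, with moment map \[ \mu:T\mathbb S^{2n+1}\to\mathfrak u(n+1)^*,\qquad \mu(z,v)[A]:=g_z(Az,v)-\alpha_z(Az),\quad\forall A\in\mathfrak u(n+1),\ \forall (z,v)\in T\mathbb S^{2n+1}. \] A closed, connected submanifold $N$ of $\mathbb S^{2n+1}$ of positive dimension is totally magnetic if and only if $N=\mathbb S^{2n+1}\cap V$, where $V$ is a complex vector subspace of $\mathbb C^{n+1}$. In this case, $N$, with the pullbacks $g_N,\sigma_N$ of $g,\mathrm d\alpha$ to $N$, is magnetomorphic to $(\mathbb S^{2j+1},g,\mathrm d\alpha)$ for some $j$, where $g$ and $\alpha$ denote the round metric and standard contact form on $\mathbb S^{2j+1}$.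
   Context: $\mathbb S^{2n+1}$ is the unit sphere in $\mathbb C^{n+1}$ with standard Hermitian product $\langle\cdot,\cdot\rangle$; $g=\mathrm{Re}\langle\cdot,\cdot\rangle$ restricted to the sphere; $\alpha_z=\tfrac12\mathrm{Re}\langle\mathrm iz,\cdot\rangle$ (same formulas on every $\mathbb S^{2j+1}\subset\mathbb C^{j+1}$). A magnetic system $(M,g,\sigma)$ is a closed connected Riemannian manifold with a closed two-form $\sigma$; its Lorentz force $Y$ is given by $g(Yu,v)=\sigma(u,v)$, and magnetic geodesics are the curves with $\nabla_{\dot\gamma}\dot\gamma=Y_\gamma\dot\gamma$. A magnetomorphism $(M_1,g_1,\sigma_1)\to(M_2,g_2,\sigma_2)$ is a diffeomorphism $\Phi:M_1\to M_2$ with $\Phi^*g_2=g_1$ and $\Phi^*\sigma_2=\sigma_1$; $\mathrm{Mag}(M,g,\sigma)$ is the group of magnetomorphisms of $(M,g,\sigma)$ to itself. An embedded submanifold $N\subset M$ is totally magnetic if for every magnetic geodesic $\gamma:I\to M$ with $\gamma(0)\in N$, $\dot\gamma(0)\in T_{\gamma(0)}N$, there is $\varepsilon>0$ with $\gamma((-\varepsilon,\varepsilon))\subset N$. The twisted symplectic form on $TM$ is $\omega_\sigma:=\mathrm d\lambda-\pi_{TM}^*\sigma$, where $\lambda$ is the pullback of the canonical Liouville $1$-form of $T^*M$ to $TM$ via the metric, i.e. $\lambda_{(q,v)}(\xi)=g_q(v,\mathrm d\pi_{TM}\xi)$, and $\pi_{TM}:TM\to M$ is the projection. Sign convention: that $\mu$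 is a moment map means $\iota_{X_A}\omega_{\mathrm d\alpha}=-\mathrm d(\mu[A])$, where $X_A$ is the vector field on $T\mathbb S^{2n+1}$ generating the lifted action of the one-parameter group $t\mapsto e^{tA}$, $A\in\mathfrak u(n+1)$. *)

(* Defs.v *)
(* Manifolds are embedded submanifolds of a Euclidean
   space, i.e. subsets of a finite-dimensional normed R-module V, and all
   geometric notions on a subset are those of an embedded submanifold. *)
From HB Require Import structures.
From mathcomp Require Import all_boot all_order all_algebra.
From mathcomp Require Import complex.
From mathcomp Require Import all_classical all_reals all_analysis.

Set Implicit Arguments.
Unset Strict Implicit.
Unset Printing Implicit Defensive.

Import Order.TTheory GRing.Theory Num.Theory.
Import numFieldNormedType.Exports.

Local Open Scope classical_set_scope.
Local Open Scope ring_scope.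
Local Open Scope sesquilinear_scope.

Section SmoothMaps.
Context {R : realType} {V W : normedModType R}.

Fixpoint Ck (k : nat) (U : set V) (f : V -> W) : Prop :=
  match k with
  | 0 => forall x, U x -> {for x, continuous f}
  | k'.+1 => (forall x, U x -> differentiable f x) /\
             (forall v, Ck k' U ('D_v f))
  end.

(* For U open (and V finite-dimensional). *)
Definition smooth_on (U : set V) (f : V -> W) : Prop := forall k, Ck k U f.

(* Smoothness on an arbitrary subset, e.g. a submanifold: f is near each point
   of A the restriction of a smooth map defined on an open subset of V. *)
Definition smooth_map (A : set V) (f : V -> W) : Prop :=
  forall x, A x -> exists (U : set V) (F : V -> W),
    [/\ open U, U x, smooth_on U F & forall y, U y -> A y -> F y = f y].

End SmoothMaps.

(* Maps between subsets A and B are total functions of which only the values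
   on A matter. *)
Definition diffeo {R : realType} {V W : normedModType R}
    (A : set V) (B : set W) (f : V -> W) : Prop :=
  [/\ forall x, A x -> B (f x),
      smooth_map A f &
      exists g : W -> V,
        [/\ forall y, B y -> A (g y),
            smooth_map B g,
            forall x, A x -> g (f x) = x &
            forall y, B y -> f (g y) = y]].

Section Submanifolds.
Context {R : realType} {V : normedModType R}.

(* A submanifold of a submanifold M of V is a submanifold of V contained
   in M. *)
Definition submanifold (k : nat) (M : set V) : Prop :=
  forall x, M x -> exists (O : set V) (D : set 'rV[R]_k) (f : V -> 'rV[R]_k),
    [/\ open O, O x, open D & diffeo (M `&` O) D f].

Definition curve_at (M : set V) (x u : V) (c : R -> V) : Prop :=
  exists2 e : R, 0 < e &
    [/\ smooth_on (ball (0 : R) e) c,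
        forall t, ball (0 : R) e t -> M (c t),
        c 0 = x & derive1 c 0 = u].

Definition tangent (M : set V) (x u : V) : Prop :=
  exists c : R -> V, curve_at M x u c.

(* df_x(u) = (f o c)'(0) for a curve c in M through x with velocity u; this
   does not depend on c when f is smooth on M. *)
Definition dmap {W : normedModType R} (M : set V) (f : V -> W) (x u : V) : W :=
  xget (0 : W) [set w | exists2 c, curve_at M x u c & w = derive1 (f \o c) 0].

Definition vector_field (M : set V) (X : V -> V) : Prop :=
  smooth_map M X /\ (forall x, M x -> tangent M x (X x)).

Definition lie_bracket (M : set V) (X Y : V -> V) (x : V) : V :=
  dmap M Y x (X x) - dmap M X x (Y x).

(* Exterior derivative of the 1-form a on V.  As d commutes with pullback, its
   values on vectors tangent to a submanifold are those of the exterior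
   derivative of the restriction of a to that submanifold. *)
Definition ext_d (a : V -> V -> R) (x u v : V) : R :=
  'D_u (fun y => a y v) x - 'D_v (fun y => a y u) x.

End Submanifolds.

(* Here g x u v and s x u v are only meaningful for u and v tangent at x. *)
Record magnetic_system {R : realType} (V : normedModType R) := MagneticSystem {
  carrier : set V ;
  metric : V -> V -> V -> R ;
  mform : V -> V -> V -> R }.

Section Connections.
Context {R : realType} {V : normedModType R}.

(* nabla Y x u is the covariant derivative at x of Y along u. *)
Record levi_civita (M : set V) (g : V -> V -> V -> R)
    (nabla : (V -> V) -> V -> V -> V) : Prop := LeviCivita {
  lc_tangent : forall Y x u, vector_field M Y -> M x -> tangent M x u ->
    tangent M x (nabla Y x u) ;
  lc_smooth : forall X Y, vector_field M X -> vector_field M Y ->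
    smooth_map M (fun x => nabla Y x (X x)) ;
  lc_linear : forall Y x (a : R) u v, vector_field M Y -> M x ->
    tangent M x u -> tangent M x v ->
    nabla Y x (a *: u + v) = a *: nabla Y x u + nabla Y x v ;
  lc_additive : forall Y Z x u, vector_field M Y -> vector_field M Z ->
    M x -> tangent M x u ->
    nabla (fun y => Y y + Z y) x u = nabla Y x u + nabla Z x u ;
  lc_leibniz : forall (f : V -> R) Y x u, smooth_map M f ->
    vector_field M Y -> M x -> tangent M x u ->
    nabla (fun y => f y *: Y y) x u = dmap M f x u *: Y x + f x *: nabla Y x u ;
  lc_metric : forall Y Z x u, vector_field M Y -> vector_field M Z ->
    M x -> tangent M x u ->
    dmap M (fun y => g y (Y y) (Z y)) x u =
      g x (nabla Y x u) (Z x) + g x (Y x) (nabla Z x u) ;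
  lc_torsion_free : forall X Y x, vector_field M X -> vector_field M Y ->
    M x -> nabla Y x (X x) - nabla X x (Y x) = lie_bracket M X Y x }.

(* a is the covariant derivative at time t of the vector field w along the
   curve c: writing w = \sum_i f_i (X_i o c) near t with vector fields X_i on
   M, it is \sum_i (f_i'(t) X_i(c(t)) + f_i(t) nabla_{c'(t)} X_i). *)
Definition cov_deriv (M : set V) (nabla : (V -> V) -> V -> V -> V)
    (c w : R -> V) (t : R) (a : V) : Prop :=
  exists (m : nat) (f : 'I_m -> R -> R) (X : 'I_m -> V -> V),
  exists2 e : R, 0 < e &
    [/\ forall i, smooth_on (ball t e) (f i),
        forall i, vector_field M (X i),
        forall s, ball t e s -> w s = \sum_(i < m) f i s *: X i (c s) &
        a = \sum_(i < m) (derive1 (f i) t *: X i (c t) +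
                          f i t *: nabla (X i) (c t) (derive1 c t))].

Implicit Type S : magnetic_system V.

Definition lorentz_force S (Y : V -> V -> V) : Prop :=
  forall x u, carrier S x -> tangent (carrier S) x u ->
    tangent (carrier S) x (Y x u) /\
    (forall v, tangent (carrier S) x v -> metric S x (Y x u) v = mform S x u v).

Definition magnetic_geodesic S (I : set R) (c : R -> V) : Prop :=
  [/\ open I, is_interval I, smooth_on I c, forall t, I t -> carrier S (c t) &
      exists nabla Y, [/\ levi_civita (carrier S) (metric S) nabla,
        lorentz_force S Y &
        forall t, I t ->
          cov_deriv (carrier S) nabla c (derive1 c) t (Y (c t) (derive1 c t))]].

Definition totally_magnetic S (N : set V) : Prop :=
  forall (I : set R) (c : R -> V), magnetic_geodesic S I c -> I 0 ->
    N (c 0) -> tangent N (c 0) (derive1 c 0) ->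
    exists2 e : R, 0 < e & forall t, - e < t < e -> I t /\ N (c t).

(* The submanifold N of S with the pullbacks of the metric and of the 2-form
   along the inclusion. *)
Definition pullback_system S (N : set V) : magnetic_system V :=
  MagneticSystem N (metric S) (mform S).

End Connections.

Definition magnetomorphism {R : realType} {V W : normedModType R}
    (S1 : magnetic_system V) (S2 : magnetic_system W) (f : V -> W) : Prop :=
  [/\ diffeo (carrier S1) (carrier S2) f,
      forall x u v, carrier S1 x ->
        tangent (carrier S1) x u -> tangent (carrier S1) x v ->
        metric S2 (f x) (dmap (carrier S1) f x u) (dmap (carrier S1) f x v) =
          metric S1 x u v &
      forall x u v, carrier S1 x ->
        tangent (carrier S1) x u -> tangent (carrier S1) x v ->
        mform S2 (f x) (dmap (carrier S1) f x u) (dmap (carrier S1) f x v) =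
          mform S1 x u v].

Definition Mag {R : realType} {V : normedModType R} (S : magnetic_system V) :
    set (carrier S -> carrier S) :=
  [set f | exists2 F : V -> V, magnetomorphism S S F &
             forall x : carrier S, \val (f x) = F (\val x)].
Arguments Mag {R V} S.

Section TangentBundle.
Context {R : realType} {V : normedModType R}.

Definition tangent_bundle (M : set V) : set (V * V)%type :=
  [set p | M p.1 /\ tangent M p.1 p.2].

Definition tangent_lift (M : set V) (f : V -> V) (p : V * V) : V * V :=
  (f p.1, dmap M f p.1 p.2).

(* The projection of the tangent bundle is p |-> p.1, with differential
   xi |-> xi.1. *)
Definition liouville (g : V -> V -> V -> R) (p xi : V * V) : R :=
  g p.1 p.2 xi.1.

Definition twisted_form (S : magnetic_system V) (p xi eta : V * V) : R :=
  ext_d (liouville (metric S)) p xi eta - mform S p.1 xi.1 eta.1.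

Definition symplectomorphism (P : set (V * V)%type)
    (omega : V * V -> V * V -> V * V -> R) (F : V * V -> V * V) : Prop :=
  diffeo P P F /\
  (forall p xi eta, P p -> tangent P p xi -> tangent P p eta ->
     omega (F p) (dmap P F p xi) (dmap P F p eta) = omega p xi eta).

End TangentBundle.

(* C^m as the real normed space R^m x R^m, z = (x, y) standing for x + iy. *)
Notation Cvec R m := ('cV[R]_m * 'cV[R]_m)%type.

Section ComplexSpace.
Context {R : realType}.
Local Notation C := (R[i])%C.

Definition toC m n (Z : 'M[R]_(m, n) * 'M[R]_(m, n)) : 'M[C]_(m, n) :=
  \matrix_(i, j) (Z.1 i j +i* Z.2 i j)%C.

Definition ofC m n (A : 'M[C]_(m, n)) : 'M[R]_(m, n) * 'M[R]_(m, n) :=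
  (map_mx (@complex.Re R) A, map_mx (@complex.Im R) A).

Definition act_mx m (A : 'M[C]_m) (z : Cvec R m) : Cvec R m := ofC (A *m toC z).

(* Conjugate-linear in the first argument; the convention is immaterial since
   only squared norms and real parts are used below. *)
Definition herm m (z w : Cvec R m) : C :=
  \sum_(k < m) (toC z k ord0)^* * toC w k ord0.

Definition imul m (z : Cvec R m) : Cvec R m := ofC ('i *: toC z).

Definition sphere n : set (Cvec R n.+1) := [set z | herm z z = 1].

Definition round_metric n (z u v : Cvec R n.+1) : R := complex.Re (herm u v).

Definition alpha n (z u : Cvec R n.+1) : R :=
  2^-1 * complex.Re (herm (imul z) u).

Definition sphere_system n : magnetic_system (Cvec R n.+1) :=
  MagneticSystem (@sphere n) (@round_metric n) (ext_d (@alpha n)).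

(* The sum of A^k / k!, taken in the real normed space of pairs (Re, Im). *)
Definition expmx n (A : 'M[C]_n.+1) : 'M[C]_n.+1 :=
  let T := ('M[R]_n.+1 * 'M[R]_n.+1)%type : normedModType R in
  toC (lim (series (fun k => ofC (k`!%:R^-1 *: A ^+ k) : T) @ \oo)).

Definition u_alg m : set 'M[C]_m := [set A | A ^t* = - A].

Definition inf_generator n (A : 'M[C]_n.+1) (p : Cvec R n.+1 * Cvec R n.+1) :
    Cvec R n.+1 * Cvec R n.+1 :=
  derive1 (fun t : R => tangent_lift (@sphere n) (act_mx (expmx (t%:C%C *: A))) p) 0.

Definition mu n (p : Cvec R n.+1 * Cvec R n.+1) (A : 'M[C]_n.+1) : R :=
  round_metric p.1 (act_mx A p.1) p.2 - alpha p.1 (act_mx A p.1).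

(* m is a smooth map to the dual of the real vector space u(n+1) such that
   iota_{X_A} omega = - d(m[A]), where X_A is inf_generator A. *)
Definition moment_map n
    (omega : Cvec R n.+1 * Cvec R n.+1 -> Cvec R n.+1 * Cvec R n.+1 ->
             Cvec R n.+1 * Cvec R n.+1 -> R)
    (m : Cvec R n.+1 * Cvec R n.+1 -> 'M[C]_n.+1 -> R) : Prop :=
  let TS := tangent_bundle (@sphere n) in
  [/\ forall p (a : R) A B, TS p -> u_alg A -> u_alg B ->
        m p (a%:C%C *: A + B) = a * m p A + m p B,
      forall A, u_alg A -> smooth_map TS (m^~ A) &
      forall A p eta, u_alg A -> TS p -> tangent TS p eta ->
        omega p (inf_generator A p) eta = - dmap TS (m^~ A) p eta].

End ComplexSpace.

(* Main.v *)
Require Import Defs.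
From HB Require Import structures.
From mathcomp Require Import all_boot all_order all_algebra.
From mathcomp Require Import complex ring lra.
From mathcomp Require Import all_classical all_reals all_analysis.

Set Implicit Arguments.
Unset Strict Implicit.
Unset Printing Implicit Defensive.

Import Order.TTheory GRing.Theory Num.Theory.
Import numFieldNormedType.Exports.

Local Open Scope classical_set_scope.
Local Open Scope ring_scope.

(** The sphere is studied through the real inner product [ip] and the complex
    structure [J] of the ambient space: the tangent space at [z] is the orthogonal
    complement of [z], and the magnetic form is [ip (J u) v].

    Magnetomorphisms. A unitary matrix preserves [ip] and commutes with [J]. Let
    conversely [F] be a magnetomorphism. The cone over [F] maps the segment from [x]
    to [y] to a curve of the same constant speed, so the chord from [F x] to [F y]
    is not longer than the chord from [x] to [y] (isometric_chord); with the same
    bound for the inverse, [F] preserves [ip] on the sphere, hence is the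
    restriction of a linear map and equals its own differential. Preservation of
    the magnetic form at a point orthogonal to [e] and [J e], which exists because
    the complex dimension is at least two, gives [F (J e) = J (F e)] for each basis
    vector [e], so the matrix with columns [F e] is unitary and represents [F]
    (magneto_unitary).

    Moment map. On the tangent bundle the lifted action is linear, the twisted form
    has constant coefficients (twistedE), and the moment map is quadratic. The
    generator of the one-parameter group of [A] is [A] itself, by termwise
    differentiation of the exponential series (is_derive_expmx), and the identity
    of moment maps is a computation with skew-Hermitian [A].

    Magnetic geodesics. The Levi-Civita connection is the tangential part of the
    ambient derivative (round_levi_civita, levi_civita_unique). The magnetic
    geodesics are therefore the solutions of [c'' = J c' - m c], where
    [m = ip (J c') c + ip c' c'] is constant along [c] (geodesic_energy). This
    linear equation commutes with complex-linear projections, whence every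
    intersection of the sphere with a complex subspace is totally magnetic
    (subsphere_totally_magnetic). Its solutions are sums of two rotations
    (helix_magnetic).

    Totally magnetic submanifolds. Let [N] be one. As [N] is closed, it contains
    every complete magnetic geodesic that is tangent to it once (helix_stays). Fast
    magnetic geodesics are nearly great circles and [N] is closed, so [N] contains
    the great circles tangent to it (great_circle_in): it contains the great sphere
    of the real span [V z] of [z] and of the tangent space at [z] (tspan_sub), and
    coincides with it near [z] (tspan_local). A magnetic geodesic through [z] with
    velocity [v] stays in [V z], and its acceleration is [J v] up to a multiple of
    [z], so [J v] lies in [V z] (tspan_J_tangent). Applied at the point [v], where
    [V v = V z] and [z] is a tangent vector, this shows that [J z] lies in [V z] too
    (tspan_J_base): [V z] is a complex subspace. Along the great sphere of [V z]
    the space [V y] does not change, so this great sphere is open and closed in the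
    connected set [N] and equals it. An orthonormal basis of [V z] identifies [N]
    with a standard sphere (subsphere_magnetomorphic). *)

(** * Calculus in finite-dimensional normed spaces *)

Section Frames.
Context {R : realType}.

(** A finite-dimensional space, given by linear coordinates. The coordinates are
    data so that they can be read off from matrices and products. *)
Class frame (V : normedModType R) := Frame {
  fdim : nat ;
  fbasis : 'I_fdim -> V ;
  fcoord : 'I_fdim -> V -> R ;
  fcoord_lin : forall i, linear (fcoord i : V -> R^o) ;
  fcoord_cont : forall i, continuous (fcoord i) ;
  frameE : forall v, v = \sum_(i < fdim) fcoord i v *: fbasis i }.
Arguments fdim V {frame}.

Definition lin_of (V W : lmodType R) (f : V -> W) (fl : linear f) :
  {linear V -> W} := HB.pack f (GRing.isLinear.Build R V W *:%R f fl).

Lemma lin_comb (V W : lmodType R) (f : V -> W) (n : nat) (a : 'I_n -> R)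
    (e : 'I_n -> V) : linear f ->
  f (\sum_(i < n) a i *: e i) = \sum_(i < n) a i *: f (e i).
Proof.
move=> fl; rewrite -[f]/(lin_of fl : V -> W) linear_sum.
by apply: eq_bigr => i _; rewrite linearZ.
Qed.

Lemma lin_ZB (V W : lmodType R) (f : V -> W) a u v : linear f ->
  f (a *: (u - v)) = a *: (f u - f v).
Proof. by move=> fl; rewrite -[f]/(lin_of fl : V -> W) linearZ linearB. Qed.

Global Instance frame_R : frame R.
Proof.
refine (@Frame R 1 (fun=> 1) (fun=> id) _ _ _).
- by move=> i a u v.
- by move=> i x.
- by move=> v; rewrite big_ord1 /GRing.scale/= mulr1.
Defined.

Global Instance frame_mx (m n : nat) : frame 'M[R]_(m, n).
Proof.
refine (@Frame 'M[R]_(m, n) #|{: 'I_m * 'I_n}|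
  (fun i => delta_mx (enum_val i).1 (enum_val i).2)
  (fun i A => A (enum_val i).1 (enum_val i).2) _ _ _).
- by move=> i a u v; rewrite !mxE.
- by move=> i; exact: coord_continuous.
- move=> v; rewrite [LHS]matrix_sum_delta pair_bigA /=.
  by rewrite (reindex (fun k : 'I_#|{: 'I_m * 'I_n}| => enum_val k))//=;
    exact: onW_bij (@enum_val_bij _).
Defined.

Global Instance frame_prod (V W : normedModType R) {fV : frame V} {fW : frame W} :
  frame (V * W)%type.
Proof.
refine (@Frame (V * W)%type (fdim V + fdim W)
  (fun i => match fintype.split i with inl j => (fbasis j, 0) | inr j => (0, fbasis j) end)
  (fun i p => match fintype.split i with inl j => fcoord j p.1 | inr j => fcoord j p.2 end)
  _ _ _).
- by move=> i a u v; case: (fintype.split i) => j; exact: fcoord_lin.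
- move=> i p; case: (fintype.split i) => j.
    by apply: continuous_comp; [exact: cvg_fst|exact: fcoord_cont].
  by apply: continuous_comp; [exact: cvg_snd|exact: fcoord_cont].
- case=> v w; rewrite big_split_ord/=.
  under eq_bigr => i _.
    rewrite (_ : fintype.split (lshift _ i) = inl i); last exact: (unsplitK (inl i)). over.
  under [X in _ + X]eq_bigr => i _.
    rewrite (_ : fintype.split (rshift _ i) = inr i); last exact: (unsplitK (inr i)). over.
  rewrite /= [in LHS](frameE v) [in LHS](frameE w).
  have E1 n (a : 'I_n -> R) (e : 'I_n -> V) :
      \sum_(i < n) a i *: ((e i, 0) : V * W) = (\sum_(i < n) a i *: e i, 0).
    elim/big_ind2 : _ => // [x1 x2 y1 y2 -> ->|i _].
      by congr pair; rewrite /= addr0.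
    by congr pair; rewrite /= scaler0.
  have E2 n (a : 'I_n -> R) (e : 'I_n -> W) :
      \sum_(i < n) a i *: ((0, e i) : V * W) = (0, \sum_(i < n) a i *: e i).
    elim/big_ind2 : _ => // [x1 x2 y1 y2 -> ->|i _].
      by congr pair; rewrite /= addr0.
    by congr pair; rewrite /= scaler0.
  by rewrite E1 E2; congr pair; rewrite /= ?addr0 ?add0r.
Defined.

Lemma sum_fctE (T : Type) (W : zmodType) n (h : 'I_n -> T -> W) x :
  (\sum_(i < n) h i) x = \sum_(i < n) h i x.
Proof. by rewrite fct_sumE. Qed.

Lemma cvg_sum (T : Type) (F : set_system T) (FF : Filter F) (W : normedModType R) n
    (f : 'I_n -> T -> W) (a : 'I_n -> W) : (forall i, f i @ F --> a i) ->
  (fun x => \sum_(i < n) f i x) @ F --> \sum_(i < n) a i.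
Proof.
elim: n f a => [|n IH] f a fa.
  rewrite big_ord0 (_ : (fun x => _) = cst 0); first exact: cvg_cst.
  by apply/funext => x; rewrite big_ord0.
rewrite big_ord_recr/=.
rewrite (_ : (fun x => _) = fun x => \sum_(i < n) f (widen_ord (leqnSn n) i) x + f ord_max x);
  last by apply/funext => x; rewrite big_ord_recr.
by apply: cvgD => //; apply: IH => i.
Qed.

Section Linear.
Context {V W : normedModType R} {fV : frame V}.
Variables (f : V -> W) (fl : linear f).

Lemma lin_frame v : f v = \sum_(i < fdim V) fcoord i v *: f (fbasis i).
Proof. by rewrite {1}(frameE v) lin_comb. Qed.

Lemma lin_continuous : continuous f.
Proof.
move=> x; rewrite (_ : f = fun v => \sum_(i < fdim V) fcoord i v *: f (fbasis i));
  last by apply/funext => v; exact: lin_frame.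
by apply: cvg_sum => i; apply: cvgZr_tmp; exact: fcoord_cont.
Qed.

Lemma lin_differentiable x : differentiable f x.
Proof.
by apply: (@linear_differentiable _ _ _ (lin_of fl)) => y; exact: lin_continuous.
Qed.

Lemma lin_diff x v : 'd f x v = f v.
Proof. by rewrite (@diff_lin _ _ _ (lin_of fl))// => y; exact: lin_continuous. Qed.

Lemma lin_derive x v : 'D_v f x = f v.
Proof. by rewrite deriveE ?lin_diff//; exact: lin_differentiable. Qed.

End Linear.

(** The remainder of [g] equals that of [f] near [x], so the differential of [f]
    serves for [g]. *)
Lemma differentiable_near (V W : normedModType R) (f g : V -> W) x :
  (\near x, f x = g x) -> differentiable f x -> differentiable g x /\ 'd g x = 'd f x :> (V -> W).
Proof.
move=> fg df; have [dc dfE] := (diff_locallyP x f).1 df.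
have gE : g \o shift x = cst (g x) + 'd f x +o_ 0 id.
  apply/eqaddoP => _/posnumP[e].
  have /eqaddoP/(_ e%:num (gt0 _)) := dfE => H.
  have fg0 : \forall h \near 0, f (h + x) = g (h + x).
    have : \forall z \near x, f z = g z by [].
    by rewrite (near_shift 0 x); apply: filterS => h /=; rewrite subr0.
  near=> h.
  have -> : ((g \o shift x) - (cst (g x) + 'd f x)) h =
            ((f \o shift x) - (cst (f x) + 'd f x)) h.
    rewrite /= !fctE/= (nbhs_singleton fg); congr (_ - _).
    by apply/esym; near: h.
  by near: h.
have dgE : 'd g x = 'd f x :> (V -> W) by exact: diff_unique.
by split; [apply/diff_locallyP; rewrite dgE|exact: dgE].
Unshelve. all: by end_near. Qed.

Lemma is_derive_lin (U V W : normedModType R) {fV : frame V} (f : V -> W)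
    (c : U -> V) x u dc : linear f ->
  is_derive x u c dc -> is_derive x u (f \o c) (f dc).
Proof.
move=> fl [cd <-].
have H : (fun h => h^-1 *: (((f \o c) \o shift x) (h *: u) - (f \o c) x)) @ 0^' -->
    f ('D_u c x).
  rewrite (_ : (fun h => _) =
      f \o (fun h : R => h^-1 *: ((c \o shift x) (h *: u) - c x))); last first.
    by apply/funext => h /=; rewrite lin_ZB.
  by apply: continuous_cvg; [exact: lin_continuous|exact: cd].
apply: DeriveDef; first by apply/cvg_ex; exists (f ('D_u c x)).
exact: cvg_lim H.
Qed.

Lemma is_derive_scale (U W : normedModType R) {fW : frame W} (a : U -> R)
    (f : U -> W) x u da df : is_derive x u a da -> is_derive x u f df ->
  is_derive x u (fun y => a y *: f y) (da *: f x + a x *: df).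
Proof.
move=> ad fd.
have lc i : linear (fcoord i : W -> R) by exact: fcoord_lin.
have li (i : 'I_(fdim W)) : linear (fun r : R => r *: fbasis i : W).
  by move=> k r s; rewrite scalerDl scalerA.
rewrite (_ : (fun y => _) =
  \sum_(i < fdim W) ((fun r : R => r *: (fbasis i : W)) \o
    (a * (fcoord i \o f)))); last first.
  apply/funext => y; rewrite sum_fctE {1}(frameE (f y)) scaler_sumr.
  by apply: eq_bigr => i _; rewrite scalerA.
apply: is_derive_eq.
  by apply: is_derive_sum => i; apply: is_derive_lin (li i) _;
    apply: is_deriveM; apply: is_derive_lin (lc i) _.
rewrite [in RHS](frameE (f x)) [in RHS](frameE df) !scaler_sumr -big_split/=.
apply: eq_bigr => i _; rewrite !scalerA scalerDl addrC; congr (_ + _).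
by rewrite /GRing.scale/= mulrC.
Qed.

(** In coordinates of the first argument, [b] is a sum of products of a real
    function with a linear function of the second argument. *)
Lemma is_derive_bilin (U V V' W : normedModType R) {fV : frame V} {fV' : frame V'}
    {fW : frame W} (b : V -> V' -> W) (c : U -> V) (d : U -> V') x u dc dd :
  (forall w, linear (b^~ w)) -> (forall v, linear (b v)) ->
  is_derive x u c dc -> is_derive x u d dd ->
  is_derive x u (fun y => b (c y) (d y)) (b dc (d x) + b (c x) dd).
Proof.
move=> bl br cd dd'.
have lc i : linear (fcoord i : V -> R) by exact: fcoord_lin.
rewrite (_ : (fun y => _) =
  \sum_(i < fdim V) (fun y => fcoord i (c y) *: b (fbasis i) (d y))); last first.
  apply/funext => y; rewrite sum_fctE {1}(frameE (c y)).
  exact: (@lin_comb _ _ (b^~ (d y))).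
apply: is_derive_eq.
  apply: is_derive_sum => i; apply: is_derive_scale.
    exact: (is_derive_lin (lc i) cd).
  exact: (is_derive_lin (br _) dd').
rewrite big_split/=; congr (_ + _).
  by rewrite [in RHS](frameE dc) (@lin_comb _ _ (b^~ (d x))).
by rewrite [in RHS](frameE (c x)) (@lin_comb _ _ (b^~ dd)).
Qed.

Lemma is_derive_differentiable (V W : normedModType R) (f : V -> W) x v :
  differentiable f x -> is_derive x v f ('d f x v).
Proof. by move=> df; rewrite -deriveE//; apply: derivableP; exact: diff_derivable. Qed.

Lemma differentiable_curve (V : normedModType R) (c : R -> V) t u :
  is_derive t (1 : R) c u -> differentiable c t.
Proof. by move=> [cd _]; exact/derivable1_diffP. Qed.

Lemma is_derive_chain (V W : normedModType R) (f : V -> W) (c : R -> V) t u :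
  differentiable f (c t) -> is_derive t (1 : R) c u ->
  is_derive t (1 : R) (f \o c) ('d f (c t) u).
Proof.
move=> df cd; have dc := differentiable_curve cd.
have := is_derive_differentiable (1 : R) (differentiable_comp dc df).
by rewrite diff_comp//= -(deriveE _ dc) (@derive_val _ _ _ _ _ _ _ cd).
Qed.

Lemma diff_frame (V W : normedModType R) {fV : frame V} (F : V -> W) x u :
  differentiable F x -> 'd F x u = \sum_(i < fdim V) fcoord i u *: 'D_(fbasis i) F x.
Proof.
move=> dF; rewrite {1}(frameE u) linear_sum; apply: eq_bigr => i _.
by rewrite linearZ/=; congr (_ *: _); exact/esym/deriveE.
Qed.

Section CkTheory.
Context {V : normedModType R}.

(** Openness of [U] makes equality on [U] an equality near each of its points, which
    is what the derivatives depend on. *)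
Lemma Ck_eq (W : normedModType R) k (U : set V) (f g : V -> W) : open U ->
  (forall x, U x -> f x = g x) -> Ck k U f -> Ck k U g.
Proof.
move=> oU; elim: k f g => [|k IH] f g fg /=.
  move=> cf x Ux; have fgx : \forall y \near x, f y = g y.
    by have := open_nbhs_nbhs (conj oU Ux); apply: filterS => y; exact: fg.
  suff : g @ x --> g x by []; rewrite -(fg x Ux); apply: cvg_trans (cf x Ux).
  by apply: near_eq_cvg; apply: filterS fgx.
move=> [df Cf]; have fgx x : U x -> \forall y \near x, f y = g y.
  by move=> Ux; have := open_nbhs_nbhs (conj oU Ux); apply: filterS => y; exact: fg.
split=> [x Ux|v].
  by have [] := differentiable_near (fgx x Ux) (df x Ux).
by apply: (IH ('D_v f)) (Cf v) => x Ux; apply: near_eq_derive; exact: fgx.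
Qed.

Lemma Ck_sub (W : normedModType R) k (U U' : set V) (f : V -> W) : U' `<=` U ->
  Ck k U f -> Ck k U' f.
Proof.
move=> UU'; elim: k f => [|k IH] f /=; first by move=> cf x /UU'; exact: cf.
by move=> [df Cf]; split=> [x /UU'|v]; [exact: df|exact: IH].
Qed.

Lemma CkW (W : normedModType R) k (U : set V) (f : V -> W) : Ck k.+1 U f -> Ck k U f.
Proof.
elim: k f => [|k IH] f; first by move=> [df _] x Ux; exact/differentiable_continuous/df.
by move=> [df Cf]; split=> // v; apply: IH; exact: Cf.
Qed.

Lemma Ck_cst (W : normedModType R) k (U : set V) (a : W) : open U -> Ck k U (cst a).
Proof.
move=> oU; elim: k a => [|k IH] a /=; first by move=> x _; exact: cvg_cst.
split=> [x _|v]; first exact: differentiable_cst.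
by apply: (@Ck_eq _ k U (cst 0)) (IH 0) => // x _; rewrite derive_cst.
Qed.

Lemma CkD (W : normedModType R) k (U : set V) (f g : V -> W) : open U ->
  Ck k U f -> Ck k U g -> Ck k U (fun x => f x + g x).
Proof.
move=> oU; elim: k f g => [|k IH] f g /=.
  by move=> cf cg x Ux; apply: cvgD; [exact: cf|exact: cg].
move=> [df Cf] [dg Cg]; split=> [x Ux|v].
  by apply: differentiableD; [exact: df|exact: dg].
apply: Ck_eq (IH _ _ (Cf v) (Cg v)) => // x Ux.
by rewrite -deriveD//; apply: diff_derivable; [exact: df|exact: dg].
Qed.

Lemma Ck_sum (W : normedModType R) k (U : set V) n (f : 'I_n -> V -> W) : open U ->
  (forall i, Ck k U (f i)) -> Ck k U (fun x => \sum_(i < n) f i x).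
Proof.
move=> oU Cf; elim: n f Cf => [|n IH] f Cf.
  by apply: (Ck_eq (f := cst 0)) => // [x _|]; [rewrite big_ord0|exact: Ck_cst].
apply: (Ck_eq (f := fun x => \sum_(i < n) f (widen_ord (leqnSn n) i) x + f ord_max x))
    => // [x _|].
  by rewrite big_ord_recr.
by apply: CkD => //; apply: IH => i; exact: Cf.
Qed.

Lemma Ck_lin (W W' : normedModType R) {fW : frame W} k (U : set V) (f : V -> W)
    (l : W -> W') : linear l -> open U -> Ck k U f -> Ck k U (fun x => l (f x)).
Proof.
move=> ll oU; elim: k f => [|k IH] f /=.
  move=> cf x Ux; apply: (@continuous_comp _ _ _ f l); first exact: cf.
  exact: lin_continuous.
move=> [df Cf]; split=> [x Ux|v].
  apply: (@differentiable_comp _ _ _ _ f l); first exact: df.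
  exact: lin_differentiable.
apply: Ck_eq (IH _ (Cf v)) => // x Ux.
apply/esym; apply: derive_val; apply: is_derive_lin => //.
by apply: derivableP; apply: diff_derivable; exact: df.
Qed.

Lemma Ck_scale (W : normedModType R) {fW : frame W} k (U : set V) (a : V -> R)
    (f : V -> W) : open U ->
  Ck k U a -> Ck k U f -> Ck k U (fun x => a x *: f x).
Proof.
move=> oU; elim: k a f => [|k IH] a f.
  by move=> ca cf x Ux; apply: cvgZ; [exact: ca|exact: cf].
move=> Ha Hf; have [da Ca] := Ha; have [df Cf] := Hf; split=> [x Ux|v].
  rewrite (_ : (fun y => _) =
    \sum_(i < fdim W) (fun y => (a * (fcoord i \o f)) y *: (fbasis i : W))); last first.
    apply/funext => y; rewrite sum_fctE {1}(frameE (f y)) scaler_sumr.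
    by apply: eq_bigr => i _; rewrite scalerA.
  apply: differentiable_sum => i; apply: differentiableZl; apply: differentiableM.
    exact: da.
  apply: differentiable_comp; first exact: df.
  by apply: lin_differentiable; exact: fcoord_lin.
apply: (Ck_eq (f := fun x => 'D_v a x *: f x + a x *: 'D_v f x)) => // [x Ux|].
  apply/esym; apply: derive_val; apply: is_derive_scale;
  by apply: derivableP; apply: diff_derivable; first [exact: da | exact: df].
by apply: CkD => //; apply: IH; first [exact: Ca | exact: Cf | exact: CkW].
Qed.

End CkTheory.

(** The derivative of the composite is a combination, with coefficients the
    coordinates of [D_v h], of partial derivatives of [f] composed with [h]; all of
    them are one degree less smooth. *)
Lemma Ck_comp (V W X : normedModType R) {fW : frame W} {fX : frame X} k
    (U : set V) (U' : set W) (h : V -> W) (f : W -> X) :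
  open U -> open U' -> (forall x, U x -> U' (h x)) ->
  Ck k U h -> Ck k U' f -> Ck k U (fun x => f (h x)).
Proof.
move=> oU oU' UU'; elim: k f h UU' => [|k IH] f h UU'.
  move=> ch cf x Ux; apply: (@continuous_comp _ _ _ h f); first exact: ch.
  exact/cf/UU'.
move=> Hh Hf; have [dh Ch] := Hh; have [df Cf] := Hf; split=> [x Ux|v].
  by apply: (@differentiable_comp _ _ _ _ h f); [exact: dh|exact/df/UU'].
apply: (Ck_eq (f := fun x => \sum_(i < fdim W)
    fcoord i ('D_v h x) *: 'D_(fbasis i) f (h x))) => // [x Ux|].
  have dfx := df _ (UU' _ Ux).
  rewrite (deriveE v (differentiable_comp (dh x Ux) dfx)) diff_comp//; last exact: dh.
  rewrite -[RHS]/('d f (h x) ('d h x v)) -(deriveE v (dh x Ux)).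
  exact/esym/diff_frame.
apply: Ck_sum => // i; apply: Ck_scale => //.
  by apply: (Ck_lin (l := fcoord i : W -> R));
    [exact: fcoord_lin|exact: oU|exact: Ch].
by apply: (IH ('D_(fbasis i) f) h) => //; [exact: CkW|exact: Cf].
Qed.

Lemma Ck_linear (V W : normedModType R) {fV : frame V} k (U : set V) (f : V -> W) :
  linear f -> open U -> Ck k U f.
Proof.
move=> fl oU; case: k => [|k]; first by move=> x _; exact: lin_continuous.
split=> [x _|v]; first exact: lin_differentiable.
apply: (Ck_eq (f := cst (f v))) => // [x _|]; last exact: Ck_cst.
by rewrite lin_derive.
Qed.

Lemma smooth_on_derive (V W : normedModType R) (U : set V) (f : V -> W) v :
  smooth_on U f -> smooth_on U ('D_v f).
Proof. by move=> fs k; have [_] := fs k.+1; exact. Qed.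

Lemma smooth_on_differentiable (V W : normedModType R) (U : set V) (f : V -> W) x :
  smooth_on U f -> U x -> differentiable f x.
Proof. by move=> /(_ 1) [df _]; exact: df. Qed.

Lemma smooth_on_continuous (V W : normedModType R) (U : set V) (f : V -> W) x :
  smooth_on U f -> U x -> {for x, continuous f}.
Proof. by move=> /(_ 0); exact. Qed.

Lemma smooth_bilin (U V V' W : normedModType R) {fV : frame V} {fW : frame W}
   {fV' : frame V'} (b : V -> V' -> W) (O : set U) (c : U -> V) (d : U -> V') :
  (forall w, linear (b^~ w)) -> (forall v, linear (b v)) -> open O ->
  smooth_on O c -> smooth_on O d -> smooth_on O (fun y => b (c y) (d y)).
Proof.
move=> bl br oO cs ds k.
apply: (Ck_eq (f := fun y =>
  \sum_(i < fdim V) fcoord i (c y) *: b (fbasis i) (d y))) => // [x Ux|].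
  by rewrite {2}(frameE (c x)) (@lin_comb _ _ (b^~ (d x))).
apply: Ck_sum => // i; apply: Ck_scale => //; last exact: Ck_lin.
by apply: (Ck_lin (l := fcoord i : V -> R)) => //; exact: fcoord_lin.
Qed.

End Frames.

Arguments fdim {R} V {frame}.

(** * Complex coordinates, the real inner product and the complex structure *)

Local Open Scope sesquilinear_scope.

Section Hermitian.
Context {R : realType}.
Local Notation C := (R[i])%C.

Lemma eq_cplx (x y : C) : complex.Re x = complex.Re y ->
  complex.Im x = complex.Im y -> x = y.
Proof. by case: x y => [a b] [c d] /= -> ->. Qed.

Lemma ReD (x y : C) : complex.Re (x + y) = complex.Re x + complex.Re y.
Proof. by case: x y => [a b] [c d]. Qed.

Lemma ImD (x y : C) : complex.Im (x + y) = complex.Im x + complex.Im y.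
Proof. by case: x y => [a b] [c d]. Qed.

Lemma ReM (x y : C) : complex.Re (x * y) =
  complex.Re x * complex.Re y - complex.Im x * complex.Im y.
Proof. by case: x y => [a b] [c d]. Qed.

Lemma ImM (x y : C) : complex.Im (x * y) =
  complex.Re x * complex.Im y + complex.Im x * complex.Re y.
Proof. by case: x y => [a b] [c d]. Qed.

Lemma ReN (x : C) : complex.Re (- x) = - complex.Re x.
Proof. by case: x. Qed.

Lemma ImN (x : C) : complex.Im (- x) = - complex.Im x.
Proof. by case: x. Qed.

Lemma Re_conj (x : C) : complex.Re x^* = complex.Re x.
Proof. by case: x. Qed.

Lemma Im_conj (x : C) : complex.Im x^* = - complex.Im x.
Proof. by case: x. Qed.

Lemma ReI : complex.Re ('i : C) = 0.
Proof. by rewrite -complexiE. Qed.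

Lemma ImI : complex.Im ('i : C) = 1.
Proof. by rewrite -complexiE. Qed.

Lemma Re_sum (I : Type) (r : seq I) (P : pred I) (F : I -> C) :
  complex.Re (\sum_(i <- r | P i) F i) = \sum_(i <- r | P i) complex.Re (F i).
Proof. by apply: (big_morph _ ReD). Qed.

Lemma Im_sum (I : Type) (r : seq I) (P : pred I) (F : I -> C) :
  complex.Im (\sum_(i <- r | P i) F i) = \sum_(i <- r | P i) complex.Im (F i).
Proof. by apply: (big_morph _ ImD). Qed.

Definition cplxE := (ReD, ImD, ReM, ImM, ReN, ImN, Re_conj, Im_conj, ReI, ImI).

Lemma toC_Re m n (Z : 'M[R]_(m, n) * 'M[R]_(m, n)) i j :
  complex.Re (toC Z i j) = Z.1 i j.
Proof. by rewrite mxE. Qed.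

Lemma toC_Im m n (Z : 'M[R]_(m, n) * 'M[R]_(m, n)) i j :
  complex.Im (toC Z i j) = Z.2 i j.
Proof. by rewrite mxE. Qed.

Lemma toCK m n : cancel (@toC R m n) (@ofC R m n).
Proof.
by case=> X Y; congr pair; apply/matrixP => i j; rewrite mxE ?toC_Re ?toC_Im.
Qed.

Lemma ofCK m n : cancel (@ofC R m n) (@toC R m n).
Proof. by move=> A; apply/matrixP => i j; apply: eq_cplx; rewrite ?toC_Re ?toC_Im mxE. Qed.

Lemma toC_inj m n : injective (@toC R m n).
Proof. exact: can_inj (@toCK m n). Qed.

Lemma ofC_inj m n : injective (@ofC R m n).
Proof. exact: can_inj (@ofCK m n). Qed.

Lemma toC_lin m n (a : R) (Z W : 'M[R]_(m, n) * 'M[R]_(m, n)) :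
  toC (a *: Z + W) = a%:C%C *: toC Z + toC W.
Proof.
apply/matrixP => i j; apply: eq_cplx; rewrite ?(toC_Re, toC_Im) !mxE !cplxE/= ?mxE.
  by rewrite mul0r subr0.
by rewrite mul0r addr0.
Qed.

Lemma toCZ m n (a : R) (Z : 'M[R]_(m, n) * 'M[R]_(m, n)) :
  toC (a *: Z) = a%:C%C *: toC Z.
Proof.
apply/matrixP => i j; apply: eq_cplx; rewrite ?(toC_Re, toC_Im) !mxE !cplxE/= ?mxE.
  by rewrite mul0r subr0.
by rewrite mul0r addr0.
Qed.

Lemma toC0 m n : toC (0 : 'M[R]_(m, n) * 'M[R]_(m, n)) = 0.
Proof. by apply/matrixP => i j; apply: eq_cplx; rewrite ?(toC_Re, toC_Im) !mxE. Qed.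

Lemma ofC_lin m n (a : R) (A B : 'M[C]_(m, n)) :
  ofC (a%:C%C *: A + B) = a *: ofC A + ofC B.
Proof. by apply: toC_inj; rewrite toC_lin !ofCK. Qed.

(** Agrees with [act_mx] on square matrices. *)
Definition cact p m (B : 'M[C]_(p, m)) (z : Cvec R m) : Cvec R p := ofC (B *m toC z).

Lemma cact_lin p m (B : 'M[C]_(p, m)) : linear (cact B).
Proof.
by move=> a u v; rewrite /cact toC_lin mulmxDr -scalemxAr ofC_lin.
Qed.

Lemma cactM p m q (A : 'M[C]_(p, m)) (B : 'M[C]_(m, q)) z :
  cact (A *m B) z = cact A (cact B z).
Proof. by rewrite /cact ofCK mulmxA. Qed.

Lemma cact1 m (z : Cvec R m) : cact 1%:M z = z.
Proof. by rewrite /cact mul1mx toCK. Qed.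

Section InnerProduct.
Context {m : nat}.
Implicit Types u v w z : Cvec R m.

Definition ip u v : R := complex.Re (herm u v).
Definition J z : Cvec R m := imul z.

Lemma ipE u v :
  ip u v = \sum_k (u.1 k ord0 * v.1 k ord0 + u.2 k ord0 * v.2 k ord0).
Proof.
rewrite /ip /herm Re_sum; apply: eq_bigr => k _.
by rewrite !cplxE !toC_Re !toC_Im mulNr opprK.
Qed.

Lemma ip_linl w : linear (ip^~ w).
Proof.
move=> a u v; rewrite !ipE /GRing.scale/= mulr_sumr -big_split/=.
by apply: eq_bigr => k _; rewrite !mxE; ring.
Qed.

Lemma ipC u v : ip u v = ip v u.
Proof. by rewrite !ipE; apply: eq_bigr => k _; rewrite mulrC; congr (_ + _); rewrite mulrC. Qed.

Lemma ip_linr v : linear (ip v).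
Proof. by move=> a u w; rewrite ipC ip_linl ipC (ipC w). Qed.

Lemma ipDl u v w : ip (u + v) w = ip u w + ip v w.
Proof. by have := ip_linl w 1 u v; rewrite !scale1r. Qed.
Lemma ip0l w : ip 0 w = 0.
Proof. by apply: (addrI (ip 0 w)); rewrite -ipDl !addr0. Qed.
Lemma ipZl a u w : ip (a *: u) w = a * ip u w.
Proof. by have := ip_linl w a u 0; rewrite addr0 ip0l addr0. Qed.
Lemma ipNl u w : ip (- u) w = - ip u w.
Proof. by rewrite -scaleN1r ipZl mulN1r. Qed.
Lemma ipDr u v w : ip w (u + v) = ip w u + ip w v.
Proof. by rewrite ipC ipDl !(ipC w). Qed.
Lemma ipZr a u w : ip w (a *: u) = a * ip w u.
Proof. by rewrite ipC ipZl (ipC w). Qed.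
Lemma ipNr u w : ip w (- u) = - ip w u.
Proof. by rewrite ipC ipNl (ipC w). Qed.
Lemma ip0r w : ip w 0 = 0.
Proof. by rewrite ipC ip0l. Qed.

Definition ipP := (ipDl, ipDr, ipNl, ipNr, ipZl, ipZr, ip0l, ip0r).

Lemma ip_ge0 u : 0 <= ip u u.
Proof. by rewrite ipE sumr_ge0// => k _; rewrite addr_ge0// -expr2 sqr_ge0. Qed.

Lemma ip_eq0 u : ip u u = 0 -> u = 0.
Proof.
rewrite ipE => /eqP; rewrite psumr_eq0; last first.
  by move=> k _; rewrite addr_ge0// -expr2 sqr_ge0.
move=> /allP H; case: u H => x y H; congr pair; apply/matrixP => k l;
  rewrite !ord1 mxE; have := H k (mem_index_enum _);
  by rewrite /= paddr_eq0 -?expr2 ?sqr_ge0// !sqrf_eq0 => /andP[/eqP ? /eqP].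
Qed.

Lemma ip_inj u v : (forall w, ip u w = ip v w) -> u = v.
Proof.
move=> uv; apply/eqP; rewrite -subr_eq0; apply/eqP/ip_eq0.
by rewrite ipDl ipNl uv subrr.
Qed.

Lemma ip_gt0 u : u != 0 -> 0 < ip u u.
Proof.
move=> u0; rewrite lt_neqAle ip_ge0 andbT; apply: contra u0 => /eqP/esym/ip_eq0 ->.
exact: eqxx.
Qed.

(** The square of the norm of [ip v v *: u - ip u v *: v] is nonnegative. *)
Lemma ip_CS u v : ip u v ^+ 2 <= ip u u * ip v v.
Proof.
have [->|v0] := eqVneq v 0; first by rewrite !ip0r expr0n/= mulr0.
have vv := ip_gt0 v0.
have := ip_ge0 (ip v v *: u - ip u v *: v).
rewrite !ipP (ipC v u); set a := ip u u; set b := ip u v; set c := ip v v in vv *.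
move=> H; have : 0 <= c * (a * c - b ^+ 2) by apply: le_trans H _; rewrite le_eqVlt; apply/orP; left; apply/eqP; ring.
by rewrite pmulr_rge0// subr_ge0.
Qed.

Lemma JE z : J z = (- z.2, z.1).
Proof.
apply: toC_inj; rewrite /J /imul ofCK; apply/matrixP => i j.
by apply: eq_cplx; rewrite !mxE !cplxE/= ?mxE; ring.
Qed.

Lemma J_lin : linear J.
Proof.
move=> a u v; rewrite !JE; congr pair => /=.
by rewrite opprD scalerN.
Qed.

Lemma JD u v : J (u + v) = J u + J v.
Proof. by have := J_lin 1 u v; rewrite !scale1r. Qed.
Lemma JN u : J (- u) = - J u.
Proof. by rewrite !JE; congr pair. Qed.
Lemma JZ a u : J (a *: u) = a *: J u.
Proof. by rewrite !JE; congr pair; rewrite /= scalerN. Qed.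
Lemma J0 : J 0 = 0.
Proof. by rewrite JE /= oppr0. Qed.
Lemma JJ u : J (J u) = - u.
Proof. by rewrite !JE. Qed.

Definition JP := (JD, JN, JZ, JJ).

Lemma ipJl u v : ip (J u) v = - ip u (J v).
Proof. by rewrite !ipE JE (JE v) -sumrN; apply: eq_bigr => k _ /=; rewrite !mxE; ring. Qed.

Lemma ipJJ u v : ip (J u) (J v) = ip u v.
Proof. by rewrite ipJl JJ ipNr opprK. Qed.

Lemma ipJ0 u : ip (J u) u = 0.
Proof. by have := ipJl u u; rewrite [in RHS]ipC => /eqP; rewrite -addr_eq0 -mulr2n mulrn_eq0/= => /eqP. Qed.

Lemma ip0J u : ip u (J u) = 0.
Proof. by rewrite ipC ipJ0. Qed.

(** The real part of the Hermitian product is [ip], and its imaginary part is [ip]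
    after [J] because the product is conjugate-linear on the left. *)
Lemma hermE u v : herm u v = (ip u v +i* ip (J u) v)%C.
Proof.
apply: eq_cplx => //=; rewrite /herm Im_sum ipE; apply: eq_bigr => k _.
by rewrite !cplxE !toC_Re !toC_Im JE /= !mxE; ring.
Qed.

Lemma ipDl_eq u v w a b : ip u w = a -> ip v w = b -> ip (u + v) w = a + b.
Proof. by move=> <- <-; exact: ipDl. Qed.
Lemma ipNl_eq u w a : ip u w = a -> ip (- u) w = - a.
Proof. by move=> <-; exact: ipNl. Qed.
Lemma ipZl_eq k u w a : ip u w = a -> ip (k *: u) w = k * a.
Proof. by move=> <-; exact: ipZl. Qed.
Lemma ipDr_eq u v w a b : ip w u = a -> ip w v = b -> ip w (u + v) = a + b.
Proof. by move=> <- <-; exact: ipDr. Qed.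
Lemma ipNr_eq u w a : ip w u = a -> ip w (- u) = - a.
Proof. by move=> <-; exact: ipNr. Qed.
Lemma ipZr_eq k u w a : ip w u = a -> ip w (k *: u) = k * a.
Proof. by move=> <-; exact: ipZr. Qed.
Lemma ip_eql u u' w a : u = u' -> ip u' w = a -> ip u w = a.
Proof. by move=> ->. Qed.
Lemma ip_eqr u u' w a : u = u' -> ip w u' = a -> ip w u = a.
Proof. by move=> ->. Qed.

End InnerProduct.

Lemma cactJ p m (B : 'M[C]_(p, m)) z : cact B (J z) = J (cact B z).
Proof. by rewrite /cact /J /imul ofCK -scalemxAr ofCK. Qed.

Lemma herm_mx m (u v : Cvec R m) : herm u v = ((toC u)^t* *m toC v) ord0 ord0.
Proof. by rewrite mxE; apply: eq_bigr => k _; rewrite !mxE. Qed.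

Lemma ip_adj p m (B : 'M[C]_(p, m)) u v : ip (cact B u) v = ip u (cact (B^t*) v).
Proof.
rewrite /ip !herm_mx /cact !ofCK; congr (complex.Re _).
by rewrite mulmxA trmx_mul map_mxM.
Qed.

(** Move [B] to the other side by its adjoint: only [v] has to lie in the initial
    space of the partial isometry. *)
Lemma ip_isometry p m (B : 'M[C]_(p, m)) u v :
  cact (B^t* *m B) v = v -> ip (cact B u) (cact B v) = ip u v.
Proof. by move=> BB; rewrite ip_adj -cactM BB. Qed.

Lemma adjK p m (B : 'M[C]_(p, m)) : (B^t*)^t* = B.
Proof. by apply/matrixP => i j; rewrite !mxE; apply: eq_cplx; rewrite !cplxE ?opprK. Qed.

Lemma unitary_cact m (U : 'M[C]_m) : U \is unitarymx ->
  (U^t* *m U = 1%:M) * (U *m U^t* = 1%:M).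
Proof. by move=> /unitarymxP UU; split=> //; exact: mulmx1C. Qed.

End Hermitian.

Lemma round_metricE (R : realType) n (z u v : Cvec R n.+1) : round_metric z u v = ip u v.
Proof. by []. Qed.

Lemma alphaE (R : realType) n (z u : Cvec R n.+1) : alpha z u = 2^-1 * ip (J z) u.
Proof. by []. Qed.

(* Keeps conversion from unfolding sums over coordinates. *)
Global Opaque ip J.

(** Expansion of [ip] and [J]. The proof term is built from the syntax of the
    vectors, because a rewriting search would compare them up to conversion and
    unfold pairs of matrices and real constants. *)
Ltac ip_pf_r x y :=
  match y with
  | (?u + ?v) => let p := ip_pf_r x u in let q := ip_pf_r x v in
                 constr:(ipDr_eq p q)
  | (- ?u) => let p := ip_pf_r x u in constr:(ipNr_eq p)
  | (?a *: ?u) => let p := ip_pf_r x u in constr:(ipZr_eq a p)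
  | 0 => constr:(ip0r x)
  | J (?u + ?v) => let p := ip_pf_r x constr:(J u + J v) in constr:(ip_eqr (JD u v) p)
  | J (- ?u) => let p := ip_pf_r x constr:(- J u) in constr:(ip_eqr (JN u) p)
  | J (?a *: ?u) => let p := ip_pf_r x constr:(a *: J u) in constr:(ip_eqr (JZ a u) p)
  | J (J ?u) => let p := ip_pf_r x constr:(- u) in constr:(ip_eqr (JJ u) p)
  | _ => constr:(erefl (ip x y))
  end.

Ltac ip_pf x y :=
  match x with
  | (?u + ?v) => let p := ip_pf u y in let q := ip_pf v y in
                 constr:(ipDl_eq p q)
  | (- ?u) => let p := ip_pf u y in constr:(ipNl_eq p)
  | (?a *: ?u) => let p := ip_pf u y in constr:(ipZl_eq a p)
  | 0 => constr:(ip0l y)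
  | J (?u + ?v) => let p := ip_pf constr:(J u + J v) y in constr:(ip_eql (JD u v) p)
  | J (- ?u) => let p := ip_pf constr:(- J u) y in constr:(ip_eql (JN u) p)
  | J (?a *: ?u) => let p := ip_pf constr:(a *: J u) y in constr:(ip_eql (JZ a u) p)
  | J (J ?u) => let p := ip_pf constr:(- u) y in constr:(ip_eql (JJ u) p)
  | _ => ip_pf_r x y
  end.

Ltac ip_expand_in x y :=
  let p := ip_pf x y in
  match type of p with
  | _ = ?e =>
    let p' := constr:(p : ip x y = e) in
    let t := fresh in let Ht := fresh in
    generalize p'; generalize (ip x y); intros t Ht; rewrite {}Ht {t}
  end.

Ltac ip_composite x :=
  match x with
  | (_ + _) => idtac
  | (- _) => idtac
  | (_ *: _) => idtac
  | 0 => idtac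
  | J ?u => match u with
    | (_ + _) => idtac | (- _) => idtac | (_ *: _) => idtac | J _ => idtac
    end
  end.

Ltac ip_expand :=
  repeat match goal with
  | |- context [ip ?x ?y] => first [ip_composite x | ip_composite y]; ip_expand_in x y
  end.

Ltac ip_atoms :=
  repeat match goal with |- context [ip ?x ?y] => generalize (ip x y); intro end.

(** Vector identities are checked on inner products with a test vector, where
    they become identities in a field. *)
Ltac vring := cbv beta; apply: ip_inj => ?; ip_expand; ip_atoms; ring.
Ltac vfield := cbv beta; apply: ip_inj => ?; ip_expand; ip_atoms; field.

(** * Differentials on subsets, rotations, and the tangent spaces of the sphere *)

Section Curves.
Context {R : realType}.

Lemma is_derive1 (V : normedModType R) (c : R -> V) t u :
  is_derive t (1 : R) c u -> derive1 c t = u.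
Proof. by move=> cd; rewrite derive1E (@derive_val _ _ _ _ _ _ _ cd). Qed.

Lemma differentiable_is_derive1 (V : normedModType R) (c : R -> V) t :
  differentiable c t -> is_derive t (1 : R) c (derive1 c t).
Proof. by move=> /derivable1_diffP; rewrite derive1E; exact: derivableP. Qed.

Lemma is_derive_uniq (V W : normedModType R) (f : V -> W) x v a b :
  is_derive x v f a -> is_derive x v f b -> a = b.
Proof. by move=> [_ <-] [_ <-]. Qed.

Lemma is_derive_continuous (V : normedModType R) (c : R -> V) t u :
  is_derive t (1 : R) c u -> {for t, continuous c}.
Proof. by move=> /differentiable_curve/differentiable_continuous. Qed.

Lemma is_derive_near (V : normedModType R) (c : R -> V) t u (P : set V) :
  is_derive t (1 : R) c u -> (\forall y \near c t, P y) -> \forall s \near t, P (c s).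
Proof. by move=> /is_derive_continuous cc Pc; exact: (cc P Pc). Qed.

Lemma curve_atP (V : normedModType R) (M : set V) x u c : curve_at M x u c ->
  [/\ is_derive (0 : R) (1 : R) c u, \forall t \near (0 : R), M (c t) & c 0 = x].
Proof.
case=> e e0 [cs cM c0 cu]; split=> //.
  rewrite -cu; apply: differentiable_is_derive1.
  by apply: (smooth_on_differentiable cs); exact: ballxx.
by have := nbhsx_ballx (0 : R) e e0; apply: filterS => t; exact: cM.
Qed.

Lemma tangentP (V : normedModType R) (M : set V) x u : tangent M x u ->
  exists c : R -> V, [/\ is_derive (0 : R) (1 : R) c u,
    \forall t \near (0 : R), M (c t) & c 0 = x].
Proof. by case=> c /curve_atP; exists c. Qed.

(** Every curve with velocity [u] gives the same derivative, by the chain rule for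
    the extension [F]. *)
Lemma dmapE (V W : normedModType R) (M : set V) (f F : V -> W) x u :
  tangent M x u -> differentiable F x -> (\forall y \near x, M y -> F y = f y) ->
  dmap M f x u = 'd F x u.
Proof.
move=> [c0 c0c] dF Ff.
have key c : curve_at M x u c -> derive1 (f \o c) 0 = 'd F x u.
  move=> /curve_atP[cd cM cx].
  have dF' : differentiable F (c 0) by rewrite cx.
  have := is_derive_chain dF' cd; rewrite cx => H.
  apply: is_derive1; apply: near_eq_is_derive H.
  have Fc : \forall t \near (0 : R), M (c t) -> F (c t) = f (c t).
    by apply: (is_derive_near (P := fun y => M y -> F y = f y) cd); rewrite cx.
  by near=> t; apply: (near Fc t) => //; near: t.
rewrite /dmap; case: xgetP => [w _ [c cc ->]|/(_ ('d F x u))]; first exact: key.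
by case; exists c0 => //; rewrite key.
Unshelve. all: by end_near. Qed.

Lemma smooth_dmap (V W : normedModType R) (M : set V) (f : V -> W) x :
  smooth_map M f -> M x -> exists (O : set V) (F : V -> W),
  [/\ open O, O x, smooth_on O F, (forall y, O y -> M y -> F y = f y) &
      forall y u, O y -> M y -> tangent M y u -> dmap M f y u = 'd F y u].
Proof.
move=> fs Mx; have [D [F [oD Dx sF FE]]] := fs x Mx.
exists D, F; split=> // y u Oy My tu; apply: dmapE => //.
  exact: (smooth_on_differentiable sF Oy).
have := open_nbhs_nbhs (conj oD Oy); apply: filterS => z Oz Mz; exact: FE.
Qed.

(** The chain rule for [dmap] along curves that are differentiable at one point,
    such as normalized segments. *)
Lemma is_derive_dmap (V W : normedModType R) (M : set V) (f : V -> W) (c : R -> V) t dc :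
  smooth_map M f -> M (c t) -> tangent M (c t) dc ->
  (\forall s \near t, M (c s)) -> is_derive t (1 : R) c dc ->
  is_derive t (1 : R) (f \o c) (dmap M f (c t) dc).
Proof.
move=> fs Mc tdc cM cd; have [D [F [oD Dx sF FE FdE]]] := smooth_dmap fs Mc.
rewrite (FdE (c t) dc Dx Mc tdc).
apply: near_eq_is_derive (is_derive_chain (smooth_on_differentiable sF Dx) cd).
have Oc : \forall s \near t, D (c s).
  by apply: (is_derive_near cd); exact: open_nbhs_nbhs.
by near=> s; apply: FE; near: s.
Unshelve. all: by end_near. Qed.

Lemma smooth_map_on (V W : normedModType R) (M : set V) (f : V -> W) :
  smooth_on setT f -> smooth_map M f.
Proof. by move=> fs x Mx; exists setT, f; split=> //; exact: openT. Qed.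

Lemma smooth_map_eq (V W : normedModType R) (M : set V) (f g : V -> W) :
  (forall x, M x -> f x = g x) -> smooth_map M f -> smooth_map M g.
Proof.
move=> fg fs x Mx; have [D [F [oD Dx sF FE]]] := fs x Mx; exists D, F; split=> //.
by move=> y Oy My; rewrite FE// fg.
Qed.

Lemma smooth_on_lin (V W : normedModType R) {fV : frame V} (U : set V) (f : V -> W) :
  linear f -> open U -> smooth_on U f.
Proof. by move=> fl oU k; exact: Ck_linear. Qed.

Lemma smooth_on_comp (V W X : normedModType R) {fW : frame W} {fX : frame X}
    (U : set V) (U' : set W) (h : V -> W) (f : W -> X) :
  open U -> open U' -> (forall x, U x -> U' (h x)) ->
  smooth_on U h -> smooth_on U' f -> smooth_on U (fun x => f (h x)).
Proof. by move=> oU oU' UU' sh sf k; exact: (Ck_comp oU oU' UU'). Qed.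

Lemma smooth_onD (V W : normedModType R) (U : set V) (f g : V -> W) : open U ->
  smooth_on U f -> smooth_on U g -> smooth_on U (fun x => f x + g x).
Proof. by move=> oU fs gs k; exact: CkD. Qed.

Lemma smooth_onZ (V W : normedModType R) {fW : frame W} (U : set V) (a : V -> R)
    (f : V -> W) : open U ->
  smooth_on U a -> smooth_on U f -> smooth_on U (fun x => a x *: f x).
Proof. by move=> oU fs gs k; exact: Ck_scale. Qed.

Lemma smooth_on_cst (V W : normedModType R) (U : set V) (a : W) : open U ->
  smooth_on U (fun=> a).
Proof. by move=> oU k; exact: Ck_cst. Qed.

Lemma smooth_on_sub (V W : normedModType R) (U U' : set V) (f : V -> W) :
  U' `<=` U -> smooth_on U f -> smooth_on U' f.
Proof. by move=> UU' fs k; exact: Ck_sub (fs k). Qed.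

Lemma smooth_map_lin (V W : normedModType R) {fV : frame V} (M : set V) (f : V -> W) :
  linear f -> smooth_map M f.
Proof. by move=> fl; apply: smooth_map_on; apply: smooth_on_lin => //; exact: openT. Qed.

Lemma dmap_lin (V W : normedModType R) {fV : frame V} (M : set V) (f g : V -> W) x u :
  linear g -> (forall y, M y -> f y = g y) -> tangent M x u ->
  dmap M f x u = g u.
Proof.
move=> gl fg tu; rewrite (@dmapE _ _ _ _ g)//; first exact: lin_diff.
  exact: lin_differentiable.
by near=> y => My; rewrite fg.
Unshelve. all: by end_near. Qed.

Lemma tangent_lin (V W : normedModType R) {fV : frame V} (M : set V) (g : V -> W)
    (b : W) x u :
  linear g -> (forall y, M y -> g y = b) -> tangent M x u -> g u = 0.
Proof.
move=> gl gb /tangentP[c [cd cM cx]].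
apply: (is_derive_uniq (is_derive_lin gl cd)).
apply: near_eq_is_derive (is_derive_cst b (0 : R) (1 : R)).
by near=> t; rewrite /= gb//; near: t.
Unshelve. all: by end_near. Qed.

Lemma is_derive_rescale (V : normedModType R) (c : R -> V) (w t : R) u :
  is_derive (w * t) (1 : R) c u -> is_derive t (1 : R) (fun s => c (w * s)) (w *: u).
Proof.
move=> cd; have dc := differentiable_curve cd.
have dw : is_derive t (1 : R) (fun s : R => w * s) w.
  apply: is_derive_eq (is_deriveZ w (is_derive_id (t : R) (1 : R))) _.
  by rewrite /GRing.scale/= mulr1.
have := @is_derive_chain _ _ _ c (fun s => w * s) t w dc dw.
rewrite -(deriveE _ dc) => H; apply: is_derive_eq H _.
rewrite (deriveE _ dc) -[w in 'd _ _ w]mulr1 -[w * 1]/(w *: (1 : R^o)) linearZ/=.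
by rewrite -(deriveE _ dc) (@derive_val _ _ _ _ _ _ _ cd).
Qed.

Lemma is_derive_shift1 (V : normedModType R) (c : R -> V) (r t : R) u :
  is_derive (r + t) (1 : R) c u -> is_derive t (1 : R) (fun s => c (r + s)) u.
Proof.
move=> cd; have dc := differentiable_curve cd.
have dw : is_derive t (1 : R) (fun s : R => r + s) 1.
  rewrite -[X in is_derive _ _ _ X]add0r.
  by apply: (is_deriveD (f := cst r)).
have := @is_derive_chain _ _ _ c (fun s => r + s) t 1 dc dw.
by rewrite -(deriveE _ dc) (@derive_val _ _ _ _ _ _ _ cd).
Qed.

Lemma derive_R (V : normedModType R) (c : R -> V) t v : differentiable c t ->
  'D_v c t = v *: 'D_1 c t.
Proof.
move=> dc; rewrite !(deriveE _ dc) -[v in LHS]mulr1 -[v * 1]/(v *: (1 : R^o)).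
by rewrite linearZ.
Qed.

(** In one variable all directional derivatives are multiples of the derivative. *)
Lemma Ck_R (V : normedModType R) {fV : frame V} k (U : set R) (c dc : R -> V) : open U ->
  (forall t, U t -> is_derive t (1 : R) c (dc t)) -> Ck k U dc -> Ck k.+1 U c.
Proof.
move=> oU cd Cdc; have dfc t : U t -> differentiable c t.
  by move=> Ut; exact: differentiable_curve (cd _ Ut).
split=> // v; apply: (Ck_eq (f := fun t => cst v t *: dc t)) => // [t Ut|].
  rewrite derive_R; last exact: dfc.
  by rewrite (@derive_val _ _ _ _ _ _ _ (cd t Ut)).
by apply: Ck_scale => //; exact: Ck_cst.
Qed.

Lemma smooth_on_derive1 (V : normedModType R) (U : set R) (c : R -> V) :
  smooth_on U c -> smooth_on U (derive1 c).
Proof.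
by move=> cs; rewrite (_ : derive1 c = 'D_1 c); [exact: smooth_on_derive|
  apply/funext => t; rewrite derive1E].
Qed.

End Curves.

Section Rotation.
Context {R : realType} {m : nat}.
Implicit Types A B z u v : Cvec R m.

Definition rot (a : R) z : Cvec R m := cos a *: z + sin a *: J z.

Lemma rotJ a z : rot a (J z) = J (rot a z).
Proof. by rewrite /rot !JP. Qed.

Lemma rot0 z : rot 0 z = z.
Proof. by rewrite /rot cos0 sin0 scale1r scale0r addr0. Qed.

Lemma rotD a b z : rot (a + b) z = rot a (rot b z).
Proof.
by rewrite /rot cosD sinD; vring.
Qed.

Lemma ip_rot a u v : ip (rot a u) (rot a v) = ip u v.
Proof.
rewrite /rot; move: (cos a) (sin a) (cos2Dsin2 a) => c s cs.
by ip_expand; rewrite !ipJJ !ipJl -[RHS]mul1r -cs; ring.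
Qed.

Lemma is_derive_rot (w t : R) z :
  is_derive t (1 : R) (fun s => rot (w * s) z) (rot (w * t) (w *: J z)).
Proof.
have dcos : is_derive t (1 : R) (fun t => cos (w * t)) (w * - sin (w * t)).
  exact: is_derive_rescale.
have dsin : is_derive t (1 : R) (fun t => sin (w * t)) (w * cos (w * t)).
  exact: is_derive_rescale.
pose proof (is_derive_scale dcos (is_derive_cst z t (1 : R))) as H1.
pose proof (is_derive_scale dsin (is_derive_cst (J z) t (1 : R))) as H2.
apply: is_derive_eq (is_deriveD H1 H2) _.
by rewrite /rot /cst; vring.
Qed.

(** A superposition of two rotations of angular speeds [a] and [b]. The derivative
    of a helix is again a helix with the same speeds. *)
Definition helix (a b : R) A B (t : R) : Cvec R m := rot (a * t) A + rot (b * t) B.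

Lemma is_derive_helix a b A B t :
  is_derive t (1 : R) (helix a b A B) (helix a b (a *: J A) (b *: J B) t).
Proof. by apply: is_deriveD; exact: is_derive_rot. Qed.

Lemma smooth_helix a b A B : smooth_on setT (helix a b A B).
Proof.
suff H k : forall A B, Ck k setT (helix a b A B) by move=> k.
elim: k => [|k IH] {}A {}B.
  by move=> t _; exact: is_derive_continuous (is_derive_helix a b A B t).
by apply: Ck_R (fun t _ => is_derive_helix a b A B t) _ => //; exact: openT.
Qed.

Lemma helix_shift a b A B r t :
  helix a b A B (r + t) = helix a b (rot (a * r) A) (rot (b * r) B) t.
Proof. by rewrite /helix !mulrDr !(addrC (_ * r)) !rotD. Qed.

Lemma helix0 a b A B : helix a b A B 0 = A + B.
Proof. by rewrite /helix !mulr0 !rot0. Qed.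

End Rotation.

Section Sphere.
Context {R : realType} {n : nat}.
Implicit Types z u v : Cvec R n.+1.

Lemma sphereE z : sphere z <-> ip z z = 1.
Proof.
rewrite /sphere/= hermE ipJ0; split=> [[]//|->]; exact: eq_cplx.
Qed.

Lemma is_derive_ip (U : normedModType R) (c d : U -> Cvec R n.+1) (t w : U)
    dc dd : is_derive t w c dc -> is_derive t w d dd ->
  is_derive t w (fun s => ip (c s) (d s)) (ip dc (d t) + ip (c t) dd).
Proof. by apply: is_derive_bilin; [exact: ip_linl|exact: ip_linr]. Qed.

Lemma smooth_ip (U : normedModType R) (O : set U) (c d : U -> Cvec R n.+1) : open O ->
  smooth_on O c -> smooth_on O d -> smooth_on O (fun s => ip (c s) (d s)).
Proof. by apply: smooth_bilin; [exact: ip_linl|exact: ip_linr]. Qed.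

(** Differentiate [ip (c s) (c s) = 1]. *)
Lemma sphere_is_derive (c : R -> Cvec R n.+1) t dc :
  (\forall s \near t, sphere (c s)) -> is_derive t (1 : R) c dc -> ip (c t) dc = 0.
Proof.
move=> cS cd; have H := is_derive_ip cd cd.
have H0 : is_derive t (1 : R) (fun s => ip (c s) (c s)) 0.
  apply: near_eq_is_derive (is_derive_cst (1 : R) t (1 : R)).
  by near=> s; apply/esym/sphereE; near: s.
have := is_derive_uniq H H0; rewrite ipC -mulr2n => /eqP.
by rewrite mulrn_eq0/= => /eqP.
Unshelve. all: by end_near. Qed.

(** The great circle from [z] with initial velocity [u], written as a helix. *)
Definition great_circle z u : R -> Cvec R n.+1 :=
  let r := Num.sqrt (ip u u) in
  helix r (- r) (2^-1 *: (z - r^-1 *: J u)) (2^-1 *: (z + r^-1 *: J u)).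

Lemma great_circleE z u t : let r := Num.sqrt (ip u u) in
  great_circle z u t = cos (r * t) *: z + sin (r * t) *: (r^-1 *: u).
Proof.
move=> r; rewrite /great_circle /helix -/r mulNr /rot cosN sinN.
move: (cos _) (sin _) r^-1 => c s q.
by vfield.
Qed.

Lemma great_circle_sphere z u t : sphere z -> ip z u = 0 -> sphere (great_circle z u t).
Proof.
move=> /sphereE zz zu; apply/sphereE; rewrite great_circleE.
have [->|u0] := eqVneq u 0.
  by rewrite ip0l sqrtr0 mul0r cos0 sin0 !scale0r addr0 scale1r.
have r0 : Num.sqrt (ip u u) != 0 by rewrite sqrtr_eq0 -ltNge ip_gt0.
move: r0 (sqr_sqrtr (ip_ge0 u)) (cos2Dsin2 (Num.sqrt (ip u u) * t)).
move: (cos _) (sin _) => c s; move: (Num.sqrt _) => r r0 rr cs.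
have q : r^-1 ^+ 2 * r ^+ 2 = 1 by field.
move: r^-1 q => q qr; ip_expand; rewrite zz (ipC u z) zu -rr.
by transitivity (c ^+ 2 + s ^+ 2 * (q ^+ 2 * r ^+ 2)); [ring|rewrite qr mulr1].
Qed.

Lemma is_derive_great_circle z u :
  is_derive (0 : R) (1 : R) (great_circle z u) u.
Proof.
apply: is_derive_eq (is_derive_helix _ _ _ _ _) _; rewrite helix0.
have [->|u0] := eqVneq u 0.
  by rewrite ip0l sqrtr0 oppr0 !scale0r addr0.
have : Num.sqrt (ip u u) != 0 by rewrite sqrtr_eq0 -ltNge ip_gt0.
move: (Num.sqrt _) => r r0; have : r * r^-1 = 1 by field.
move: r^-1 => q qr; apply: ip_inj => w; ip_expand.
by transitivity ((r * q) * ip u w); [field|rewrite qr mul1r].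
Qed.

Lemma great_circle0 z u : great_circle z u 0 = z.
Proof. 
rewrite /great_circle helix0; move: (Num.sqrt _)^-1 => q.
by vfield.
 Qed.

Lemma tangent_sphere z u : sphere z -> tangent (@sphere R n) z u <-> ip z u = 0.
Proof.
move=> Sz; split.
  move=> /tangentP[c [cd cS c0]]; rewrite -c0; exact: sphere_is_derive cS cd.
move=> zu; exists (great_circle z u); exists 1 => //; split.
- by apply: smooth_on_sub (smooth_helix _ _ _ _).
- by move=> t _; exact: great_circle_sphere.
- exact: great_circle0.
- exact: is_derive1 (is_derive_great_circle z u).
Qed.

End Sphere.

(** * Isometries of the round sphere *)


Section RoundIsometries.
Context {R : realType} {n : nat}.
Implicit Types (x y z u v w : Cvec R n.+1) (F G : Cvec R n.+1 -> Cvec R n.+1).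
Local Notation S := (@sphere R n).

Lemma mformE x u v : ext_d (@alpha R n) x u v = ip (J u) v.
Proof.
have D a b : 'D_a (fun y => alpha y b) x = 2^-1 * ip (J a) b.
  rewrite (@lin_derive _ _ _ _ (fun y => alpha y b)) => [//|k p q].
  by rewrite !alphaE; ip_expand; ip_atoms => *; rewrite /GRing.scale/=; ring.
by rewrite /ext_d !D (ipJl v u) (ipC v (J u)); ip_atoms; field.
Qed.

Lemma ip_sphere_geN1 x y : S x -> S y -> -1 <= ip x y.
Proof.
move=> /sphereE xx /sphereE yy; have := ip_ge0 (x + y).
by ip_expand; rewrite xx yy (ipC y x) => H; lra.
Qed.

Lemma sphere_eq x y : S x -> S y -> ip x y = 1 -> x = y.
Proof.
move=> /sphereE xx /sphereE yy xy; apply/eqP; rewrite -subr_eq0; apply/eqP/ip_eq0.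
by ip_expand; rewrite xx yy (ipC y x) xy; ring.
Qed.

Definition isometric F := [/\ smooth_map S F, forall x, S x -> S (F x) &
  forall x u, S x -> tangent S x u -> ip (dmap S F x u) (dmap S F x u) = ip u u].

(** The curve [r t *: F (c t)], where [r t *: c t] is the segment from [x] to [y]
    in polar form, has the velocity norm of the segment: on both sides radial and
    angular velocities are orthogonal, and [F] preserves the angular one. The mean
    value theorem for the component along [F y - F x] then bounds the chord. The
    segment avoids the origin because [y != - x]. *)
Lemma isometric_chord F x y : isometric F -> S x -> S y -> y != - x ->
  ip x y <= ip (F x) (F y).
Proof.
move=> [sF FS Fiso] Sx Sy yNx.
have xx := (sphereE x).1 Sx; have yy := (sphereE y).1 Sy.
pose g (t : R) := x + t *: (y - x).
have gd (t : R) : is_derive t (1 : R) g (y - x).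
  rewrite -[X in is_derive _ _ _ X]add0r.
  apply: (is_deriveD (f := cst x)).
  pose proof (is_derive_scale (is_derive_id t (1 : R)) (is_derive_cst (y - x) t (1 : R))) as H.
  by apply: is_derive_eq H _; rewrite scale1r scaler0 addr0.
pose q (t : R) := ip (g t) (g t).
have q0 t : 0 < q t.
  apply: ip_gt0; apply/eqP => gt0; move/eqP: yNx; apply.
  have E : (1 - t) *: x = - (t *: y).
    by apply/eqP; rewrite -addr_eq0 -gt0 /g; apply/eqP; vring.
  have : ip ((1 - t) *: x) ((1 - t) *: x) = ip (- (t *: y)) (- (t *: y)) by rewrite E.
  ip_expand; rewrite xx yy => t2; have {}t2 : t = 2^-1 by lra.
  have : (2^-1 : R) *: (x + y) = 0 by rewrite -gt0 /g t2; vfield.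
  move=> /eqP; rewrite scaler_eq0 invr_eq0 pnatr_eq0/= addrC addr_eq0 => /eqP //.
pose r t := Num.sqrt (q t).
have r0 t : 0 < r t by rewrite sqrtr_gt0.
have rr t : r t ^+ 2 = q t by rewrite sqr_sqrtr// ltW.
have [dr rd] : exists dr : R -> R, forall t : R, is_derive t (1 : R) r (dr t).
  exists (fun t => (2 * Num.sqrt (q t))^-1 * (ip (y - x) (g t) + ip (g t) (y - x))) => t.
  apply: (is_derive1_comp (f := Num.sqrt) (g := q)); first exact: is_derive1_sqrt.
  exact: is_derive_ip.
pose c t := (r t)^-1 *: g t.
have cS t : S (c t).
  by apply/sphereE; rewrite /c ipZl ipZr -/(q t) -rr; field; exact: lt0r_neq0.
have [dc cd] : exists dc : R -> Cvec R n.+1, forall t : R, is_derive t (1 : R) c (dc t).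
  exists (fun t => (- r t ^- 2 *: dr t) *: g t + (r t)^-1 *: (y - x)) => t.
  apply: is_derive_scale => //; apply: is_deriveV => //; exact: lt0r_neq0.
have cdc t : ip (c t) (dc t) = 0.
  by apply: sphere_is_derive (cd t); near=> s; exact: cS.
(* The velocity of the segment in polar form, and [e] its image under [F]. *)
have yx t : y - x = dr t *: c t + r t *: dc t.
  apply: is_derive_uniq (gd t) _.
  pose proof (is_derive_scale (rd t) (cd t)) as H.
  apply: near_eq_is_derive H; near=> s.
  by rewrite /c scalerA divff ?scale1r//; exact: lt0r_neq0.
pose db t := dmap S F (c t) (dc t).
have tdc t : tangent S (c t) (dc t) by apply/tangent_sphere.
have bd t : is_derive t (1 : R) (F \o c) (db t).
  by apply: is_derive_dmap => //; near=> s; exact: cS.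
have bdb t : ip (F (c t)) (db t) = 0.
  by apply: (sphere_is_derive (c := F \o c) _ (bd t)); near=> s; apply: FS; exact: cS.
pose w := F y - F x.
pose e t := dr t *: F (c t) + r t *: db t.
have ee t : ip (e t) (e t) = ip (y - x) (y - x).
  rewrite (yx t) /e; ip_expand; rewrite (ipC (dc t)) cdc (ipC (db t)) bdb (Fiso _ _ (cS t) (tdc t)).
  by rewrite ((sphereE _).1 (cS t)) ((sphereE _).1 (FS _ (cS t))).
pose phi t := ip w (r t *: F (c t)).
have phid t : is_derive t (1 : R) phi (ip w (e t)).
  pose proof (is_derive_scale (rd t) (bd t)) as H.
  by apply: is_derive_eq (is_derive_ip (is_derive_cst w t (1 : R)) H) _; rewrite ip0l add0r.
have [xi _] : exists2 xi : R, xi \in `]0, 1[ & phi 1 - phi 0 = ip w (e xi) * (1 - 0).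
  apply: (@MVT _ phi (fun t => ip w (e t))) => //.
  apply: continuous_subspaceT => t; exact: is_derive_continuous (phid t).
have g0 : g 0 = x by rewrite /g scale0r addr0.
have g1 : g 1 = y by rewrite /g scale1r addrC subrK.
have r00 : r 0 = 1 by rewrite /r /q g0 xx sqrtr1.
have r11 : r 1 = 1 by rewrite /r /q g1 yy sqrtr1.
rewrite /phi /c g0 g1 r00 r11 invr1 !scale1r subr0 mulr1 -ipNr -ipDr -/w => ww.
have := ip_CS w (e xi); rewrite -ww ee.
have w0 := ip_ge0 w => H.
have {}H : ip w w <= ip (y - x) (y - x).
  have [->|wn0] := eqVneq w 0; first by rewrite ip0l ip_ge0.
  by rewrite -(ler_pM2l (ip_gt0 wn0)) -expr2.
move: H; rewrite /w; ip_expand; rewrite xx yy ((sphereE _).1 (FS _ Sx)) ((sphereE _).1 (FS _ Sy)).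
by rewrite (ipC y x) (ipC (F y)) => H; lra.
Unshelve. all: by end_near. Qed.

Lemma isometric_expand F x y : isometric F -> S x -> S y -> ip x y <= ip (F x) (F y).
Proof.
move=> Fi Sx Sy; have [->|] := eqVneq y (- x); last exact: isometric_chord.
have [_ FS _] := Fi; rewrite ipNr ((sphereE x).1 Sx); apply: ip_sphere_geN1; first exact: FS.
by apply: FS; apply/sphereE; rewrite ipNl ipNr opprK; exact/sphereE.
Qed.

(** By the chain rule the differential of [F] undoes that of [G]. *)
Lemma isometric_inverse F G : isometric F -> smooth_map S G ->
  (forall x, S x -> S (G x)) -> (forall x, S x -> F (G x) = x) -> isometric G.
Proof.
move=> [sF FS Fiso] sG GS FG; split=> [||x u Sx tu]; [exact: sG|exact: GS|].
have [c [cd cS cx]] := tangentP tu; subst x.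
have Gd := is_derive_dmap sG Sx tu cS cd.
have GcS : \forall s \near (0 : R), S ((G \o c) s).
  by near=> s; apply: GS; near: s.
have tGu : tangent S (G (c 0)) (dmap S G (c 0) u).
  apply/tangent_sphere; first exact: GS.
  exact: (sphere_is_derive GcS Gd).
have FGd := is_derive_dmap (c := G \o c) sF (GS _ Sx) tGu GcS Gd.
have E : dmap S F (G (c 0)) (dmap S G (c 0) u) = u.
  apply: (is_derive_uniq FGd).
  apply: near_eq_is_derive cd; near=> s; rewrite /= FG//; near: s; exact: cS.
by have := Fiso _ _ (GS _ Sx) tGu; rewrite E.
Unshelve. all: by end_near. Qed.

End RoundIsometries.

(** * Magnetomorphisms and unitary matrices *)

Section Magnetomorphisms.
Context {R : realType}.
Local Notation C := (R[i])%C.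

(** The adjoint inverts [B] on tangent vectors, so [ip] is preserved; [B] commutes
    with [J], so the magnetic form is preserved as well. *)
Lemma magnetomorphism_cact m p (M : set (Cvec R m.+1)) (M' : set (Cvec R p.+1))
    (B : 'M[C]_(p.+1, m.+1)) (B' : 'M[C]_(m.+1, p.+1)) :
  (forall x, M x -> M' (cact B x)) -> (forall y, M' y -> M (cact B' y)) ->
  (forall x, M x -> cact B' (cact B x) = x) ->
  (forall y, M' y -> cact B (cact B' y) = y) ->
  (forall x u, M x -> tangent M x u -> cact (B^t* *m B) u = u) ->
  magnetomorphism (MagneticSystem M (@round_metric R m) (ext_d (@alpha R m)))
    (MagneticSystem M' (@round_metric R p) (ext_d (@alpha R p))) (cact B).
Proof.
move=> MM' M'M BK B'K iso.
have D x u : tangent M x u -> dmap M (cact B) x u = cact B u.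
  by move=> tu; apply: dmap_lin => //; exact: cact_lin.
split=> /=.
- split=> //; first by apply: smooth_map_lin; exact: cact_lin.
  exists (cact B'); split=> //; apply: smooth_map_lin; exact: cact_lin.
- move=> x u v Mx tu tv; rewrite !D// !round_metricE; apply: ip_isometry.
  exact: (iso x).
- move=> x u v Mx tu tv; rewrite !D// !mformE -cactJ; apply: ip_isometry.
  exact: (iso x).
Qed.

Context {n : nat}.
Implicit Types (x y z u v w : Cvec R n.+1) (F G : Cvec R n.+1 -> Cvec R n.+1).
Local Notation S := (@sphere R n).

Lemma ip_unitary (U : 'M[C]_n.+1) u v : U \is unitarymx -> ip (cact U u) (cact U v) = ip u v.
Proof. by move=> /unitary_cact[UU _]; apply: ip_isometry; rewrite UU cact1. Qed.

Lemma unitary_sphere (U : 'M[C]_n.+1) z : U \is unitarymx -> S z -> S (cact U z).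
Proof. by move=> Uu /sphereE zz; apply/sphereE; rewrite ip_unitary. Qed.

Lemma adj_unitary (U : 'M[C]_n.+1) : U \is unitarymx -> U^t* \is unitarymx.
Proof. by move=> /unitary_cact[U1 U2]; apply/unitarymxP; rewrite adjK. Qed.

Lemma unitary_magnetomorphism (U : 'M[C]_n.+1) : U \is unitarymx ->
  magnetomorphism (@sphere_system R n) (@sphere_system R n) (act_mx U).
Proof.
move=> Uu; have [U1 U2] := unitary_cact Uu.
apply: (@magnetomorphism_cact n n S S U (U^t*)).
- by move=> x; exact: unitary_sphere.
- by move=> x; apply: unitary_sphere; exact: adj_unitary.
- by move=> x _; rewrite -cactM U1 cact1.
- by move=> x _; rewrite -cactM U2 cact1.
- by move=> x u _ _; rewrite U1 cact1.
Qed.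

Definition ebasis (k : 'I_n.+1) : Cvec R n.+1 := (delta_mx k ord0, 0).

Lemma ebasis_sum z : z =
  \sum_k (z.1 k ord0 *: ebasis k) + \sum_k (z.2 k ord0 *: J (ebasis k)).
Proof.
have E1 (f : 'I_n.+1 -> R) : \sum_k f k *: ebasis k = (\col_k f k, 0).
  transitivity ((\sum_k f k *: delta_mx k ord0 : 'cV[R]_n.+1, 0 : 'cV[R]_n.+1)).
    elim/big_ind2 : _ => // [x1 x2 y1 y2 -> ->|i _].
      by congr pair; rewrite /= addr0.
    by congr pair; rewrite /= scaler0.
  congr pair; rewrite [RHS]matrix_sum_delta; apply: eq_bigr => k _.
  by rewrite big_ord1 mxE.
rewrite -[in X in _ + X](@lin_comb _ _ _ _ _ (fun k => z.2 k ord0) ebasis (@J_lin _ _)).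
rewrite !E1 JE /=; case: z => a b; congr pair => /=; apply/matrixP => i j;
  by rewrite !ord1 !mxE ?oppr0 ?addr0 ?add0r.
Qed.

Lemma ebasis_ip k l : ip (ebasis k) (ebasis l) = (k == l)%:R.
Proof.
rewrite ipE (bigD1 k)//= big1 ?addr0; last first.
  by move=> i ik; rewrite !mxE (negPf ik) !mul0r addr0.
by rewrite !mxE !eqxx mul1r mulr0 addr0 andbT.
Qed.

Lemma ebasis_ipJ k l : ip (J (ebasis k)) (ebasis l) = 0.
Proof. by rewrite ipE big1// => i _; rewrite JE /= !mxE oppr0 mul0r mulr0 addr0. Qed.

Lemma lin_ext (W : lmodType R) (f g : Cvec R n.+1 -> W) : linear f -> linear g ->
  (forall k, f (ebasis k) = g (ebasis k)) ->
  (forall k, f (J (ebasis k)) = g (J (ebasis k))) -> f =1 g.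
Proof.
move=> fl gl fg fgJ z; rewrite (ebasis_sum z).
have fD u v : f (u + v) = f u + f v by have := fl 1 u v; rewrite !scale1r.
have gD u v : g (u + v) = g u + g v by have := gl 1 u v; rewrite !scale1r.
rewrite fD gD !(lin_comb _ _ fl) !(lin_comb _ _ gl).
by congr (_ + _); apply: eq_bigr => k _; rewrite ?fg ?fgJ.
Qed.

Lemma ebasis_sphere k : S (ebasis k).
Proof. by apply/sphereE; rewrite ebasis_ip eqxx. Qed.

Lemma J_sphere z : S z -> S (J z).
Proof. by move=> /sphereE zz; apply/sphereE; rewrite ipJJ. Qed.

Lemma cact_inj (A B : 'M[C]_n.+1) :
  (forall z, S z -> cact A z = cact B z) -> A = B.
Proof.
move=> AB; apply/matrixP => i k.
have /ofC_inj/matrixP/(_ i ord0) := AB _ (ebasis_sphere k).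
rewrite !mxE (bigD1 k)//= big1 ?addr0; last first.
  move=> j jk; rewrite (_ : toC _ j ord0 = 0) ?mulr0//.
  by apply: eq_cplx; rewrite ?toC_Re ?toC_Im /= !mxE ?(negPf jk).
rewrite [in RHS](bigD1 k)//= big1 ?addr0; last first.
  move=> j jk; rewrite (_ : toC _ j ord0 = 0) ?mulr0//.
  by apply: eq_cplx; rewrite ?toC_Re ?toC_Im /= !mxE ?(negPf jk).
rewrite (_ : toC _ k ord0 = 1) ?mulr1//.
by apply: eq_cplx; rewrite ?toC_Re ?toC_Im /= !mxE ?eqxx.
Qed.

Section SphereMagnetomorphism.
Variable F : Cvec R n.+1 -> Cvec R n.+1.
Hypothesis n1 : (1 <= n)%N.
Hypothesis FM : magnetomorphism (@sphere_system R n) (@sphere_system R n) F.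

Let FS : forall x, S x -> S (F x). Proof. by case: FM => -[]. Qed.

Lemma magneto_isometric : isometric F.
Proof.
case: FM => -[/= _ sF _] mF _; split; [exact: sF|exact: FS|].
by move=> x u Sx tu; have := mF x u u Sx tu tu; rewrite !round_metricE.
Qed.

Lemma magneto_ip x y : S x -> S y -> ip (F x) (F y) = ip x y.
Proof.
move=> Sx Sy; have Fi := magneto_isometric.
case: FM => -[/= _ _ [G [GS sG GF FG]]] _ _.
have Gi : isometric G by exact: isometric_inverse Fi sG GS FG.
apply/eqP; rewrite eq_le; apply/andP; split; last exact: isometric_expand.
have := isometric_expand Gi (FS Sx) (FS Sy).
by rewrite (GF x)// (GF y).
Qed.

(** The norm of the difference of the two sides only involves inner products of
    values of [F], which are those of the arguments. *)
Lemma magneto_comb a b x y : S x -> S y -> S (a *: x + b *: y) ->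
  F (a *: x + b *: y) = a *: F x + b *: F y.
Proof.
move=> Sx Sy Sxy; apply/eqP; rewrite -subr_eq0; apply/eqP/ip_eq0.
have fs z : S z -> ip (F z) (F z) = 1 by move=> /FS/sphereE.
have ss z : S z -> ip z z = 1 by move=> /sphereE.
move: (fs _ Sx) (fs _ Sy) (fs _ Sxy) (magneto_ip Sx Sy) (magneto_ip Sxy Sx) (magneto_ip Sxy Sy).
have := ss _ Sxy; move: (ss _ Sx) (ss _ Sy).
move: (F (a *: x + b *: y)) => p; move: (F x) (F y) => q r.
ip_expand; rewrite (ipC q p) (ipC r p) (ipC r q) (ipC y x).
move=> -> -> /eqP; rewrite -subr_eq0 => /eqP e -> -> -> -> -> ->.
by apply/eqP; rewrite -oppr_eq0 -[X in _ == X]e; apply/eqP; ring.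
Qed.

(** [F] maps great circles to great circles, being linear on combinations. *)
Lemma magneto_dmap z u : S z -> S u -> ip z u = 0 -> dmap S F z u = F u.
Proof.
move=> Sz Su zu; have [sF _ _] := magneto_isometric.
have gcE (a b : Cvec R n.+1) t : S b -> great_circle a b t = cos t *: a + sin t *: b.
  by move=> /sphereE bb; rewrite great_circleE bb sqrtr1 mul1r invr1 scale1r.
have gS : \forall t \near (0 : R), S (great_circle z u t).
  by near=> t; exact: great_circle_sphere.
have Sz0 : S (great_circle z u 0) by rewrite great_circle0.
have tzu : tangent S (great_circle z u 0) u.
  by rewrite great_circle0; apply/tangent_sphere.
have := is_derive_dmap sF Sz0 tzu gS (is_derive_great_circle z u).
rewrite great_circle0 => H; apply: (is_derive_uniq H).
apply: near_eq_is_derive (is_derive_great_circle (F z) (F u)).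
near=> t; rewrite gcE; last exact: FS.
rewrite /= gcE// magneto_comb// -gcE//; exact: great_circle_sphere.
Unshelve. all: by end_near. Qed.

(** At a basis point orthogonal to [e] and [J e] the preserved form gives
    [ip (J (F e)) (F (J e)) = 1], which for unit vectors means equality. *)
Lemma magneto_J k : F (J (ebasis k)) = J (F (ebasis k)).
Proof.
(* Here the complex dimension is at least two. *)
have [l lk] : exists l : 'I_n.+1, l != k.
  have [k0|k0] := eqVneq k ord0; last by exists ord0; rewrite eq_sym.
  by exists ord_max; rewrite k0 -val_eqE/= -lt0n.
have Sk := ebasis_sphere k; have Sl := ebasis_sphere l; have SJ := J_sphere Sk.
have lk0 : ip (ebasis l) (ebasis k) = 0 by rewrite ebasis_ip (negPf lk).
have lJ0 : ip (ebasis l) (J (ebasis k)) = 0 by rewrite ipC ebasis_ipJ.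
have tk : tangent S (ebasis l) (ebasis k) by apply/tangent_sphere.
have tJ : tangent S (ebasis l) (J (ebasis k)) by apply/tangent_sphere.
case: FM => /= _ _ /(_ _ _ _ Sl tk tJ); rewrite !mformE !magneto_dmap//.
move=> H; apply/esym; apply: sphere_eq (J_sphere (FS Sk)) (FS SJ) _.
by rewrite H; exact: (sphereE _).1 SJ.
Qed.

Lemma magneto_unitary : exists2 U : 'M[C]_n.+1, U \is unitarymx &
  forall z, S z -> F z = act_mx U z.
Proof.
pose U : 'M[C]_n.+1 := \matrix_(i, k) toC (F (ebasis k)) i ord0.
have UE k : cact U (ebasis k) = F (ebasis k).
  apply: toC_inj; rewrite ofCK; apply/matrixP => i j; rewrite ord1 mxE.
  rewrite (bigD1 k)//= big1 ?addr0; last first.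
    move=> l lk; rewrite (_ : toC _ l ord0 = 0) ?mulr0//.
    by apply: eq_cplx; rewrite ?toC_Re ?toC_Im /= !mxE ?(negPf lk).
  rewrite (_ : toC (ebasis k) k ord0 = 1); first by rewrite mulr1 [LHS]mxE.
  by apply: eq_cplx; rewrite ?toC_Re ?toC_Im /= !mxE ?eqxx.
have Sb k := ebasis_sphere k.
have UU : U^t* *m U = 1%:M.
  apply/matrixP => k l; rewrite [RHS]mxE.
  transitivity (herm (F (ebasis k)) (F (ebasis l))).
    by rewrite mxE; apply: eq_bigr => i _; rewrite /U !mxE.
  rewrite hermE -magneto_J !magneto_ip//; last exact: J_sphere.
  by rewrite ebasis_ip ebasis_ipJ; apply: eq_cplx => /=; case: eqP.
have Uu : U \is unitarymx by apply/unitarymxP; exact: mulmx1C.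
exists U => // z Sz; apply: ip_inj => w.
have [_ U2] := unitary_cact Uu.
have -> : w = cact U (cact (U^t*) w) by rewrite -cactM U2 cact1.
move: (cact _ w) => {}w; rewrite -[act_mx U z]/(cact U z) ip_unitary//.
have cl v : linear (fun w => ip v (cact U w)).
  by move=> a u1 u2; rewrite cact_lin; exact: ip_linr.
apply: (@lin_ext R (fun w => ip (F z) (cact U w)) (ip z)) => [||k|k].
- exact: cl.
- exact: ip_linr.
- by rewrite UE magneto_ip.
- by rewrite cactJ UE -magneto_J magneto_ip//; exact: J_sphere.
Qed.

End SphereMagnetomorphism.

Lemma Mag_sphere : (1 <= n)%N -> Mag (@sphere_system R n) =
  [set f | exists2 U : 'M[C]_n.+1, U \is unitarymx &
     forall z : carrier (@sphere_system R n), \val (f z) = act_mx U (\val z)].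
Proof.
move=> n1; apply/seteqP; split=> f /=.
  move=> [F FM fF]; have [U Uu FU] := magneto_unitary n1 FM.
  by exists U => // z; rewrite fF FU//; exact: set_valP.
move=> [U Uu fU]; exists (act_mx U) => //; exact: unitary_magnetomorphism.
Qed.

End Magnetomorphisms.

(** * The lifted action, the matrix exponential and the moment map *)

Section TangentLift.
Context {R : realType} {n : nat}.
Local Notation C := (R[i])%C.
Local Notation S := (@sphere R n).
Local Notation TS := (tangent_bundle S).
Local Notation V := (Cvec R n.+1).
Implicit Types (U A : 'M[C]_n.+1) (p xi eta : V * V).

Definition cact2 A p : V * V := (cact A p.1, cact A p.2).

Lemma cact2_lin A : linear (cact2 A).
Proof. by move=> a p q; congr pair; exact: cact_lin. Qed.

Lemma TS_E p : TS p <-> ip p.1 p.1 = 1 /\ ip p.1 p.2 = 0.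
Proof.
split=> -[p1 p2]; first by have Sp := (sphereE p.1).1 p1; split=> //; exact/tangent_sphere.
have Sp : S p.1 by exact/sphereE.
by split=> //; exact/tangent_sphere.
Qed.

Lemma tangent_liftE A p : TS p -> tangent_lift S (act_mx A) p = cact2 A p.
Proof.
by move=> [_ tp]; congr pair; apply: dmap_lin tp => //; exact: cact_lin.
Qed.

Lemma TS_unitary U p : U \is unitarymx -> TS p -> TS (cact2 U p).
Proof. by move=> Uu /TS_E[p1 p2]; apply/TS_E; rewrite !ip_unitary. Qed.

(** The Liouville form is bilinear, so its exterior derivative is constant. *)
Lemma twistedE p xi eta : twisted_form (@sphere_system R n) p xi eta =
  ip xi.2 eta.1 - ip eta.2 xi.1 - ip (J xi.1) eta.1.
Proof.
rewrite /twisted_form /= mformE; congr (_ - _); rewrite /ext_d.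
have D (a b : V * V) : 'D_a (fun y : V * V => liouville (@round_metric R n) y b) p = ip a.2 b.1.
  apply: (lin_derive (f := fun y : V * V => ip y.2 b.1)) => k q r.
  exact: (ip_linl b.1 k q.2 r.2).
by rewrite !D.
Qed.

Lemma unitary_symplectomorphism U : U \is unitarymx ->
  symplectomorphism TS (twisted_form (@sphere_system R n)) (tangent_lift S (act_mx U)).
Proof.
move=> Uu; have [U1 U2] := unitary_cact Uu.
have dE p xi : tangent TS p xi -> dmap TS (tangent_lift S (act_mx U)) p xi = cact2 U xi.
  by apply: dmap_lin; [exact: cact2_lin|move=> q; exact: tangent_liftE].
split; last first.
  move=> p xi eta Tp txi teta; rewrite !dE// !twistedE /=.
  by rewrite -cactJ !ip_unitary.
split.
- by move=> p Tp; rewrite tangent_liftE//; exact: TS_unitary.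
- apply: (smooth_map_eq (f := cact2 U)); first by move=> p Tp; rewrite tangent_liftE.
  by apply: smooth_map_lin; exact: cact2_lin.
- exists (cact2 (U^t*)); split.
  + by move=> p; apply: TS_unitary; exact: adj_unitary.
  + by apply: smooth_map_lin; exact: cact2_lin.
  + move=> p Tp; rewrite tangent_liftE// /cact2/= -!cactM U1 !cact1.
    by case: p {Tp}.
  + move=> p Tp; rewrite tangent_liftE; last first.
      by apply: TS_unitary Tp; exact: adj_unitary.
    rewrite /cact2/= -!cactM U2 !cact1.
    by case: p {Tp}.
Qed.

End TangentLift.

Section Exponential.
Context {R : realType}.
Local Notation C := (R[i])%C.

(** Coefficients dominated by those of an exponential series; this class is stable
    under formal derivation and every power series in it converges everywhere. *)
Definition exp_bounded (K b : R) (c : nat -> R) := forall k, `|c k| <= K * (b ^+ k / k`!%:R).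

Lemma exp_bounded_cvg K b c x : exp_bounded K b c -> cvgn (pseries c x).
Proof.
move=> cb; apply: normed_cvg.
apply: (@series_le_cvg _ _ (fun k => K * exp_coeff (`|b * x|) k)).
- by move=> k; exact: normr_ge0.
- move=> k; apply: mulr_ge0; last first.
    by rewrite /exp_coeff mulr_ge0// ?invr_ge0 ?exprn_ge0// ler0n.
  by have := cb 0; rewrite expr0 fact0 divr1 mulr1; apply: le_trans; exact: normr_ge0.
- move=> k /=; have -> : `|c k * x ^+ k| = `|c k| * `|x| ^+ k by rewrite normrM normrX.
  rewrite /exp_coeff /=.
  have H : `|c k| <= K * (`|b| ^+ k / k`!%:R).
    apply: le_trans (cb k) _; apply: ler_wpM2l.
      by have := cb 0; rewrite expr0 fact0 divr1 mulr1; apply: le_trans; exact: normr_ge0.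
    by rewrite ler_wpM2r ?invr_ge0 ?ler0n// -normrX ler_norm.
  apply: le_trans (ler_wpM2r _ H) _; first by rewrite exprn_ge0.
  by rewrite normrM exprMn le_eqVlt; apply/orP; left; apply/eqP; field; rewrite pnatr_eq0 -lt0n fact_gt0.
- apply: (@is_cvg_seriesZ R _ K); exact: is_cvg_series_exp_coeff.
Qed.

Lemma exp_bounded_diffs K b c : exp_bounded K b c -> exp_bounded (K * b) b (pseries_diffs c).
Proof.
move=> cb k; rewrite /pseries_diffs normrM normr_nat.
apply: le_trans (ler_wpM2l _ (cb k.+1)) _; first by rewrite ler0n.
have k1 : k.+1%:R != 0 :> R by rewrite pnatr_eq0.
have kf : k`!%:R != 0 :> R by rewrite pnatr_eq0 -lt0n fact_gt0.
rewrite factS exprS natrM le_eqVlt; apply/orP; left; apply/eqP.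
by move: (k.+1%:R) (k`!%:R) k1 kf => p q p0 q0; field; apply/andP.
Qed.

Lemma pseries0 (c : nat -> R) : limn (pseries c 0) = c 0.
Proof.
have H : (fun=> c 0) @ \oo --> c 0 by exact: cvg_cst.
apply: cvg_lim => //; apply: cvg_trans H; apply: near_eq_cvg.
near=> N; rewrite /pseries/series/=.
have : (0 < N)%N by near: N; exact: nbhs_infty_gt.
move=> N0; rewrite -(prednK N0) big_nat_recl// expr0 mulr1 big1 ?addr0// => k _.
by rewrite exprS mul0r mulr0.
Unshelve. all: by end_near. Qed.

Lemma exp_bounded_derive K b c : exp_bounded K b c ->
  is_derive (0 : R) (1 : R) (fun t => limn (pseries c t)) (c 1).
Proof.
move=> cb; have cb1 := exp_bounded_diffs cb; have cb2 := exp_bounded_diffs cb1.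
have := @pseries_snd_diffs R c 1 0 (@exp_bounded_cvg _ _ _ _ cb)
  (@exp_bounded_cvg _ _ _ _ cb1) (@exp_bounded_cvg _ _ _ _ cb2).
by rewrite normr0 normr1 pseries0 /pseries_diffs mul1r; apply.
Qed.

Lemma cvg_frame (V : normedModType R) {fV : frame V} (u : nat -> V) (l : 'I_(fdim V) -> R) :
  (forall i, fcoord i (u k) @[k --> \oo] --> l i) ->
  u @ \oo --> \sum_i l i *: fbasis i.
Proof.
move=> ul; rewrite (_ : u = fun k => \sum_i fcoord i (u k) *: fbasis i).
  by apply: cvg_sum => i; exact: cvgZr_tmp.
by apply/funext => k; exact: frameE.
Qed.

Context {n : nat}.
Local Notation MM := ('M[R]_n.+1 * 'M[R]_n.+1)%type.
Implicit Types X Y : 'M[C]_n.+1.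

Definition abs1 (x : C) := `|complex.Re x| + `|complex.Im x|.
(** A submultiplicative norm that dominates all real and imaginary parts. *)
Definition sum_abs (X : 'M[C]_n.+1) := \sum_i \sum_j abs1 (X i j).

Lemma abs1_ge0 x : 0 <= abs1 x. Proof. exact: addr_ge0. Qed.

Lemma abs1D x y : abs1 (x + y) <= abs1 x + abs1 y.
Proof.
rewrite /abs1 ReD ImD addrACA; apply: lerD; exact: ler_normD.
Qed.

Lemma abs1M x y : abs1 (x * y) <= abs1 x * abs1 y.
Proof.
rewrite /abs1 ReM ImM.
apply: le_trans (lerD (ler_normB _ _) (ler_normD _ _)) _; rewrite !normrM.
by rewrite le_eqVlt; apply/orP; left; apply/eqP; ring.
Qed.

Lemma abs1_sum (I : finType) (f : I -> C) : abs1 (\sum_i f i) <= \sum_i abs1 (f i).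
Proof.
elim/big_rec2 : _ => [|i x y _ H]; first by rewrite /abs1 normr0 addr0.
by apply: le_trans (abs1D _ _) _; rewrite lerD2l.
Qed.

Lemma sum_abs_ge0 X : 0 <= sum_abs X.
Proof. by apply: sumr_ge0 => i _; apply: sumr_ge0 => j _; exact: abs1_ge0. Qed.

Lemma row_le_sum_abs (X : 'M[C]_n.+1) i : \sum_j abs1 (X i j) <= sum_abs X.
Proof.
rewrite /sum_abs [leRHS](bigD1 i)//= lerDl; apply: sumr_ge0 => k _; apply: sumr_ge0 => j _.
exact: abs1_ge0.
Qed.

Lemma entry_le_sum_abs (X : 'M[C]_n.+1) i j : abs1 (X i j) <= sum_abs X.
Proof.
apply: le_trans (row_le_sum_abs X i); rewrite (bigD1 j)//= lerDl.
by apply: sumr_ge0 => k _; exact: abs1_ge0.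
Qed.

Lemma sum_absM X Y : sum_abs (X *m Y) <= sum_abs X * sum_abs Y.
Proof.
rewrite [X in _ <= X * _]/sum_abs mulr_suml; apply: ler_sum => i _.
apply: (@le_trans _ _ (\sum_j \sum_k abs1 (X i k) * abs1 (Y k j))).
  apply: ler_sum => j _; rewrite mxE; apply: le_trans (abs1_sum _) _.
  by apply: ler_sum => k _; exact: abs1M.
rewrite exchange_big/= mulr_suml; apply: ler_sum => k _; rewrite -mulr_sumr.
by apply: ler_wpM2l; [exact: abs1_ge0|exact: row_le_sum_abs].
Qed.

Lemma sum_absX X k : sum_abs (X ^+ k) <= sum_abs 1 * sum_abs X ^+ k.
Proof.
elim: k => [|k IH]; first by rewrite !expr0 mulr1.
rewrite exprSr (exprSr (sum_abs X)) mulrA; apply: le_trans (sum_absM _ _) _.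
by apply: ler_wpM2r => //; exact: sum_abs_ge0.
Qed.

Lemma fcoord_le_sum_abs X (i : 'I_(fdim MM)) :
  `|fcoord i (ofC X : MM)| <= sum_abs X.
Proof.
have H a b : `|complex.Re (X a b)| <= sum_abs X /\ `|complex.Im (X a b)| <= sum_abs X.
  by split; apply: le_trans (entry_le_sum_abs X a b); rewrite /abs1 ?lerDl ?lerDr.
rewrite /fcoord/=; case: (fintype.split i) => j; rewrite !mxE.
  by have [] := H (enum_val j).1 (enum_val j).2.
by have [] := H (enum_val j).1 (enum_val j).2.
Qed.

Lemma ofC_scale (a : R) (X : 'M[C]_n.+1) : ofC (a%:C%C *: X) = a *: (ofC X : MM).
Proof. by apply: toC_inj; rewrite toCZ !ofCK. Qed.

Definition exp_coord (A : 'M[C]_n.+1) (i : 'I_(fdim MM)) (k : nat) : R :=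
  fcoord i (ofC (A ^+ k) : MM) / k`!%:R.

(** Each coordinate of [exp (t A)] is a power series in [t] whose coefficient of
    degree one is the coordinate of [A]. *)
Lemma is_derive_expmx (A : 'M[C]_n.+1) :
  is_derive (0 : R) (1 : R) (fun t : R => ofC (expmx (t%:C%C *: A)) : MM) (ofC A : MM).
Proof.
pose c := exp_coord A.
have cb i : exp_bounded (sum_abs 1) (sum_abs A) (c i).
  move=> k; rewrite /c /exp_coord normrM (ger0_norm (x := _^-1)) ?invr_ge0 ?ler0n// mulrA.
  rewrite ler_wpM2r ?invr_ge0 ?ler0n//; apply: le_trans (fcoord_le_sum_abs _ _) _.
  exact: sum_absX.
have cl i : linear (fcoord i : MM -> R) by exact: fcoord_lin.
have E t : ofC (expmx (t%:C%C *: A)) = \sum_i limn (pseries (c i) t) *: (fbasis i : MM).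
  rewrite /expmx toCK; apply: (@cvg_lim (MM : normedModType R) (@norm_hausdorff R (MM : normedModType R))).
  apply: cvg_frame => i; rewrite (_ : (fun k => _) = pseries (c i) t).
    exact: (@exp_bounded_cvg _ _ _ _ (cb i)).
  apply/funext => N; pose f : {linear MM -> R} := lin_of (cl i).
  transitivity (\sum_(0 <= k < N) f (ofC (k`!%:R^-1 *: (t%:C%C *: A) ^+ k))).
    by rewrite -raddf_sum.
  apply: eq_bigr => k _.
  rewrite exprZn scalerA (_ : k`!%:R^-1 * t%:C%C ^+ k = (k`!%:R^-1 * t ^+ k)%:C%C); last first.
    by rewrite rmorphM/= fmorphV/= rmorph_nat rmorphXn.
  rewrite -[RHS]/(c i k * t ^+ k) ofC_scale linearZ (_ : c i k = f (ofC (A ^+ k)) / k`!%:R); last by [].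
  by move: (f _) => y; rewrite -[LHS]/((k`!%:R^-1 * t ^+ k) * y); ring.
rewrite (_ : (fun t => _) = \sum_i (fun t => limn (pseries (c i) t) *: (fbasis i : MM))); last first.
  by apply/funext => t; rewrite E sum_fctE.
have H (i : 'I_(fdim MM)) : is_derive (0 : R) (1 : R)
    (fun t => limn (pseries (c i) t) *: (fbasis i : MM)) (c i 1 *: fbasis i).
  pose proof (is_derive_scale (exp_bounded_derive (cb i))
    (is_derive_cst (fbasis i : MM) (0 : R) (1 : R))) as H.
  by apply: is_derive_eq H _; rewrite scaler0 addr0.
apply: is_derive_eq (is_derive_sum H) _.
rewrite [RHS](frameE (ofC A : MM)); apply: eq_bigr => i _.
by rewrite /c /exp_coord expr1 -[1`!]/1%N divr1.
Qed.

End Exponential.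


Section MomentMap.
Context {R : realType} {n : nat}.
Local Notation C := (R[i])%C.
Local Notation S := (@sphere R n).
Local Notation TS := (tangent_bundle S).
Local Notation V := (Cvec R n.+1).
Local Notation MM := ('M[R]_n.+1 * 'M[R]_n.+1)%type.
Implicit Types (A B : 'M[C]_n.+1) (p xi eta : V * V).

Lemma inf_generatorE A p : TS p -> inf_generator A p = cact2 A p.
Proof.
move=> Tp; apply: is_derive1.
pose g (e : MM) : V * V := cact2 (toC e) p.
have gl : linear g.
  move=> a e f; rewrite /g /cact2 /cact toC_lin !mulmxDl -!scalemxAl !ofC_lin.
  by [].
have <- : g (ofC A) = cact2 A p by rewrite /g ofCK.
rewrite (_ : (fun t => _) = g \o (fun t : R => ofC (expmx (t%:C%C *: A)))).
  apply: is_derive_lin gl _; exact: is_derive_expmx.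
by apply/funext => t; rewrite tangent_liftE// /g /= ofCK.
Qed.

Lemma muE A p : mu p A = ip (cact A p.1) p.2 + ip ((- 2^-1) *: J p.1) (cact A p.1).
Proof. by rewrite /mu round_metricE alphaE ipZl mulNr. Qed.

Lemma pair1_lin (W : lmodType R) (f : V -> W) : linear f -> linear (fun p : V * V => f p.1).
Proof. by move=> fl a p q; exact: fl. Qed.

Lemma pair2_lin (W : lmodType R) (f : V -> W) : linear f -> linear (fun p : V * V => f p.2).
Proof. by move=> fl a p q; exact: fl. Qed.

Lemma id_lin (W : lmodType R) : linear (fun w : W => w).
Proof. by []. Qed.

Lemma JZ_lin (a : R) : linear (fun z : V => a *: J z).
Proof. by move=> k u v; vring. Qed.

Lemma smooth_mu A : smooth_on setT ((@mu R n)^~ A).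
Proof.
move=> k; apply: (Ck_eq (f := fun p : V * V =>
  ip (cact A p.1) p.2 + ip ((- 2^-1) *: J p.1) (cact A p.1))) => [|p _|].
- exact: openT.
- by rewrite muE.
move: k; apply: smooth_onD; first exact: openT.
- apply: smooth_ip; first exact: openT.
    by apply: smooth_on_lin (pair1_lin (cact_lin A)) _; exact: openT.
  by apply: smooth_on_lin (pair2_lin (@id_lin _)) _; exact: openT.
- apply: smooth_ip; first exact: openT.
    by apply: smooth_on_lin (pair1_lin (JZ_lin _)) _; exact: openT.
  by apply: smooth_on_lin (pair1_lin (cact_lin A)) _; exact: openT.
Qed.

Lemma dmap_mu A p eta : tangent TS p eta -> dmap TS ((@mu R n)^~ A) p eta =
  ip (cact A eta.1) p.2 + ip (cact A p.1) eta.2 -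
  2^-1 * (ip (J eta.1) (cact A p.1) + ip (J p.1) (cact A eta.1)).
Proof.
move=> teta; have dmu : differentiable ((@mu R n)^~ A) p.
  exact: smooth_on_differentiable (smooth_mu A) _.
rewrite (dmapE (F := (@mu R n)^~ A) teta dmu); last by near=> q.
have lin_id (W : normedModType R) (f : V * V -> W) : linear f ->
    is_derive p eta f (f eta).
  by move=> fl; exact: is_derive_lin fl (is_derive_id p eta).
have d1 := lin_id _ _ (pair1_lin (cact_lin A)).
have d2 := lin_id _ _ (pair2_lin (@id_lin _)).
have d3 := lin_id _ _ (pair1_lin (JZ_lin (- 2^-1))).
have H := is_deriveD (is_derive_ip d1 d2) (is_derive_ip d3 d1).
rewrite -(deriveE _ dmu); apply: derive_val.
rewrite (_ : (@mu R n)^~ A = (fun p : V * V => ip (cact A p.1) p.2) +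
  (fun p : V * V => ip ((- 2^-1) *: J p.1) (cact A p.1))); last first.
  by apply/funext => q; rewrite muE.
apply: is_derive_eq H _; ip_expand; ip_atoms; ring.
Unshelve. all: by end_near. Qed.

Lemma u_algP A u v : u_alg A -> ip (cact A u) v = - ip u (cact A v).
Proof.
have ofCN (X : 'cV[C]_n.+1) : ofC (- X) = - ofC X.
  by congr pair; apply/matrixP => i j; rewrite !mxE cplxE.
by move=> /= AA; rewrite ip_adj AA /cact mulNmx ofCN ipNr.
Qed.

(** The terms in the fibre variable cancel because [A] is skew; the two terms from
    [alpha] both equal half the magnetic term, because [A] is skew and commutes with
    [J]. *)
Lemma sphere_moment_map : moment_map (twisted_form (@sphere_system R n)) (@mu R n).
Proof.
split.
- move=> p a A B _ _ _; rewrite !muE.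
  have cE z : cact (a%:C%C *: A + B) z = a *: cact A z + cact B z.
    by rewrite /cact mulmxDl -scalemxAl ofC_lin.
  rewrite !cE; ip_expand; ip_atoms; ring.
- by move=> A _; apply: smooth_map_on; exact: smooth_mu.
- move=> A [z v] [a b] Au Tp teta; rewrite inf_generatorE// twistedE dmap_mu//=.
  have e1 : ip (cact A a) v = - ip (cact A v) a by rewrite (u_algP _ _ Au) ipC.
  have e2 : ip b (cact A z) = ip (cact A z) b by exact: ipC.
  have e3 : ip (J a) (cact A z) = - ip (J (cact A z)) a by rewrite ipJl ipC.
  have e4 : ip (J z) (cact A a) = - ip (J (cact A z)) a.
    by rewrite -cactJ (u_algP _ _ Au) opprK.
  by move: e1 e2 e3 e4; ip_atoms => e1 e2 e3 e4; lra.
Qed.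

End MomentMap.

(** * The Levi-Civita connection of the sphere and the equation of magnetic geodesics *)

Section SmoothMapOperations.
Context {R : realType}.

Lemma smooth_map2 (V W W' X : normedModType R) (M : set V) (h : W -> W' -> X)
    (f : V -> W) (g : V -> W') :
  (forall (U : set V) F G, open U -> smooth_on U F -> smooth_on U G ->
     smooth_on U (fun x => h (F x) (G x))) ->
  smooth_map M f -> smooth_map M g -> smooth_map M (fun x => h (f x) (g x)).
Proof.
move=> hs fs gs x Mx.
have [D [F [oD Dx sF FE]]] := fs x Mx; have [E [G [oE Ex sG GE]]] := gs x Mx.
exists (D `&` E), (fun x => h (F x) (G x)); split.
- exact: openI.
- by [].
- apply: hs; first exact: openI.
    by apply: smooth_on_sub sF => y [].
  by apply: smooth_on_sub sG => y [].
- by move=> y [Dy Ey] My; rewrite FE// GE.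
Qed.

Lemma smooth_mapD (V W : normedModType R) (M : set V) (f g : V -> W) :
  smooth_map M f -> smooth_map M g -> smooth_map M (fun x => f x + g x).
Proof. by apply: smooth_map2 => U F G; exact: smooth_onD. Qed.

Lemma smooth_mapZ (V W : normedModType R) {fW : frame W} (M : set V) (a : V -> R)
    (f : V -> W) :
  smooth_map M a -> smooth_map M f -> smooth_map M (fun x => a x *: f x).
Proof. by apply: (smooth_map2 (h := fun (a : R) w => a *: w)) => U F G; exact: smooth_onZ. Qed.

Lemma smooth_map_ip (V : normedModType R) n (M : set V) (f g : V -> Cvec R n.+1) :
  smooth_map M f -> smooth_map M g -> smooth_map M (fun x => ip (f x) (g x)).
Proof. by apply: (smooth_map2 (h := @ip R n.+1)) => U F G; exact: smooth_ip. Qed.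

Lemma smooth_map_id (V : normedModType R) {fV : frame V} (M : set V) :
  smooth_map M (fun x => x).
Proof. by apply: smooth_map_lin. Qed.

Lemma dmap_curve (V W : normedModType R) (M : set V) (f : V -> W) (c : R -> V) u w :
  smooth_map M f -> tangent M (c 0) u -> is_derive (0 : R) (1 : R) c u ->
  (\forall t \near (0 : R), M (c t)) ->
  is_derive (0 : R) (1 : R) (f \o c) w -> dmap M f (c 0) u = w.
Proof.
move=> fs tu cd cM H; apply: is_derive_uniq _ H; apply: is_derive_dmap => //.
exact: nbhs_singleton cM.
Qed.

(** In coordinates the differential is a combination of partial derivatives of a
    smooth extension. *)
Lemma smooth_dmap_field (V W : normedModType R) {fV : frame V} {fW : frame W}
    (M : set V) (f : V -> W) (X : V -> V) :
  smooth_map M f -> vector_field M X -> smooth_map M (fun x => dmap M f x (X x)).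
Proof.
move=> fs [sX tX] x Mx.
have [D [F [oD Dx sF FE FdE]]] := smooth_dmap fs Mx.
have [E [G [oE Ex sG GE]]] := sX x Mx.
exists (D `&` E), (fun y => \sum_i fcoord i (G y) *: 'D_(fbasis i) F y); split.
- exact: openI.
- by [].
- have oDE : open (D `&` E) by exact: openI.
  move=> k; apply: Ck_sum => // i; move: k; apply: smooth_onZ => //.
    move=> k; apply: (Ck_lin (l := fcoord i : V -> R)) => //; first exact: fcoord_lin.
    by move: k; apply: smooth_on_sub sG => y [].
  by apply: smooth_on_sub (smooth_on_derive _ sF) => y [].
- move=> y [Dy Ey] My; rewrite FdE//; last exact: tX.
  have dF := smooth_on_differentiable sF Dy.
  by rewrite -(GE y Ey My); exact/esym/diff_frame.
Qed.

End SmoothMapOperations.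

Section LeviCivita.
Context {R : realType} {n : nat}.
Local Notation V := (Cvec R n.+1).
Local Notation S := (@sphere R n).
Local Notation Sys := (@sphere_system R n).
Implicit Types (x y z u v w : V) (X Y Z : V -> V).

Definition round_nabla Y x u : V := dmap S Y x u + ip (Y x) u *: x.

Lemma vfield_ip X x : vector_field S X -> S x -> ip x (X x) = 0.
Proof. by move=> [_ tX] Sx; apply/tangent_sphere => //; exact: tX. Qed.

(** Differentiate [ip x (X x) = 0]. This is the normal component which
    [round_nabla] removes. *)
Lemma vfield_dmap_ip X x u : vector_field S X -> S x -> tangent S x u ->
  ip x (dmap S X x u) = - ip (X x) u.
Proof.
move=> Xf Sx tu; have [c [cd cS c0]] := tangentP tu; subst x.
have [sX _] := Xf.
have H := is_derive_ip cd (is_derive_dmap sX Sx tu cS cd).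
have H0 : is_derive (0 : R) (1 : R) (fun s => ip (c s) ((X \o c) s)) 0.
  apply: near_eq_is_derive (is_derive_cst (0 : R) (0 : R) (1 : R)).
  by near=> s; rewrite /= vfield_ip//; near: s.
have /eqP := is_derive_uniq H H0; rewrite addrC addr_eq0 => /eqP ->.
by rewrite ipC.
Unshelve. all: by end_near. Qed.

Lemma tangent_comb x a u v : S x -> tangent S x u -> tangent S x v ->
  tangent S x (a *: u + v).
Proof.
move=> Sx /(tangent_sphere _ Sx) xu /(tangent_sphere _ Sx) xv.
by apply/(tangent_sphere _ Sx); rewrite ipDr ipZr xu xv mulr0 addr0.
Qed.

Lemma round_levi_civita : levi_civita S (@round_metric R n) round_nabla.
Proof.
split.
- move=> Y x u Yf Sx tu; apply/(tangent_sphere _ Sx).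
  by rewrite /round_nabla ipDr vfield_dmap_ip// ipZr ((sphereE x).1 Sx) mulr1 addNr.
- move=> X Y Xf Yf; have [sX _] := Xf; have [sY _] := Yf.
  apply: smooth_mapD; first exact: smooth_dmap_field.
  by apply: smooth_mapZ; [exact: smooth_map_ip|exact: smooth_map_id].
- move=> Y x a u v [sY tY] Sx tu tv.
  have [D [F [_ Dx _ _ FE]]] := smooth_dmap sY Sx.
  rewrite /round_nabla !FE//; last exact: tangent_comb.
  have -> : 'd F x (a *: u + v) = a *: 'd F x u + 'd F x v by exact: linearP.
  by move: ('d F x u) ('d F x v) => p q; vring.
- move=> Y Z x u [sY tY] [sZ tZ] Sx tu; rewrite /round_nabla.
  have [c [cd cS c0]] := tangentP tu; subst x.
  have -> : dmap S (fun y => Y y + Z y) (c 0) u = dmap S Y (c 0) u + dmap S Z (c 0) u.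
    apply: (dmap_curve _ tu cd cS); first exact: smooth_mapD.
    by apply: is_deriveD; exact: is_derive_dmap.
  by move: (dmap S Y _ _) (dmap S Z _ _) => p q; vring.
- move=> f Y x u sf [sY tY] Sx tu; rewrite /round_nabla.
  have [c [cd cS c0]] := tangentP tu; subst x.
  have -> : dmap S (fun y => f y *: Y y) (c 0) u =
      dmap S f (c 0) u *: Y (c 0) + f (c 0) *: dmap S Y (c 0) u.
    apply: (dmap_curve _ tu cd cS); first exact: smooth_mapZ.
    exact: is_derive_scale (is_derive_dmap sf Sx tu cS cd) (is_derive_dmap sY Sx tu cS cd).
  by move: (dmap S Y _ _) (dmap S f _ _) => p q; vring.
- move=> Y Z x u Yf Zf Sx tu; rewrite !round_metricE /round_nabla.
  have xY := vfield_ip Yf Sx; have xZ := vfield_ip Zf Sx.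
  have [sY tY] := Yf; have [sZ tZ] := Zf.
  have [c [cd cS c0]] := tangentP tu; subst x.
  have -> : dmap S (fun y => ip (Y y) (Z y)) (c 0) u =
      ip (dmap S Y (c 0) u) (Z (c 0)) + ip (Y (c 0)) (dmap S Z (c 0) u).
    apply: (dmap_curve _ tu cd cS); first exact: smooth_map_ip.
    exact: is_derive_ip (is_derive_dmap sY Sx tu cS cd) (is_derive_dmap sZ Sx tu cS cd).
  move: (dmap S Y _ _) (dmap S Z _ _) => p q.
  by ip_expand; rewrite xZ (ipC (Y _)  (c 0)) xY; ip_atoms; ring.
- move=> X Y x Xf Yf Sx; rewrite /round_nabla /lie_bracket (ipC (X x)).
  by move: (dmap S Y _ _) (dmap S X _ _) => p q; vring.
Qed.

(** The field of projections of a constant vector; its value at a point extends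
    any vector tangent there. *)
Definition proj_field u y : V := u - ip u y *: y.

Lemma proj_field_vfield u : vector_field S (proj_field u).
Proof.
split; last first.
  move=> x Sx; apply/(tangent_sphere _ Sx).
  by rewrite /proj_field; ip_expand; rewrite ((sphereE x).1 Sx) (ipC x); ring.
apply: (smooth_map_eq (f := fun y => u + (ip (- u) y) *: y)).
  by move=> x _; rewrite /proj_field ipNl scaleNr.
have cs : smooth_map S (fun _ : V => u).
  by apply: smooth_map_on; apply: smooth_on_cst; exact: openT.
have cs' : smooth_map S (fun _ : V => - u).
  by apply: smooth_map_on; apply: smooth_on_cst; exact: openT.
apply: smooth_mapD => //; apply: smooth_mapZ; last exact: smooth_map_id.
apply: smooth_map_ip => //; exact: smooth_map_id.
Qed.

Lemma proj_fieldE u x : ip x u = 0 -> proj_field u x = u.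
Proof. by move=> xu; rewrite /proj_field ipC xu scale0r subr0. Qed.

(** The difference of two Levi-Civita connections is a tensor symmetric in its
    first two arguments and antisymmetric in the last two, hence zero. *)
Lemma levi_civita_unique nabla nabla' Y x u :
  levi_civita S (@round_metric R n) nabla -> levi_civita S (@round_metric R n) nabla' ->
  vector_field S Y -> S x -> tangent S x u -> nabla Y x u = nabla' Y x u.
Proof.
move=> L L' Yf Sx tu.
pose T X Y Z := ip (nabla Y x (X x)) (Z x) - ip (nabla' Y x (X x)) (Z x).
have anti X1 Y1 Z1 : vector_field S X1 -> vector_field S Y1 -> vector_field S Z1 ->
    T X1 Y1 Z1 = - T X1 Z1 Y1.
  move=> Xf Y1f Zf; have tX : tangent S x (X1 x) by apply: Xf.2.
  have := lc_metric L Y1f Zf Sx tX; rewrite (lc_metric L' Y1f Zf Sx tX) !round_metricE.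
  by rewrite /T (ipC (Y1 x)) (ipC (Y1 x)); ip_atoms => H; lra.
have sym X1 Y1 Z1 : vector_field S X1 -> vector_field S Y1 -> T X1 Y1 Z1 = T Y1 X1 Z1.
  move=> Xf Y1f; have := lc_torsion_free L Xf Y1f Sx.
  rewrite -(lc_torsion_free L' Xf Y1f Sx) => /(congr1 (fun w => ip w (Z1 x))).
  by rewrite /T !ipDl !ipNl; ip_atoms => H; lra.
have T0 X1 Y1 Z1 : vector_field S X1 -> vector_field S Y1 -> vector_field S Z1 ->
    T X1 Y1 Z1 = 0.
  move=> Xf Y1f Zf.
  have := anti _ _ _ Xf Y1f Zf; have := anti _ _ _ Zf Xf Y1f; have := anti _ _ _ Y1f Zf Xf.
  have := sym _ _ Y1 Xf Zf; have := sym _ _ X1 Zf Y1f; have := sym _ _ Z1 Y1f Xf.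
  by move: (T X1 Y1 Z1) (T X1 Z1 Y1) (T Z1 X1 Y1) (T Z1 Y1 X1) (T Y1 Z1 X1) (T Y1 X1 Z1)
    => *; lra.
have xu : ip x u = 0 by apply/(tangent_sphere _ Sx).
have tn : tangent S x (nabla Y x u) by apply: (lc_tangent L).
have tn' : tangent S x (nabla' Y x u) by apply: (lc_tangent L').
set B := nabla Y x u - nabla' Y x u.
have xB : ip x B = 0.
  move: tn tn' => /(tangent_sphere _ Sx) h /(tangent_sphere _ Sx) h'.
  by rewrite /B ipDr ipNr h h' subrr.
have := T0 (proj_field u) Y (proj_field B) (proj_field_vfield u) Yf (proj_field_vfield B).
rewrite /T (proj_fieldE xu) (proj_fieldE xB) -ipNl -ipDl -/B => /ip_eq0 /eqP.
by rewrite subr_eq0 => /eqP.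
Qed.

(** The tangential part of [J u] has the prescribed products with tangent vectors,
    and a tangent vector is determined by these. *)
Lemma lorentz_forceE (L : V -> V -> V) x u : lorentz_force Sys L -> S x ->
  tangent S x u -> L x u = J u - ip (J u) x *: x.
Proof.
move=> LF Sx tu; have [tL LE] := LF x u Sx tu.
have xL : ip x (L x u) = 0 by apply/(tangent_sphere _ Sx).
have xP : ip x (J u - ip (J u) x *: x) = 0.
  by rewrite -/(proj_field (J u) x); apply/(tangent_sphere _ Sx); exact: (proj_field_vfield _).2.
set P := J u - _ in xP *; set B := L x u - P.
have xB : ip x B = 0 by rewrite /B ipDr ipNr xL xP subrr.
have tB : tangent S x B by apply/(tangent_sphere _ Sx).
have := LE B tB; rewrite /= round_metricE mformE => LB.
apply/eqP; rewrite -subr_eq0 -/B; apply/eqP/ip_eq0.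
rewrite {1}/B ipDl ipNl LB /P ipDl ipNl ipZl xB; ring.
Qed.

Lemma round_lorentz_force : lorentz_force Sys (fun x u => J u - ip (J u) x *: x).
Proof.
move=> x u Sx tu; split; first by have [_ tX] := proj_field_vfield (J u); exact: tX.
move=> v tv; rewrite /= round_metricE mformE ipDl ipNl ipZl.
by have /(tangent_sphere _ Sx) -> := tv; rewrite mulr0 subr0.
Qed.

(** By the product rule the covariant derivative of the velocity is the tangential
    part of the ambient second derivative, whichever fields represent it. *)
Lemma cov_derivE nabla (c : R -> V) t a2 a :
  levi_civita S (@round_metric R n) nabla ->
  (\forall s \near t, S (c s)) -> is_derive t (1 : R) c (derive1 c t) ->
  is_derive t (1 : R) (derive1 c) a2 ->
  cov_deriv S nabla c (derive1 c) t a ->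
  a = a2 + ip (derive1 c t) (derive1 c t) *: c t.
Proof.
move=> L cS cd cdd [m [f [X [e e0 [fs Xf wE ->]]]]].
have Sc : S (c t) by exact: nbhs_singleton cS.
have tc : tangent S (c t) (derive1 c t).
  by apply/(tangent_sphere _ Sc); exact: sphere_is_derive cS cd.
have bt : ball t e t by exact: ballxx.
have H i : is_derive t (1 : R) (fun s => f i s *: X i (c s))
    (derive1 (f i) t *: X i (c t) + f i t *: dmap S (X i) (c t) (derive1 c t)).
  have fd : is_derive t (1 : R) (f i) (derive1 (f i) t).
    by apply: differentiable_is_derive1; exact: smooth_on_differentiable (fs i) bt.
  exact: is_derive_scale fd (is_derive_dmap (Xf i).1 Sc tc cS cd).
have -> : a2 = \sum_(i < m)
    (derive1 (f i) t *: X i (c t) + f i t *: dmap S (X i) (c t) (derive1 c t)).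
  apply: (is_derive_uniq cdd); apply: near_eq_is_derive (is_derive_sum H).
  near=> s; rewrite sum_fctE wE//; near: s; exact: nbhsx_ballx.
have w1 := wE t bt; move: (derive1 c t) w1 tc => v vE tv.
have -> : ip v v = \sum_(i < m) f i t *: ip (X i (c t)) v.
  by rewrite {1}vE; exact: (@lin_comb _ _ _ (ip^~ v) _ _ _ (ip_linl v)).
rewrite scaler_suml -big_split/=; apply: eq_bigr => i _.
rewrite (levi_civita_unique L round_levi_civita (Xf i) Sc tv) /round_nabla.
by rewrite -[f i t *: ip _ _]/(f i t * ip _ _); move: (dmap S _ _ _) (derive1 _ t) => p q; vring.
Unshelve. all: by end_near. Qed.

(** The projections of the coordinate vectors are fields that represent the velocity
    of every curve in the sphere, with its coordinates as coefficients. *)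
Lemma cov_derivP nabla (c : R -> V) t a2 :
  levi_civita S (@round_metric R n) nabla -> smooth_on setT c ->
  (forall s, S (c s)) -> is_derive t (1 : R) (derive1 c) a2 ->
  cov_deriv S nabla c (derive1 c) t (a2 + ip (derive1 c t) (derive1 c t) *: c t).
Proof.
move=> L cs cS cdd.
have cd s : is_derive s (1 : R) c (derive1 c s).
  by apply: differentiable_is_derive1; exact: smooth_on_differentiable cs _.
have [m [e [l [ll le]]]] : exists m (e : 'I_m -> V) (l : 'I_m -> V -> R),
    (forall i, linear (l i : V -> R)) /\ forall v, v = \sum_i l i v *: e i.
  exists (fdim V), (@fbasis R V _), (@fcoord R V _).
  by split=> [i|v]; [exact: fcoord_lin|exact: frameE].
pose f (i : 'I_m) s := l i (derive1 c s).
pose X (i : 'I_m) := proj_field (e i).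
pose a := \sum_(i < m) (derive1 (f i) t *: X i (c t) +
                          f i t *: nabla (X i) (c t) (derive1 c t)).
have H : cov_deriv S nabla c (derive1 c) t a.
  exists m, f, X, 1 => //; split=> //.
  - move=> i; apply: (smooth_on_sub (U := setT)) => // k.
    apply: (Ck_lin (l := l i : V -> R)); [exact: ll|exact: openT|].
    by move: k; exact: smooth_on_derive1.
  - by move=> i; exact: proj_field_vfield.
  - move=> s _; have cc : ip (derive1 c s) (c s) = 0.
      by rewrite ipC; apply: sphere_is_derive (cd s); near=> r; exact: cS.
    have pl : linear (fun u => proj_field u (c s)).
      by move=> k u v; rewrite /proj_field; vring.
    have := lin_comb (fun i => f i s) e pl.
    by rewrite -le {1}/proj_field cc scale0r subr0.
have -> // : a2 + ip (derive1 c t) (derive1 c t) *: c t = a.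
by apply/esym; apply: (cov_derivE L _ (cd t) cdd H); near=> s; exact: cS.
Unshelve. all: by end_near. Qed.

(** The right-hand side of the equation of magnetic geodesics, solved for the
    second derivative in the ambient space. *)
Definition mag_acc z v : V := J v - (ip (J v) z + ip v v) *: z.

Lemma magnetic_geodesic_ode (I : set R) (c : R -> V) t :
  magnetic_geodesic Sys I c -> I t ->
  is_derive t (1 : R) (derive1 c) (mag_acc (c t) (derive1 c t)).
Proof.
move=> [oI _ cs cS [nabla [L0 [L LF cov]]]] It.
have cSt : \forall s \near t, S (c s).
  by have := open_nbhs_nbhs (conj oI It); apply: filterS => s; exact: cS.
have cd : is_derive t (1 : R) c (derive1 c t).
  by apply: differentiable_is_derive1; exact: smooth_on_differentiable cs It.
have cdd : is_derive t (1 : R) (derive1 c) (derive1 (derive1 c) t).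
  apply: differentiable_is_derive1.
  exact: smooth_on_differentiable (smooth_on_derive1 cs) It.
have Sc : S (c t) by exact: cS.
have tc : tangent S (c t) (derive1 c t).
  by apply/(tangent_sphere _ Sc); exact: sphere_is_derive cSt cd.
have := cov_derivE L cSt cd cdd (cov t It); rewrite (lorentz_forceE LF Sc tc) => H.
apply: is_derive_eq cdd _; apply/esym; rewrite /mag_acc.
move: H; move: (derive1 (derive1 c) t) => p H.
have -> : p = (J (derive1 c t) - ip (J (derive1 c t)) (c t) *: c t) -
    ip (derive1 c t) (derive1 c t) *: c t by rewrite H addrK.
vring.
Qed.

Lemma ode_magnetic_geodesic (c : R -> V) : smooth_on setT c -> (forall t, S (c t)) ->
  (forall t, is_derive t (1 : R) (derive1 c) (mag_acc (c t) (derive1 c t))) ->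
  magnetic_geodesic Sys setT c.
Proof.
move=> cs cS cdd; split.
- exact: openT.
- by [].
- exact: cs.
- by move=> t _; exact: cS.
exists round_nabla, (fun x u => J u - ip (J u) x *: x); split.
- exact: round_levi_civita.
- exact: round_lorentz_force.
- move=> t _ /=.
  have -> : J (derive1 c t) - ip (J (derive1 c t)) (c t) *: c t =
      mag_acc (c t) (derive1 c t) + ip (derive1 c t) (derive1 c t) *: c t.
    by rewrite /mag_acc; vring.
  exact: (cov_derivP round_levi_civita cs cS (cdd t)).
Qed.

End LeviCivita.

(** * Complex subspaces cut out totally magnetic submanifolds *)

Section Subspaces.
Context {R : realType}.
Local Notation C := (R[i])%C.

Lemma adjM p q r (A : 'M[C]_(p, q)) (B : 'M[C]_(q, r)) : (A *m B)^t* = B^t* *m A^t*.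
Proof. by rewrite trmx_mul map_mxM. Qed.

(** A complex subspace is the range of an orthogonal projection
    [B^t* *m B], where the rows of [B] are orthonormal. *)
Lemma vspace_projection m (V : {vspace 'cV[C]_m}) :
  exists d (B : 'M[C]_(d, m)), B *m B^t* = 1%:M /\
    forall w, w \in V <-> B^t* *m B *m w = w.
Proof.
pose d := \dim V; pose b := vbasis V.
(* The rows of [A] are the adjoints of the basis vectors. *)
pose A : 'M[C]_(d, m) := \matrix_(i, j) (b`_i j ord0)^*.
have Asum (D : 'rV[C]_d) : (D *m A)^t* = \sum_(i < d) (D ord0 i)^* *: b`_i.
  apply/matrixP => i j; rewrite ord1 !mxE rmorph_sum summxE; apply: eq_bigr => k _.
  by rewrite rmorphM /= /A !mxE /= conjCK.
have Afree : row_free A.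
  rewrite -kermx_eq0; apply/rowV0P => u /sub_kermxP uA.
  have := Asum u; rewrite uA => /esym u0.
  have /freeP/(_ _ _) := basis_free (vbasisP V).
  move=> /(_ (fun i => (u ord0 i)^*)) H.
  apply/rowP => i; rewrite mxE; apply/eqP; rewrite -conjC_eq0; apply/eqP.
  by apply: H; rewrite u0; apply/matrixP => k l; rewrite !mxE rmorph0.
have dm : (d <= m)%N by have := rank_leq_col A; rewrite (eqP Afree).
pose B := schmidt A.
have BB : B *m B^t* = 1%:M by apply/unitarymxP; exact: schmidt_unitarymx.
have BA : (B :=: A)%MS by exact: eqmx_schmidt_free.
exists d, B; split=> // w; split=> [wV|BBw].
- have wE : w^t* = (\row_i (coord b i w)^*) *m A.
    rewrite -[RHS]adjK Asum; congr (_^t*).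
    rewrite {1}(coord_vbasis wV); apply: eq_bigr => i _.
    by rewrite mxE conjCK.
  have /submxP[D DE] : (w^t* <= B)%MS by rewrite BA wE submxMl.
  have {DE}-> : w = B^t* *m D^t* by rewrite -adjM -DE adjK.
  by rewrite -!mulmxA (mulmxA B) BB mul1mx.
- have /submxP[D DE] : (w^t* <= A)%MS.
    by rewrite -BA -BBw !adjM mulmxA adjK submxMl.
  rewrite -[w]adjK DE Asum; apply: rpred_sum => i _; apply: rpredZ.
  by apply: vbasis_mem; apply: mem_nth; rewrite size_tuple.
Qed.

(** A set closed under linear combinations is a subspace: take one of maximal
    dimension among the subspaces that it contains. *)
Lemma vspace_of_closed m (P : set 'cV[C]_m) : P 0 ->
  (forall a u v, P u -> P v -> P (a *: u + v)) ->
  exists V : {vspace 'cV[C]_m}, forall w, w \in V <-> P w.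
Proof.
move=> P0 Plin.
pose inP (U : {vspace 'cV[C]_m}) := forall w, w \in U -> P w.
pose dimP k := `[< exists U : {vspace 'cV[C]_m}, inP U /\ \dim U = k >].
have ex0 : exists k, dimP k.
  by exists 0; apply/asboolP; exists 0%VS; split; [move=> w; rewrite memv0 => /eqP ->|rewrite dimv0].
have bnd k : dimP k -> (k <= \dim {: 'cV[C]_m})%N.
  by move=> /asboolP[U [_ <-]]; exact: dimvS (subvf U).
case: (ex_maxnP ex0 bnd) => k /asboolP[U [UP dU]] kmax.
exists U => w; split=> [|Pw]; first exact: UP.
apply/negPn/negP => wU.
have UwP : inP (U + <[w]>)%VS.
  move=> x /memv_addP[u uU [v /vlineP[a ->] ->]].
  by rewrite addrC; apply: Plin => //; exact: UP.
have : (\dim (U + <[w]>) <= k)%N by apply: kmax; apply/asboolP; exists (U + <[w]>)%VS.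
rewrite -dU => dle; have /eqP UE : (U == U + <[w]>)%VS.
  by rewrite eqEdim addvSl.
by move: wU; rewrite UE memvE addvSr.
Qed.

End Subspaces.

Section Subspheres.
Context {R : realType} {n : nat}.
Local Notation C := (R[i])%C.
Local Notation V := (Cvec R n.+1).
Local Notation S := (@sphere R n).
Local Notation Sys := (@sphere_system R n).

Lemma interval_const (I : set R) (f : R -> R) : is_interval I ->
  (forall t, I t -> is_derive t (1 : R) f 0) -> forall s t, I s -> I t -> f s = f t.
Proof.
move=> iI fd.
suff H s t : s < t -> I s -> I t -> f s = f t.
  move=> s t Is It; have [st|ts|->//] := ltgtP s t; first exact: H.
  by apply/esym; exact: H.
move=> st Is It; have Ist r : s <= r <= t -> I r by move=> srt; exact: (iI s t).
have [r _ /eqP] : exists2 r, r \in `]s, t[ & f t - f s = 0 * (t - s).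
  apply: (@MVT _ f (fun=> 0)) => // [r|].
    by rewrite in_itv/= => /andP[/ltW sr /ltW rt]; apply/fd/Ist; rewrite sr.
  apply: continuous_in_subspaceT => r; rewrite inE/= in_itv/= => srt.
  exact: is_derive_continuous (fd r (Ist r srt)).
by rewrite mul0r subr_eq0 => /eqP.
Qed.

(** Along a magnetic geodesic the coefficient of the position in the equation of
    motion is constant, and it is at least -1/4. *)
Lemma geodesic_energy (I : set R) (c : R -> V) : magnetic_geodesic Sys I c -> I 0 ->
  exists2 m : R, 0 <= 1 + 4 * m &
    forall t, I t -> is_derive t (1 : R) c (derive1 c t) /\
      is_derive t (1 : R) (derive1 c) (J (derive1 c t) - m *: c t).
Proof.
move=> G I0; have [oI iI cs cS _] := G.
have cd t : I t -> is_derive t (1 : R) c (derive1 c t).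
  by move=> It; apply: differentiable_is_derive1; exact: smooth_on_differentiable cs It.
have cc t : I t -> ip (c t) (derive1 c t) = 0.
  move=> It; apply: sphere_is_derive (cd t It).
  by have := open_nbhs_nbhs (conj oI It); apply: filterS => s; exact: cS.
have key1 (z v : V) l : ip z v = 0 -> ip (J (J v - l *: z)) z + ip (J v) v = 0.
  by move=> zv; ip_expand; rewrite (ipJ0 z) (ipJ0 v) (ipC v z) zv; ring.
have key2 (z v : V) l : ip z v = 0 -> ip (J v - l *: z) v + ip v (J v - l *: z) = 0.
  by move=> zv; ip_expand; rewrite (ipJ0 v) (ip0J v) (ipC v z) zv; ring.
pose k t := ip (J (derive1 c t)) (c t); pose r t := ip (derive1 c t) (derive1 c t).
have kr t : I t -> k t + r t = k 0 + r 0.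
  move=> It.
  suff [kt rt] : (forall t, I t -> is_derive t (1 : R) k 0) /\
      (forall t, I t -> is_derive t (1 : R) r 0).
    by rewrite (interval_const iI kt It I0) (interval_const iI rt It I0).
  split=> {t It} t It; have cdd := magnetic_geodesic_ode G It;
      have ct := cd t It; have cct := cc t It.
  - pose proof (is_derive_lin (@J_lin R n.+1) cdd) as Jd.
    apply: is_derive_eq (is_derive_ip Jd ct) _.
    exact: key1.
  - apply: is_derive_eq (is_derive_ip cdd cdd) _.
    exact: key2.
exists (k 0 + r 0).
  have := ip_CS (J (derive1 c 0)) (c 0).
  rewrite ipJJ ((sphereE _).1 (cS 0 I0)) mulr1 -/(k 0) -/(r 0) => H.
  have := sqr_ge0 (1 + 2 * k 0); nra.
move=> t It; split; first exact: cd.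
by apply: is_derive_eq (magnetic_geodesic_ode G It) _; rewrite /mag_acc -/(k t) -/(r t) kr.
Qed.

(** The equation of motion is linear with constant coefficients, so it preserves
    complex subspaces. Its uniqueness is elementary because the characteristic
    roots [a] and [b] are real: the equation splits into two of first order,
    each of which preserves the norm. *)
Lemma linear_ode_unique (I : set R) (y y' : R -> V) (m : R) :
  is_interval I -> I 0 -> 0 <= 1 + 4 * m ->
  (forall t, I t -> is_derive t (1 : R) y (y' t)) ->
  (forall t, I t -> is_derive t (1 : R) y' (J (y' t) - m *: y t)) ->
  y 0 = 0 -> y' 0 = 0 -> forall t, I t -> y t = 0.
Proof.
move=> iI I0 m0 yd yd' y0 y'0.
pose d := Num.sqrt (1 + 4 * m); have dd : d ^+ 2 = 1 + 4 * m by rewrite sqr_sqrtr.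
pose a := (1 + d) / 2; pose b := (1 - d) / 2.
have ab : a + b = 1 by rewrite /a /b; field.
have mab : m = - (a * b).
  have -> : m = (d ^+ 2 - 1) / 4 by rewrite dd; field.
  by rewrite /a /b; field.
clearbody a b; clear dd d.
(* [w' = a *: J w], and then [y' = b *: J y]: both norms are constant. *)
pose w t := y' t + (- b) *: J (y t).
have wd t : I t -> is_derive t (1 : R) w (a *: J (w t)).
  move=> It; have l : linear (fun z : V => (- b) *: J z) by exact: JZ_lin.
  pose proof (is_derive_lin l (yd t It)) as H.
  apply: is_derive_eq (is_deriveD (yd' t It) H) _.
  have aE : a = 1 - b by rewrite -ab addrK.
  by rewrite /w mab aE; move: (y t) (y' t) => p q; vring.
have w0 t : I t -> w t = 0.
  move=> It; apply: ip_eq0; rewrite (@interval_const I (fun t => ip (w t) (w t)) iI _ t 0)//.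
    by rewrite /w y0 y'0 J0 scaler0 addr0 ip0l.
  move=> s Is; apply: is_derive_eq (is_derive_ip (wd s Is) (wd s Is)) _.
  by rewrite ipZl ipZr ipJ0 ip0J; ring.
move=> t It; apply: ip_eq0; rewrite (@interval_const I (fun t => ip (y t) (y t)) iI _ t 0)//.
  by rewrite y0 ip0l.
move=> s Is; apply: is_derive_eq (is_derive_ip (yd s Is) (yd s Is)) _.
have -> : y' s = b *: J (y s).
  have -> : y' s = w s + b *: J (y s) by rewrite /w; vring.
  by rewrite w0// add0r.
by rewrite ipZl ipZr ipJ0 ip0J; ring.
Qed.

(** [cact K] commutes with [J], so it maps a magnetic geodesic to a solution of the
    same linear equation, here with zero initial data. *)
Lemma subsphere_totally_magnetic (K : 'M[C]_n.+1) :
  totally_magnetic Sys (S `&` [set z | cact K z = 0]).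
Proof.
move=> I c G I0 [_ Kc0] tc.
have [m m0 cdd] := geodesic_energy G I0; have [oI iI cs cS _] := G.
have Kc0' : cact K (derive1 c 0) = 0.
  by apply: (tangent_lin (b := 0) (cact_lin K) _ tc) => y [_ Ky]; exact: Ky.
have cB a (u v : V) : cact K (u - a *: v) = cact K u - a *: cact K v.
  by rewrite addrC -scaleNr cact_lin scaleNr addrC.
have Kc t : I t -> cact K (c t) = 0.
  apply: (@linear_ode_unique I (fun t => cact K (c t)) (fun t => cact K (derive1 c t)) m)
    => //= {}t It; have [d1 d2] := cdd t It.
    exact: is_derive_lin (cact_lin K) d1.
  apply: is_derive_eq (is_derive_lin (cact_lin K) d2) _.
  by rewrite cB cactJ.
have [e /= e0 eI] := (nbhs_ballP _ _).1 (open_nbhs_nbhs (conj oI I0)).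
exists e => // t te; have It : I t.
  by apply: eI; rewrite /ball/= sub0r normrN ltr_norml.
by split=> //; split; [exact: cS|exact: Kc].
Qed.

(** [B] is the map to coordinates in an orthonormal basis of the subspace, with
    inverse its adjoint. The subspace is not zero since it contains a unit vector. *)
Lemma subsphere_magnetomorphic d (B : 'M[C]_(d, n.+1)) (N : set V) :
  B *m B^t* = 1%:M -> N = S `&` [set z | cact (B^t* *m B) z = z] -> N !=set0 ->
  exists (j : nat) (f : V -> Cvec R j.+1),
    magnetomorphism (pullback_system Sys N) (@sphere_system R j) f.
Proof.
case: d B => [|j] B BB NE [z0 Nz0].
  move: Nz0; rewrite NE => -[/sphereE z01 z0E]; exfalso.
  move: z01; rewrite -z0E cactM ip_adj.
  rewrite ipE big_ord0.
  by move=> /eqP; rewrite eq_sym oner_eq0.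
exists j, (cact B).
apply: (@magnetomorphism_cact _ n j N (@sphere R j) B (B^t*)).
- move=> x; rewrite NE => -[/sphereE Sx xE]; apply/sphereE.
  by rewrite ip_isometry.
- move=> y /sphereE Sy; rewrite NE; split.
    by apply/sphereE; rewrite ip_isometry ?Sy// adjK BB cact1.
  by rewrite /= -cactM -mulmxA BB mulmx1.
- by move=> x; rewrite NE => -[_ xE]; rewrite -cactM.
- by move=> y _; rewrite -cactM BB cact1.
- move=> x u _ tu.
  pose g (z : V) := cact (B^t* *m B) z - z.
  have gl : linear g.
    by move=> a p q; rewrite /g cact_lin; vring.
  have : g u = 0.
    by apply: (tangent_lin (b := 0) gl _ tu) => y; rewrite NE /g => -[_ ->]; rewrite subrr.
  by rewrite /g => /eqP; rewrite subr_eq0 => /eqP.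
Qed.

End Subspheres.

(** * Local retractions and strict differentiability *)

Section Lines.
Context {R : realType} {V : normedModType R} {fV : frame V}.

Lemma is_derive_line (x u : V) (t : R) : is_derive t (1 : R) (fun s => x + s *: u) u.
Proof.
rewrite -[X in is_derive _ _ _ X]add0r; apply: (is_deriveD (f := cst x)).
pose proof (is_derive_scale (is_derive_id t (1 : R)) (is_derive_cst u t (1 : R))) as H.
by apply: is_derive_eq H _; rewrite scale1r scaler0 addr0.
Qed.

Lemma ball0_line (U : set V) x u : open U -> U x ->
  exists2 e : R, 0 < e & forall t : R, ball (0 : R) e t -> U (x + t *: u).
Proof.
move=> oU Ux.
have c0 := is_derive_continuous (is_derive_line x u 0).
have : nbhs (0 : R) ((fun t : R => x + t *: u) @^-1` U).
  by apply: c0; rewrite scale0r addr0; exact: open_nbhs_nbhs.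
by move=> /nbhs_ballP[e /= e0 eU]; exists e.
Qed.

Lemma smooth_line (x u : V) (U : set R) : open U -> smooth_on U (fun s => x + s *: u).
Proof.
move=> oU; apply: smooth_onD => //; first exact: smooth_on_cst.
by apply: smooth_on_lin => // a s t; rewrite scalerDl scalerA.
Qed.

Lemma curve_in_image (W : normedModType R) {fW : frame W} (N : set W) (U : set V)
    (G : V -> W) x u : open U -> U x -> smooth_on U G -> (forall y, U y -> N (G y)) ->
  curve_at N (G x) ('d G x u) (fun t : R => G (x + t *: u)).
Proof.
move=> oU Ux sG GN; have [e e0 eU] := ball0_line u oU Ux.
exists e => //; split.
- by apply: (smooth_on_comp (U' := U)) => //; [exact: ball_open|apply: smooth_line; exact: ball_open].
- by move=> t /eU; exact: GN.
- by rewrite scale0r addr0.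
- apply: is_derive1.
  have dG : differentiable G (x + 0 *: u).
    by rewrite scale0r addr0; exact: smooth_on_differentiable sG Ux.
  have := is_derive_chain dG (is_derive_line x u 0).
  by rewrite scale0r addr0.
Qed.

End Lines.

Section Retractions.
Context {R : realType} {V : normedModType R} {fV : frame V}.

Lemma open_preimage (W : normedModType R) (U : set V) (D : set W) (F : V -> W) :
  open U -> (forall x, U x -> {for x, continuous F}) -> open D ->
  open (U `&` F @^-1` D).
Proof.
move=> oU cF oD; rewrite openE => x [Ux Dx].
apply: filterI; first exact: open_nbhs_nbhs.
by apply: (cF x Ux); exact: open_nbhs_nbhs.
Qed.

(** A submanifold is locally the image of a smooth retraction: the composite of
    an extension of a chart with an extension of its inverse. *)
Lemma local_retraction k (N : set V) z : submanifold k N -> N z ->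
  exists (U : set V) (H : V -> V), [/\ open U, U z, smooth_on U H,
    forall y, U y -> N (H y) & forall y, U y -> N y -> H y = y].
Proof.
move=> sN Nz; have [U0 [D [f [oU0 U0z oD [fD sf [g [gN sg gf fg]]]]]]] := sN z Nz.
have [U [F [oU Uz sF FE]]] := sf z (conj Nz U0z).
have [E [G [oE Efz sG GE]]] := sg (f z) (fD z (conj Nz U0z)).
have oED : open (E `&` D) by exact: openI.
exists (U0 `&` (U `&` F @^-1` (E `&` D))), (fun y => G (F y)); split.
- apply: openI => //; apply: open_preimage => // x Ux.
  exact: smooth_on_continuous sF Ux.
- split=> //; split=> //; rewrite /preimage/= FE//; split=> //.
  exact: fD.
- apply: (smooth_on_comp (U' := E `&` D)) => //.
  + apply: openI => //; apply: open_preimage => // x Ux.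
    exact: smooth_on_continuous sF Ux.
  + by move=> x [_ []].
  + by apply: smooth_on_sub sF => x [_ []].
  + by apply: smooth_on_sub sG => x [].
- by move=> y [_ [_ [Ey Dy]]]; rewrite GE//; have [] := gN _ Dy.
- by move=> y [U0y [Uy [Ey Dy]]] Ny; rewrite GE// FE// gf.
Qed.

(** Near [c t] the differential is a combination of continuous partial derivatives. *)
Lemma continuous_diff_along (W : normedModType R) (U : set V) (H : V -> W)
    (c w : R -> V) (t : R) : open U -> smooth_on U H -> U (c t) ->
  {for t, continuous c} -> {for t, continuous w} ->
  {for t, continuous (fun s => 'd H (c s) (w s))}.
Proof.
move=> oU sH Ut cc cw.
have Uc : \forall s \near t, U (c s) by apply: cc; exact: open_nbhs_nbhs.
have dE s : U (c s) -> 'd H (c s) (w s) =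
    \sum_(i < fdim V) fcoord i (w s) *: 'D_(fbasis i) H (c s).
  by move=> Us; apply: diff_frame; exact: smooth_on_differentiable sH Us.
suff : 'd H (c s) (w s) @[s --> t] --> 'd H (c t) (w t) by [].
have cvs : (fun s => \sum_(i < fdim V) fcoord i (w s) *: 'D_(fbasis i) H (c s)) @ t -->
    \sum_(i < fdim V) fcoord i (w t) *: 'D_(fbasis i) H (c t).
  apply: cvg_sum => i; apply: cvgZ.
    by apply: (@continuous_comp _ _ _ w (fcoord i)) => //; exact: fcoord_cont.
  apply: (@continuous_comp _ _ _ c ('D_(fbasis i) H)) => //.
  exact: smooth_on_continuous (smooth_on_derive _ sH) Ut.
rewrite dE//; apply: cvg_trans cvs; apply: near_eq_cvg.
by near=> s; rewrite dE//; near: s; exact: Uc.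
Unshelve. all: by end_near. Qed.

Section TangentSpace.
Variables (N U : set V) (H : V -> V).
Hypotheses (oU : open U) (sH : smooth_on U H) (HN : forall y, U y -> N (H y))
  (HE : forall y, U y -> N y -> H y = y).

Lemma retraction_tangent x u : U x -> N x -> tangent N x ('d H x u).
Proof.
move=> Ux Nx; exists (fun t : R => H (x + t *: u)).
by rewrite -{1}(HE Ux Nx); exact: (curve_in_image u oU Ux sH HN).
Qed.

(** The retraction fixes every curve in [N]. Together with the preceding lemma this
    identifies the tangent space as the fixed space of the differential. *)
Lemma retraction_fix x u : U x -> N x -> tangent N x u -> 'd H x u = u.
Proof.
move=> Ux Nx /tangentP[c [cd cN c0]]; subst x.
have dH := smooth_on_differentiable sH Ux.
apply: (is_derive_uniq (is_derive_chain dH cd)); apply: (near_eq_is_derive _ cd).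
have Uc : \forall t \near (0 : R), U (c t).
  by apply: (is_derive_near cd); exact: open_nbhs_nbhs.
by near=> t; rewrite /= HE//; near: t.
Unshelve. all: by end_near. Qed.

End TangentSpace.

Lemma submanifold_tangent_closed k (N : set V) x a u v : submanifold k N -> N x ->
  tangent N x u -> tangent N x v -> tangent N x (a *: u + v).
Proof.
move=> sN Nx tu tv; have [U [H [oU Ux sH HN HE]]] := local_retraction sN Nx.
rewrite -(retraction_fix oU sH HE Ux Nx tu) -(retraction_fix oU sH HE Ux Nx tv).
have <- : 'd H x (a *: u + v) = a *: 'd H x u + 'd H x v by exact: linearP.
exact: (retraction_tangent oU sH HN HE).
Qed.

(** The inverse of a chart has an injective differential, as the chart undoes it. *)
Lemma submanifold_tangent_neq0 k (N : set V) z : (0 < k)%N -> submanifold k N -> N z ->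
  exists2 u, u != 0 & tangent N z u.
Proof.
move=> k0 sN Nz; have [U0 [D [f [oU0 U0z oD [fD sf [g [gN sg gf fg]]]]]]] := sN z Nz.
have [U [F [oU Uz sF FE]]] := sf z (conj Nz U0z).
have Dfz := fD z (conj Nz U0z).
have [E [G [oE Efz sG GE]]] := sg (f z) Dfz.
have oED : open (E `&` D) by exact: openI.
have sG' : smooth_on (E `&` D) G by apply: smooth_on_sub sG => y [].
have GN y : (E `&` D) y -> (N `&` U0) (G y).
  by move=> [Ey Dy]; rewrite GE//; exact: gN.
pose e0 : 'rV[R]_k := delta_mx ord0 (Ordinal k0).
have Gz : G (f z) = z by rewrite GE// gf.
have [e ep [cs cN c0 cd1]] := curve_in_image (N := N `&` U0) e0 oED (conj Efz Dfz) sG' GN.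
pose c (t : R) := G (f z + t *: e0).
exists ('d G (f z) e0); last first.
  exists c; exists e => //; split=> //; first by move=> t /cN [].
  by rewrite /c c0 Gz.
apply/eqP => u0.
have cd : is_derive (0 : R) (1 : R) c 0.
  rewrite -u0 -cd1; apply: differentiable_is_derive1.
  by apply: smooth_on_differentiable cs _; exact: ballxx.
have Uc0 : U (c 0) by rewrite /c scale0r addr0 Gz.
have dF : differentiable F (c 0) by exact: smooth_on_differentiable sF Uc0.
have H1 := is_derive_chain dF cd; rewrite linear0 in H1.
have H2 : is_derive (0 : R) (1 : R) (F \o c) e0.
  apply: near_eq_is_derive (is_derive_line (f z) e0 0).
  have Uc : \forall t \near (0 : R), U (c t).
    by apply: (is_derive_near cd); exact: open_nbhs_nbhs.
  have EDc : \forall t \near (0 : R), (E `&` D) (f z + t *: e0).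
    apply: (is_derive_near (is_derive_line (f z) e0 0)).
    by rewrite scale0r addr0; exact: open_nbhs_nbhs.
  near=> t.
  have [Et Dt] : (E `&` D) (f z + t *: e0) by near: t.
  have Ut : U (c t) by near: t.
  have NUt : (N `&` U0) (c t) by exact: GN.
  by rewrite /= FE// /c GE// fg.
have /matrixP/(_ ord0 (Ordinal k0)) := is_derive_uniq H1 H2.
by rewrite !mxE !eqxx => /eqP; rewrite eq_sym oner_eq0.
Unshelve. all: by end_near. Qed.

End Retractions.

Section StrictDifferentiability.
Context {R : realType} {V : normedModType R} {fV : frame V}.

Lemma lin_bounded (W : normedModType R) (f : V -> W) : linear f ->
  exists2 C : R, 0 < C & forall v, `|f v| <= C * `|v|.
Proof.
move=> fl; have [C C0 H] := @linear_lipschitz R V W (lin_of fl) (lin_continuous fl).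
by exists C.
Qed.

Lemma ball_segment (z x y : V) (d t : R) : ball z d x -> ball z d y -> 0 <= t <= 1 ->
  ball z d (y + t *: (x - y)).
Proof.
rewrite -!ball_normE /ball_/= => zx zy /andP[t0 t1].
have -> : z - (y + t *: (x - y)) = (1 - t) *: (z - y) + t *: (z - x).
  have zE : (z - x) - (z - y) = - (x - y) by rewrite !opprB addrC addrA subrK.
  by rewrite scalerBl scale1r -addrA [- _ + _]addrC -scalerBr zE scalerN opprD addrA.
apply: le_lt_trans (ler_normD _ _) _; rewrite !normrZ (ger0_norm t0) ger0_norm ?subr_ge0//.
have [->|tn0] := eqVneq t 0; first by rewrite subr0 mul1r mul0r addr0.
have tp : 0 < t by rewrite lt_neqAle eq_sym tn0.
have := ltr_pM2l tp; rewrite -subr_ge0 in t1 => ltt.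
have h1 : (1 - t) * `|z - y| <= (1 - t) * d by apply: ler_wpM2l => //; exact: ltW.
have h2 : t * `|z - x| < t * d by rewrite ltt.
lra.
Qed.

(** A smooth map is strictly differentiable: near [z] its increments are
    uniformly close to those of its differential at [z]. *)
Lemma strict_diff (W : normedModType R) {fW : frame W} (U : set V) (H : V -> W) z (e : R) :
  open U -> U z -> smooth_on U H -> 0 < e ->
  exists2 d : R, 0 < d & forall x y, ball z d x -> ball z d y ->
    `|H x - H y - 'd H z (x - y)| <= e * `|x - y|.
Proof.
move=> oU Uz sH e0.
have [C C0 lC] : exists2 C : R, 0 < C &
    forall (j : 'I_(fdim V)) v, `|fcoord j v| <= C * `|v|.
  have Hj (j : 'I_(fdim V)) : exists c, 0 < c /\ forall v, `|fcoord j v| <= c * `|v|.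
    by have [c c0 cl] := lin_bounded (fcoord_lin j); exists c.
  have [Cj Cj0] := choice Hj.
  exists (1 + \sum_j Cj j).
    by rewrite ltr_pwDl// sumr_ge0// => j _; have [/ltW] := Cj0 j.
  move=> j v; have [cj0 cjl] := Cj0 j; apply: le_trans (cjl v) _.
  apply: ler_wpM2r => //; rewrite (bigD1 j)//= addrCA lerDl addr_ge0//.
  by apply: sumr_ge0 => k _; have [/ltW] := Cj0 k.
(* Summing over the coordinates of [W] costs the factor [K], over those of [V] the
   factor [M * C]; the summands one make the factors positive. *)
pose K := 1 + \sum_i `|@fbasis R W fW i|.
have K0 : 0 < K by rewrite ltr_pwDl// sumr_ge0.
pose M : R := 1 + (@fdim R V fV)%:R.
have M0 : 0 < M by rewrite ltr_pwDl.
pose eta := e / (K * (M * C)).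
have eta0 : 0 < eta by rewrite divr_gt0// !mulr_gt0.
pose g i (x : V) : R := @fcoord R W fW i (H x).
have sg i : smooth_on U (g i).
  by move=> k; apply: (Ck_lin (l := fcoord i : W -> R)) => //; exact: fcoord_lin.
have near1 : \forall x \near z, U x /\ forall i j,
    `|'D_(fbasis j) (g i) x - 'D_(fbasis j) (g i) z| <= eta.
  apply: filterI; first exact: open_nbhs_nbhs.
  apply: filter_forall => i; apply: filter_forall => j.
  have cD : {for z, continuous ('D_(fbasis j) (g i))}.
    exact: smooth_on_continuous (smooth_on_derive _ (sg i)) Uz.
  have /cvgrPdist_le/(_ eta eta0) := cD; apply: filterS => x.
  by rewrite distrC.
have [d d0 dB] := (nbhs_ballP _ _).1 near1.
exists d => // x y bx by_.
have seg t : 0 <= t <= 1 -> ball z d (y + t *: (x - y)) by exact: ball_segment.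
have bound i w : ball z d w ->
    `|'d (g i) w (x - y) - 'd (g i) z (x - y)| <= (e / K) * `|x - y|.
  move=> /dB[Uw Dw].
  have dw := smooth_on_differentiable (sg i) Uw.
  have dz := smooth_on_differentiable (sg i) Uz.
  have -> : 'd (g i) w (x - y) - 'd (g i) z (x - y) =
      \sum_j fcoord j (x - y) * ('D_(fbasis j) (g i) w - 'D_(fbasis j) (g i) z).
    rewrite (diff_frame _ dw) (diff_frame _ dz) -sumrB; apply: eq_bigr => j _.
    by rewrite -scalerBr.
  apply: le_trans (ler_norm_sum _ _ _) _.
  apply: (@le_trans _ _ (\sum_(j < fdim V) (C * `|x - y|) * eta)).
    apply: ler_sum => j _; rewrite normrM; apply: ler_pM => //.
  rewrite sumr_const card_ord -[_ *+ _]mulr_natl /eta.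
  have -> : e / K * `|x - y| = M * (C * `|x - y| * (e / (K * (M * C)))).
    by field; rewrite !lt0r_neq0.
  apply: ler_wpM2r; last by rewrite lerDr.
  by rewrite !mulr_ge0// ?invr_ge0 ?mulr_ge0// ltW.
have comp i : `|fcoord i (H x - H y - 'd H z (x - y))| <= (e / K) * `|x - y|.
  have lfi : linear (fcoord i : W -> R) by exact: fcoord_lin.
  have dH := smooth_on_differentiable sH Uz.
  have -> : fcoord i (H x - H y - 'd H z (x - y)) = g i x - g i y - 'd (g i) z (x - y).
    have -> : 'd (g i) z (x - y) = fcoord i ('d H z (x - y)).
      rewrite (@diff_comp _ _ _ _ H (fcoord i))//; last exact: lin_differentiable.
      by rewrite /= lin_diff.
    by rewrite /g -[fcoord i]/(lin_of lfi : W -> R) !linearB.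
  (* The mean value theorem on the segment from [y] to [x]. *)
  pose phi (t : R) := g i (y + t *: (x - y)).
  have phid (t : R) : 0 <= t <= 1 ->
      is_derive t (1 : R) phi ('d (g i) (y + t *: (x - y)) (x - y)).
    move=> /seg /dB[Ut _].
    exact: is_derive_chain (smooth_on_differentiable (sg i) Ut) (is_derive_line _ _ _).
  have [xi xi01] : exists2 xi : R, xi \in `]0, 1[ &
      phi 1 - phi 0 = 'd (g i) (y + xi *: (x - y)) (x - y) * (1 - 0).
    apply: (@MVT _ phi (fun t => 'd (g i) (y + t *: (x - y)) (x - y))) => // [t|].
      by rewrite in_itv/= => /andP[/ltW t0 /ltW t1]; apply: phid; rewrite t0.
    apply: continuous_in_subspaceT => t; rewrite inE/= in_itv/= => t01.
    exact: is_derive_continuous (phid t t01).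
  rewrite /phi scale1r scale0r addr0 (addrC y) subrK subr0 mulr1 => ->.
  apply: bound; apply: seg; move: xi01; rewrite in_itv/= => /andP[/ltW -> /ltW ->].
  by [].
rewrite [X in `|X|](frameE (H x - H y - 'd H z (x - y))).
apply: le_trans (ler_norm_sum _ _ _) _.
apply: (@le_trans _ _ (\sum_(i < fdim W) (e / K * `|x - y|) * `|fbasis i : W|)).
  by apply: ler_sum => i _; rewrite normrZ; apply: ler_wpM2r.
rewrite -mulr_sumr.
have -> : e * `|x - y| = (e / K * `|x - y|) * K by field; rewrite lt0r_neq0.
apply: ler_wpM2l; last by rewrite lerDr.
by rewrite mulr_ge0// divr_ge0// ltW.
Qed.

End StrictDifferentiability.

(** * Magnetic geodesics as superpositions of two rotations *)

Section MagneticHelix.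
Context {R : realType} {n : nat}.
Local Notation V := (Cvec R n.+1).
Local Notation S := (@sphere R n).
Local Notation Sys := (@sphere_system R n).
Implicit Types (A B z u v w : V).

Lemma ip_rot_orth A B s t : ip A B = 0 -> ip (J A) B = 0 -> ip (rot s A) (rot t B) = 0.
Proof.
move=> AB JAB; have AJB : ip A (J B) = 0 by rewrite -[LHS]opprK -ipJl JAB oppr0.
rewrite /rot; move: (cos s) (sin s) (cos t) (sin t) => a b c d.
by ip_expand; rewrite ipJJ AB JAB AJB; ring.
Qed.

Lemma helix_sphere a b A B t : ip A B = 0 -> ip (J A) B = 0 -> ip A A + ip B B = 1 ->
  S (helix a b A B t).
Proof.
move=> AB JAB AABB; apply/sphereE; rewrite /helix.
have uv := ip_rot_orth (a * t) (b * t) AB JAB.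
have uu : ip (rot (a * t) A) (rot (a * t) A) = ip A A by exact: ip_rot.
have vv : ip (rot (b * t) B) (rot (b * t) B) = ip B B by exact: ip_rot.
move: (rot _ A) (rot _ B) uv uu vv => u v uv uu vv.
by ip_expand; rewrite (ipC v u) uv uu vv -AABB; ring.
Qed.

Lemma derive1_helix a b A B : derive1 (helix a b A B) = helix a b (a *: J A) (b *: J B).
Proof. by apply/funext => t; exact: is_derive1 (is_derive_helix _ _ _ _ _). Qed.

(** For orthogonal rotating vectors the constant of motion is [- a * b], and
    [a + b = 1] makes [a] and [b] the roots of [x ^+ 2 = x - a * b]. *)
Lemma mag_acc_orth (u v : V) (a b : R) : a + b = 1 -> ip u v = 0 -> ip (J u) v = 0 ->
  ip u u + ip v v = 1 ->
  mag_acc (u + v) (a *: J u + b *: J v) = (- a ^+ 2) *: u + (- b ^+ 2) *: v.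
Proof.
move=> ab uv Juv uuvv; have bE : b = 1 - a by rewrite -ab addrAC subrr add0r.
have uJv : ip u (J v) = 0 by rewrite -[LHS]opprK -ipJl Juv oppr0.
rewrite /mag_acc.
have -> : ip (J (a *: J u + b *: J v)) (u + v) +
    ip (a *: J u + b *: J v) (a *: J u + b *: J v) = a ^+ 2 - a.
  have vvE : ip v v = 1 - ip u u by rewrite -uuvv addrAC subrr add0r.
  have JvJu : ip (J v) (J u) = 0 by rewrite ipJJ ipC.
  move: JvJu (ipJJ u u) (ipJJ v v) (ipJJ u v) (ipC v u) uv vvE.
  by rewrite bE; ip_expand; ip_atoms => -> -> -> -> -> -> ->; ring.
by rewrite bE; vring.
Qed.

(** The magnetic geodesics of the sphere: superpositions of two rotations of
    complex-orthogonal vectors, with frequencies of sum one. *)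
Lemma helix_magnetic a b A B : a + b = 1 -> ip A B = 0 -> ip (J A) B = 0 ->
  ip A A + ip B B = 1 -> magnetic_geodesic Sys setT (helix a b A B).
Proof.
move=> ab AB JAB AABB; apply: ode_magnetic_geodesic.
- exact: smooth_helix.
- by move=> t; exact: helix_sphere.
- move=> t; rewrite derive1_helix; apply: is_derive_eq (is_derive_helix _ _ _ _ _) _.
  have rotZJ s k (z : V) : rot s (k *: J z) = k *: J (rot s z) by rewrite /rot; vring.
  have rotZJJ s k (z : V) : rot s (k *: J (k *: J z)) = (- k ^+ 2) *: rot s z.
    by rewrite /rot; vring.
  transitivity ((- a ^+ 2) *: rot (a * t) A + (- b ^+ 2) *: rot (b * t) B).
    by congr (_ + _); exact: rotZJJ.
  have -> : helix a b (a *: J A) (b *: J B) t =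
      a *: J (rot (a * t) A) + b *: J (rot (b * t) B).
    by congr (_ + _); exact: rotZJ.
  apply/esym; apply: mag_acc_orth ab _ _ _.
  + exact: ip_rot_orth.
  + rewrite -rotJ; apply: ip_rot_orth; first exact: JAB.
    by rewrite JJ ipNl AB oppr0.
  + by rewrite -[RHS]AABB; congr (_ + _); exact: ip_rot.
Qed.

(** The solution of [c'' = e *: J c' - (1 + e * ip (J v) z) *: c] with
    [c 0 = z] and [c' 0 = v]: a magnetic geodesic of speed [1 / e] run at unit
    speed, and the great circle when [e = 0]. *)
Definition disc (k e : R) := Num.sqrt (e ^+ 2 + 4 * k * e + 4).
Definition freq1 k e := (e + disc k e) / 2.
Definition freq2 k e := (e - disc k e) / 2.
Definition amp1 z v k e : V := (disc k e)^-1 *: (- J v - freq2 k e *: z).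
Definition amp2 z v k e : V := (disc k e)^-1 *: (freq1 k e *: z + J v).
Definition slow z v (e : R) : R -> V := let k := ip (J v) z in
  helix (freq1 k e) (freq2 k e) (amp1 z v k e) (amp2 z v k e).

(** Since [-1 <= k], the radicand is at least [4 - 4 * e]. *)
Lemma disc_sqr k e : -1 <= k <= 1 -> 0 < e < 1 ->
  disc k e ^+ 2 = e ^+ 2 + 4 * k * e + 4 /\ 0 < disc k e.
Proof.
move=> /andP[k1 k2] /andP[e0 e1].
have p : 0 < e ^+ 2 + 4 * k * e + 4 by nra.
by split; [rewrite sqr_sqrtr// ltW|rewrite sqrtr_gt0].
Qed.

Lemma ip_unit_bound z v : ip z z = 1 -> ip v v = 1 -> -1 <= ip (J v) z <= 1.
Proof.
move=> zz vv; have := ip_CS (J v) z; rewrite ipJJ zz vv mulr1; move: (ip _ _) => k kk.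
by apply/andP; split; nra.
Qed.

(** Up to the change of time [t -> e * t] the two frequencies have sum one. *)
Lemma slow_magnetic z v e : ip z z = 1 -> ip v v = 1 -> ip z v = 0 -> 0 < e < 1 ->
  exists a b A B, [/\ magnetic_geodesic Sys setT (helix a b A B),
    helix a b A B 0 = z, a *: J A + b *: J B = e^-1 *: v &
    forall t, slow z v e t = helix a b A B (e * t)].
Proof.
move=> zz vv zv e01; have k01 := ip_unit_bound zz vv.
have [dd d0] := disc_sqr k01 e01; have /andP[e0 _] := e01.
have dn : disc (ip (J v) z) e != 0 by rewrite lt0r_neq0.
have en : e != 0 by rewrite lt0r_neq0.
exists (freq1 (ip (J v) z) e / e), (freq2 (ip (J v) z) e / e),
  (amp1 z v (ip (J v) z) e), (amp2 z v (ip (J v) z) e).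
have vz : ip v z = 0 by rewrite ipC.
have zJv : ip z (J v) = ip (J v) z by exact: ipC.
have Jzv : ip (J z) v = - ip (J v) z by rewrite ipJl zJv.
have vJz : ip v (J z) = - ip (J v) z by rewrite ipC.
have JvJv : ip (J v) (J v) = 1 by rewrite ipJJ.
have JzJv : ip (J z) (J v) = 0 by rewrite ipJJ.
have z0 := ipJ0 z; have v0 := ip0J v.
rewrite /slow; move: (ip (J v) z) dd d0 dn zJv Jzv vJz {k01} => k.
rewrite /amp1 /amp2 /freq1 /freq2; move: (disc k e) => d dd d0 dn zJv Jzv vJz.
have kE : k = (d ^+ 2 - e ^+ 2 - 4) / (4 * e) by rewrite dd; field.
split.
- apply: helix_magnetic.
  + by field.
  + by ip_expand; rewrite zz JvJv zJv (ipC (J v) z) zJv kE; field; rewrite ?dn ?en.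
  + by ip_expand; rewrite z0 v0 vz JzJv; ring.
  + by ip_expand; rewrite zz JvJv zJv (ipC (J v) z) zJv kE; field; rewrite ?dn ?en.
- by rewrite helix0; vfield.
- by vfield; rewrite ?dn ?en.
- move=> t; rewrite /helix; congr (rot _ _ + rot _ _); field; exact: en.
Qed.

Lemma slow0 z v t : slow z v 0 t = cos t *: z + sin t *: v.
Proof.
rewrite /slow; move: (ip _ _) => k.
have d2 : disc k 0 = 2.
  rewrite /disc expr0n/= mulr0 !add0r (_ : 4 = 2 ^+ 2); last by ring.
  by rewrite sqrtr_sqr ger0_norm.
have p1 : freq1 k 0 = 1 by rewrite /freq1 d2; field.
have q1 : freq2 k 0 = -1 by rewrite /freq2 d2; field.
rewrite /helix /amp1 /amp2 p1 q1 d2 mul1r mulN1r /rot cosN sinN.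
by move: (cos t) (sin t) => a b; vfield.
Qed.

Lemma slow_continuous z v t : {for (0 : R), continuous (fun e => slow z v e t)}.
Proof.
rewrite /slow; move: (ip _ _) => k.
have cd : {for (0 : R), continuous (disc k)}.
  apply: (@continuous_comp _ _ _ (fun e : R => e ^+ 2 + 4 * k * e + 4) Num.sqrt); last exact: sqrt_continuous.
  by apply: cvgD; [apply: cvgD; [exact: exprn_continuous|apply: cvgM; [exact: cvg_cst|exact: cvg_id]]|exact: cvg_cst].
have d2 : disc k 0 != 0.
  rewrite /disc expr0n/= mulr0 !add0r; apply: lt0r_neq0; rewrite sqrtr_gt0; lra.
have c1 : {for (0 : R), continuous (freq1 k)}.
  by apply: cvgM; [apply: cvgD; [exact: cvg_id|exact: cd]|exact: cvg_cst].
have c2 : {for (0 : R), continuous (freq2 k)}.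
  by apply: cvgM; [apply: cvgB; [exact: cvg_id|exact: cd]|exact: cvg_cst].
have cV : {for (0 : R), continuous (fun e => (disc k e)^-1)}.
  by apply: cvgV => //; exact: cd.
have cA1 : {for (0 : R), continuous (amp1 z v k)}.
  apply: cvgZ; first exact: cV.
  by apply: cvgB; [exact: cvg_cst|apply: cvgZr_tmp; exact: c2].
have cA2 : {for (0 : R), continuous (amp2 z v k)}.
  apply: cvgZ; first exact: cV.
  by apply: cvgD; [apply: cvgZr_tmp; exact: c1|exact: cvg_cst].
have crot (f : R -> R) (a : R -> V) : {for (0 : R), continuous f} ->
    {for (0 : R), continuous a} -> {for (0 : R), continuous (fun e => rot (f e * t) (a e))}.
  move=> cf ca.
  have cft : {for (0 : R), continuous (fun e => f e * t)}.
    by apply: cvgM; [exact: cf|exact: cvg_cst].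
  apply: cvgD; apply: cvgZ.
  - by apply: (@continuous_comp _ _ _ (fun e => f e * t) cos) => //; exact: continuous_cos.
  - exact: ca.
  - by apply: (@continuous_comp _ _ _ (fun e => f e * t) sin) => //; exact: continuous_sin.
  - apply: (@continuous_comp _ _ _ a (@J R n.+1)) => //.
    by apply: lin_continuous; exact: J_lin.
by apply: cvgD; apply: crot.
Qed.

End MagneticHelix.

(** * Totally magnetic submanifolds are great spheres of complex subspaces *)

Lemma continuous_near (T U : topologicalType) (f : T -> U) x (P : set U) :
  {for x, continuous f} -> nbhs (f x) P -> \forall y \near x, P (f y).
Proof. by move=> cf Pf; exact: (cf P Pf). Qed.

Lemma closed_zero (R : realType) (W : normedModType R) : closed [set (0 : W)].
Proof. apply: accessible_closed_set1; apply: hausdorff_accessible; exact: norm_hausdorff. Qed.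

Section TotallyMagnetic.
Context {R : realType} {n : nat}.
Local Notation C := (R[i])%C.
Local Notation V := (Cvec R n.+1).
Local Notation S := (@sphere R n).
Local Notation Sys := (@sphere_system R n).
Variables (k : nat) (N : set V).
Hypotheses (k0 : (0 < k)%N) (sN : submanifold k N) (NS : N `<=` S) (cN : closed N)
  (tmN : totally_magnetic Sys N).
Implicit Types (x y z u v w : V).

Lemma tangent_orth z u : N z -> tangent N z u -> ip z u = 0.
Proof.
move=> Nz /tangentP[c [cd cNc c0]]; subst z; apply: sphere_is_derive cd.
by apply: filterS cNc => t; exact: NS.
Qed.

Lemma tangentZ z a u : N z -> tangent N z u -> tangent N z (a *: u).
Proof.
move=> Nz tu; have t0 : tangent N z 0.
  have -> : 0 = (-1) *: u + u by vring.
  exact: (submanifold_tangent_closed _ sN Nz tu tu).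
have -> : a *: u = a *: u + 0 by vring.
exact: (submanifold_tangent_closed a sN Nz tu t0).
Qed.

Lemma unit_tangent z : N z -> exists2 v, ip v v = 1 & tangent N z v.
Proof.
move=> Nz; have [u u0 tu] := submanifold_tangent_neq0 k0 sN Nz.
have r0 : Num.sqrt (ip u u) != 0 by rewrite sqrtr_eq0 -ltNge ip_gt0.
exists ((Num.sqrt (ip u u))^-1 *: u); last exact: tangentZ.
have rr := sqr_sqrtr (ip_ge0 u); rewrite ipZl ipZr -{3}rr.
by move: (Num.sqrt _) r0 => r r0; field.
Qed.

(** A closed submanifold contains the magnetic geodesics that it is tangent to
    at one time: the set of times of tangency is open and closed. *)
Lemma helix_stays a b A B : magnetic_geodesic Sys setT (helix a b A B) ->
  N (helix a b A B 0) -> tangent N (helix a b A B 0) (a *: J A + b *: J B) ->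
  forall t, N (helix a b A B t).
Proof.
move=> G N0 t0.
pose c := helix a b A B.
pose dc := helix a b (a *: J A) (b *: J B).
have cd t : is_derive t (1 : R) c (dc t) by exact: is_derive_helix.
pose T := [set t : R | N (c t) /\ tangent N (c t) (dc t)].
(* A geodesic restarted at time [s] stays in [N] for a while, so it remains
   tangent. *)
have openT' : open T.
  rewrite openE => s [Ns ts].
  have Gs : magnetic_geodesic Sys setT (fun t => c (s + t)).
    have [_ _ _ cS _] := G.
    apply: ode_magnetic_geodesic => [|t|t].
    - rewrite (_ : (fun t => _) = helix a b (rot (a * s) A) (rot (b * s) B)).
        exact: smooth_helix.
      by apply/funext => t; exact: helix_shift.
    - exact: cS.
    - have E : derive1 (fun t => c (s + t)) = fun t => derive1 c (s + t).
        apply/funext => r; apply: is_derive1; apply: is_derive_shift1.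
        by rewrite derive1_helix; exact: cd.
      rewrite E; apply: is_derive_shift1.
      exact: magnetic_geodesic_ode G _.
  have c0 : derive1 (fun t => c (s + t)) 0 = dc s.
    by apply: is_derive1; apply: is_derive_shift1; rewrite addr0; exact: cd.
  have Ns0 : N (c (s + 0)) by rewrite addr0.
  have ts0 : tangent N (c (s + 0)) (derive1 (fun t => c (s + t)) 0) by rewrite c0 addr0.
  have [e e0 eN] := tmN Gs I Ns0 ts0.
  have eN' t : ball s e t -> N (c t).
    rewrite -ball_normE /ball_/= distrC ltr_norml => te.
    by have [_] := eN (t - s) te; rewrite addrC subrK.
  apply/nbhs_ballP; exists e => // t st; split; first exact: eN'.
  exists (fun r => c (t + r)).
  have [d /= d0 dB] : nbhs_ball t (ball s e).
    by apply/nbhs_ballP; apply: open_nbhs_nbhs; split; [exact: ball_open|].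
  exists d; first exact: d0.
  split.
  - rewrite (_ : (fun r => _) = helix a b (rot (a * t) A) (rot (b * t) B)).
      by apply: smooth_on_sub (smooth_helix _ _ _ _).
    by apply/funext => r; exact: helix_shift.
  - move=> r; rewrite -ball_normE /ball_/= sub0r normrN => rd; apply: eN'; apply: dB.
    by rewrite -ball_normE /ball_/= opprD addrA subrr sub0r normrN.
  - exact: (congr1 c (addr0 t)).
  - by apply: is_derive1; apply: is_derive_shift1; rewrite addr0; exact: cd.
have closedT' : closed T.
  move=> t clt.
  have cc : {for t, continuous c}.
    exact: (is_derive_continuous (cd t)).
  have Nt : N (c t).
    apply: cN => Q /cc cQ; have [s [[Ns _] Qs]] := clt _ cQ.
    by exists (c s).
  split=> //; have [U [H [oU Ut sH HN HE]]] := local_retraction sN Nt.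
  have dcc : {for t, continuous dc}.
    exact: (is_derive_continuous (is_derive_helix a b (a *: J A) (b *: J B) t)).
  have Uc : \forall s \near t, U (c s) by apply: cc; exact: open_nbhs_nbhs.
  (* Tangency at [c s] is the vanishing of the continuous function [psi]. *)
  pose psi s := 'd H (c s) (dc s) - dc s.
  have psic : {for t, continuous psi}.
    by apply: cvgB; [exact: (continuous_diff_along oU sH Ut cc dcc)|exact: dcc].
  have psi0 : psi t = 0.
    apply/eqP/negPn/negP => nz.
    have nz' : \forall s \near t, psi s != 0.
      have oo : open [set w : V | w != 0].
        rewrite (_ : [set w | _] = ~` [set (0 : V)]); last first.
          by apply/seteqP; split=> w /= /eqP.
        exact/closed_openC/closed_zero.
      exact: (psic [set w : V | w != 0] (open_nbhs_nbhs (conj oo nz))).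
    have [s [[Ns ts] [Us /eqP]]] := clt _ (filterI Uc nz').
    apply; rewrite /psi (retraction_fix oU sH HE Us Ns ts).
    exact: subrr.
  have /eqP := psi0; rewrite subr_eq0 => /eqP <-.
  exact: (retraction_tangent oU sH HN HE).
have TT : T = setT.
  have /connected_intervalP cR : is_interval (@setT R) by [].
  apply: cR.
  - by exists 0; split; rewrite // /dc helix0.
  - by exists T => //; rewrite setTI.
  - by exists T => //; rewrite setTI.
by move=> t; have [] : T t by rewrite TT.
Qed.

Lemma slow_in z v e t : N z -> tangent N z v -> ip v v = 1 -> 0 < e < 1 -> N (slow z v e t).
Proof.
move=> Nz tv vv e01.
have zz : ip z z = 1 by apply/sphereE; exact: NS.
have [a [b [A [B [G h0 hd ->]]]]] := slow_magnetic zz vv (tangent_orth Nz tv) e01.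
by apply: helix_stays; rewrite ?h0 ?hd//; exact: tangentZ.
Qed.

(** Fast magnetic geodesics converge to great circles. *)
Lemma great_circle_in z v t : N z -> tangent N z v -> ip v v = 1 ->
  N (cos t *: z + sin t *: v).
Proof.
move=> Nz tv vv; rewrite -(slow0 z v t); apply: cN => B.
move=> /(@slow_continuous R n z v t) /nbhs_ballP[d /= d0 dB].
pose e := Num.min (d / 2) (2^-1).
have e0 : 0 < e by rewrite lt_min divr_gt0//= invr_gt0.
exists (slow z v e t); split.
  apply: slow_in => //; rewrite e0/=.
  by apply: (@le_lt_trans _ _ 2^-1); [rewrite ge_min lexx orbT|lra].
apply: dB; rewrite -ball_normE /ball_/= sub0r normrN gtr0_norm//.
by apply: (@le_lt_trans _ _ (d / 2)); [rewrite ge_min lexx|lra].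
Qed.

(** For a unit vector [z], the orthogonal projection along [z]. *)
Definition orth_part z w : V := w - ip w z *: z.
(** The real span of [z] and of the tangent space of [N] at [z]. *)
Definition tspan z : set V := [set w | tangent N z (orth_part z w)].

Lemma orth_part_lin z : linear (orth_part z).
Proof. by move=> a u v; rewrite /orth_part; vring. Qed.

Lemma orth_part_id z u : ip z u = 0 -> orth_part z u = u.
Proof. by move=> zu; rewrite /orth_part ipC zu scale0r subr0. Qed.

Lemma orth_part_self z : S z -> orth_part z z = 0.
Proof. by move=> /sphereE zz; rewrite /orth_part zz scale1r subrr. Qed.

Lemma orth_partP z w : S z -> ip z (orth_part z w) = 0.
Proof. by move=> /sphereE zz; rewrite /orth_part; ip_expand; rewrite zz (ipC z w); ring. Qed.

(** For [L] the differential at [z] of a retraction, the zeros of this map form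
    [tspan z]. *)
Lemma tspan_defect_lin z (L : {linear V -> V}) :
  linear (fun w => L (orth_part z w) - orth_part z w).
Proof.
move=> a u v; rewrite orth_part_lin.
move: (orth_part z u) (orth_part z v) => p q.
have -> : L (a *: p + q) = a *: L p + L q by exact: linearP.
by move: (L p) (L q) => r s; vring.
Qed.

Lemma tspan_comb z a u v : N z -> tspan z u -> tspan z v -> tspan z (a *: u + v).
Proof.
by move=> Nz tu tv; rewrite /tspan/= orth_part_lin; exact: (submanifold_tangent_closed a sN).
Qed.

Lemma tspan0 z : N z -> tspan z 0.
Proof.
move=> Nz; have [v _ tv] := unit_tangent Nz.
rewrite /tspan/= (_ : orth_part z 0 = 0 *: v); first exact: tangentZ.
by rewrite /orth_part; vring.
Qed.

Lemma tspanZ z a u : N z -> tspan z u -> tspan z (a *: u).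
Proof. by move=> Nz tu; have := tspan_comb a Nz tu (tspan0 Nz); rewrite addr0. Qed.

Lemma tspan_self z : N z -> tspan z z.
Proof.
by move=> Nz; have := tspan0 Nz; rewrite /tspan/= orth_part_self ?[orth_part z 0]orth_part_id ?ip0r//; exact: NS.
Qed.

Lemma tangent_tspan z u : N z -> tangent N z u -> tspan z u.
Proof. by move=> Nz tu; rewrite /tspan/= orth_part_id//; exact: tangent_orth. Qed.

Lemma tspan_tangent z u : N z -> ip z u = 0 -> tspan z u -> tangent N z u.
Proof. by move=> Nz zu; rewrite /tspan/= orth_part_id. Qed.

(** The great sphere spanned by a point and its tangent space is covered by the
    great circles through that point. *)
Lemma tspan_sub z w : N z -> S w -> tspan z w -> N w.
Proof.
move=> Nz /sphereE ww tw; have Sz := NS Nz; have /sphereE zz := Sz.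
have [v [vv tv wE]] : exists v, [/\ ip v v = 1, tangent N z v &
    orth_part z w = Num.sqrt (1 - ip w z ^+ 2) *: v].
  have wpw : ip (orth_part z w) (orth_part z w) = 1 - ip w z ^+ 2.
    by rewrite /orth_part; ip_expand; rewrite ww zz (ipC z w); ip_atoms; ring.
  have [u0|u0] := eqVneq (orth_part z w) 0.
    have [v vv tv] := unit_tangent Nz; exists v; split=> //.
    by rewrite -wpw u0 ip0l sqrtr0 scale0r.
  have r0 : Num.sqrt (ip (orth_part z w) (orth_part z w)) != 0.
    by rewrite sqrtr_eq0 -ltNge ip_gt0.
  have rr := sqr_sqrtr (ip_ge0 (orth_part z w)).
  exists ((Num.sqrt (ip (orth_part z w) (orth_part z w)))^-1 *: orth_part z w); split.
  - by rewrite ipZl ipZr -{3}rr; move: (Num.sqrt _) r0 => r r0; field.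
  - exact: tangentZ.
  - by rewrite -wpw scalerA divff// scale1r.
have /andP[k1 k2] : -1 <= ip w z <= 1.
  have := ip_CS w z; rewrite ww zz mulr1; move: (ip w z) => q qq.
  by apply/andP; split; nra.
have wE2 : w = cos (acos (ip w z)) *: z + sin (acos (ip w z)) *: v.
  have cE : cos (acos (ip w z)) = ip w z by apply: acosK; rewrite in_itv/= k1.
  have sE : sin (acos (ip w z)) = Num.sqrt (1 - ip w z ^+ 2).
    by apply: sin_acos; rewrite k1.
  rewrite cE sE; transitivity (ip w z *: z + orth_part z w); last by rewrite wE.
  by rewrite /orth_part; move: (ip w z) => q; vring.
by rewrite wE2; exact: great_circle_in.
Qed.

(** The converse near [z]: the projection onto the tangent space at [z] is
    injective on [N] near [z], and already onto a neighbourhood when restricted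
    to the great sphere. *)
Lemma tspan_local z : N z -> \forall x \near z, N x -> tspan z x.
Proof.
move=> Nz; have Sz := NS Nz; have /sphereE zz := Sz.
have [U [H [oU Uz sH HN HE]]] := local_retraction sN Nz.
(* A projection onto the tangent space at [z] that kills [z]. *)
pose p x := 'd H z (orth_part z x).
have pl : linear p by move=> a u v; rewrite /p orth_part_lin linearP.
have pt x : tangent N z (p x) by exact: (retraction_tangent oU sH HN HE).
have pfix x : tangent N z x -> p x = x.
  move=> tx; rewrite /p orth_part_id; last exact: tangent_orth.
  exact: (retraction_fix oU sH HE).
have zp x : ip z (p x) = 0 by exact: tangent_orth.
have [K K0 pK] := lin_bounded pl.
pose e := (2 * (1 + K))^-1.
have e0 : 0 < e by rewrite invr_gt0 mulr_gt0// addr_gt0.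
have [d d0 dH] := strict_diff oU Uz sH e0.
have inj x y : N x -> N y -> U x -> U y -> ball z d x -> ball z d y -> p x = p y -> x = y.
  move=> Nx Ny Ux Uy bx by_ pxy.
  have := dH x y bx by_; rewrite (HE x)// (HE y)//; set w := x - y => Hw.
  have pw : p w = 0.
    rewrite /w -[y in x - y]scale1r -scaleNr addrC.
    by rewrite pl pxy scaleNr scale1r addNr.
  have pL : p ('d H z w) = 'd H z w.
    by apply: pfix; exact: (retraction_tangent oU sH HN HE).
  have pLw : p (w - 'd H z w) = - 'd H z w.
    have := pl (-1) ('d H z w) w; by rewrite pL pw addr0 scaleN1r addrC.
  (* [p] kills [w] and fixes ['d H z w], and the two are close to each other. *)
  have Lle : `|'d H z w| <= K * (e * `|w|).
    rewrite -normrN -pLw; apply: le_trans (pK _) _.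
    by apply: ler_wpM2l => //; exact: ltW.
  have wle : `|w| <= e * `|w| + K * (e * `|w|).
    have -> : w = (w - 'd H z w) + 'd H z w by rewrite subrK.
    apply: le_trans (ler_normD _ _) _; rewrite subrK; exact: lerD.
  have {}wle : `|w| <= 2^-1 * `|w|.
    apply: le_trans wle _; rewrite le_eqVlt; apply/orP; left; apply/eqP.
    by rewrite /e; field; rewrite lt0r_neq0// addr_gt0.
  have w0 : `|w| = 0 by have := normr_ge0 w; lra.
  by apply/eqP; rewrite -subr_eq0; exact/eqP/normr0_eq0.
(* The point of the great sphere near [z] with the same projection as [x]. *)
pose y x := p x + Num.sqrt (1 - ip (p x) (p x)) *: z.
have pz : p z = 0 by rewrite /p orth_part_self// linear0.
have yz : y z = z by rewrite /y pz ip0l subr0 sqrtr1 scale1r add0r.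
have pc : {for z, continuous p} by exact: lin_continuous.
have qc : {for z, continuous (fun x => 1 - ip (p x) (p x))}.
  have sp : smooth_on setT (fun x => ip (p x) (p x)).
    by apply: smooth_ip; first exact: openT; apply: smooth_on_lin => //; exact: openT.
  by apply: cvgB; [exact: cvg_cst|exact: smooth_on_continuous sp _].
have yc : {for z, continuous y}.
  apply: cvgD; first exact: pc.
  apply: cvgZr_tmp.
  apply: (@continuous_comp _ _ _ (fun x => 1 - ip (p x) (p x)) Num.sqrt) => //.
  exact: sqrt_continuous.
have near_y : \forall x \near z, U (y x) /\ ball z d (y x).
  have H1 : nbhs (y z) U by rewrite yz; exact: open_nbhs_nbhs.
  have H2 : nbhs (y z) (ball z d) by rewrite yz; exact: nbhsx_ballx.
  by apply: filterS2 (continuous_near yc H1) (continuous_near yc H2) => x.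
have near_x : \forall x \near z, U x /\ ball z d x.
  by apply: filterI; [exact: open_nbhs_nbhs|exact: nbhsx_ballx].
have near_q : \forall x \near z, 0 < 1 - ip (p x) (p x).
  have : nbhs (1 - ip (p z) (p z)) [set r : R | 0 < r].
    apply: open_nbhs_nbhs; split; first exact: open_gt.
    by rewrite /= pz ip0l subr0.
  exact: qc.
near=> x => Nx.
have [Uy By] : U (y x) /\ ball z d (y x) by near: x.
have [Ux Bx] : U x /\ ball z d x by near: x.
have q0 : 0 < 1 - ip (p x) (p x) by near: x.
have Sy : S (y x).
  apply/sphereE; rewrite /y; have rr := sqr_sqrtr (ltW q0).
  move: (zp x) rr; move: (Num.sqrt _) => r; move: (p x) => px zpx rr.
  ip_expand; rewrite (ipC px z) zpx zz; move: rr; ip_atoms => rr; nra.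
have ty : tspan z (y x).
  rewrite /y addrC; apply: tspan_comb => //; first exact: tspan_self.
  exact: tangent_tspan.
have Ny : N (y x) by exact: tspan_sub ty.
suff <- : y x = x by [].
apply: inj => //; rewrite /y addrC pl (pfix _ (pt x)) pz.
by rewrite scaler0 add0r.
Unshelve. all: by end_near. Qed.

(** The great circles of the span of [z] through [y] lie in [N], so their velocities
    are tangent to [N] at [y]. *)
Lemma tspan_eq1 z y w : N z -> N y -> tspan z y -> tspan z w -> tspan y w.
Proof.
move=> Nz Ny zy zw; have Sy := NS Ny; rewrite /tspan/=.
set u := orth_part y w.
have zu : tspan z u.
  rewrite /u /orth_part addrC -scaleNr; exact: tspan_comb.
have yu : ip y u = 0 by exact: orth_partP.
exists (great_circle y u); exists 1; first exact: ltr01.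
split.
- by apply: smooth_on_sub (smooth_helix _ _ _ _).
- move=> t _; apply: (@tspan_sub z) => //; first exact: great_circle_sphere.
  by rewrite great_circleE; apply: tspan_comb => //; do 2 apply: tspanZ => //.
- exact: great_circle0.
- exact: is_derive1 (is_derive_great_circle y u).
Qed.

(** By symmetry, as [z] lies in the span of [y]. *)
Lemma tspan_eq z y : N z -> N y -> tspan z y -> tspan y `<=` tspan z.
Proof.
move=> Nz Ny zy w; apply: tspan_eq1 => //.
by apply: (tspan_eq1 Nz Ny zy); exact: tspan_self.
Qed.

(** The acceleration of a magnetic geodesic lies in the great sphere's span. *)
Lemma tspan_J_tangent z v : N z -> tangent N z v -> ip v v = 1 -> tspan z (J v).
Proof.
move=> Nz tv vv; have zz : ip z z = 1 by apply/sphereE; exact: NS.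
have zv := tangent_orth Nz tv.
have e01 : 0 < (2^-1 : R) < 1 by apply/andP; split; lra.
have [a [b [A [B [G h0 hd hE]]]]] := slow_magnetic zz vv zv e01.
have hN : forall t, N (helix a b A B t).
  by apply: helix_stays; rewrite ?h0 ?hd//; exact: tangentZ.
have [U [H [oU Uz sH HN HE]]] := local_retraction sN Nz.
pose phi w := 'd H z (orth_part z w) - orth_part z w.
have phil : linear phi by exact: tspan_defect_lin.
have phi0 w : tspan z w -> phi w = 0.
  by move=> tw; rewrite /phi (retraction_fix oU sH HE)// subrr.
have cd s : is_derive s (1 : R) (helix a b A B) (helix a b (a *: J A) (b *: J B) s).
  exact: is_derive_helix.
have near0 : \forall s \near (0 : R), phi (helix a b A B s) = 0.
  have : \forall s \near (0 : R), N (helix a b A B s) -> tspan z (helix a b A B s).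
    by apply: (is_derive_near (P := fun x => N x -> tspan z x) (cd 0)); rewrite h0; exact: tspan_local.
  by apply: filterS => s /(_ (hN s)); exact: phi0.
(* The curve stays in the zero set of the linear map [phi], hence so do its
   velocity and its acceleration. *)
have near1 : \forall s \near (0 : R), phi (helix a b (a *: J A) (b *: J B) s) = 0.
  have near00 := near_join near0.
  apply: filterS near00 => s ns.
  apply: (is_derive_uniq (is_derive_lin phil (cd s))).
  apply: near_eq_is_derive (is_derive_cst (0 : V) s (1 : R)).
  by apply: filterS ns => r /= ->.
have acc : phi (mag_acc z (2 *: v)) = 0.
  have := magnetic_geodesic_ode (t := 0) G I.
  rewrite derive1_helix h0 helix0 hd invrK => H2.
  apply: (is_derive_uniq (is_derive_lin phil H2)).
  apply: near_eq_is_derive (is_derive_cst (0 : V) (0 : R) (1 : R)).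
  by apply: filterS near1 => r /= ->.
have phiz : phi z = 0 by apply: phi0; exact: tspan_self.
have phiJ : phi (J v) = 0.
  have JE2 : mag_acc z (2 *: v) =
      2 *: J v + (- (ip (J (2 *: v)) z + ip (2 *: v) (2 *: v))) *: z.
    by rewrite /mag_acc; move: (_ + ip (2 *: v) _) => m; vring.
  move: acc; rewrite JE2 addrC phil phiz scaler0 add0r.
  have := phil 2 (J v) 0; rewrite addr0 => ->.
  have -> : phi 0 = 0 by apply: phi0; exact: tspan0.
  rewrite addr0 => /eqP; rewrite scaler_eq0 pnatr_eq0/= => /eqP //.
have /eqP := phiJ; rewrite subr_eq0 => /eqP zE.
by rewrite /tspan/= -zE; exact: (retraction_tangent oU sH HN HE).
Qed.

(** A unit tangent vector [v] at [z] is itself a point of [N], with the same span,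
    and [z] is a unit tangent vector there. *)
Lemma tspan_J_base z : N z -> tspan z (J z).
Proof.
move=> Nz; have [v vv tv] := unit_tangent Nz.
have zv := tspan_tangent Nz (tangent_orth Nz tv).
have tzv : tspan z v by exact: tangent_tspan.
have Sv : S v by apply/sphereE.
have Nv : N v by exact: tspan_sub tzv.
have vz : tspan v z by apply: (tspan_eq1 Nz) => //; exact: tspan_self.
apply: (tspan_eq Nz Nv tzv); apply: tspan_J_tangent => //.
  by apply: tspan_tangent => //; rewrite ipC; exact: tangent_orth.
by apply/sphereE; exact: NS.
Qed.

Lemma tspan_J z w : N z -> tspan z w -> tspan z (J w).
Proof.
move=> Nz tw.
have wE : w = orth_part z w + ip w z *: z by rewrite /orth_part subrK.
rewrite wE JD JZ addrC; apply: tspan_comb => //; first exact: tspan_J_base.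
have tu : tangent N z (orth_part z w) by exact: tw.
move: (orth_part z w) tu => u tu {wE}.
have [->|u0] := eqVneq u 0; first by rewrite J0; exact: tspan0.
have r0 : Num.sqrt (ip u u) != 0 by rewrite sqrtr_eq0 -ltNge ip_gt0.
have rr := sqr_sqrtr (ip_ge0 u).
have tJ : tspan z (J ((Num.sqrt (ip u u))^-1 *: u)).
  apply: tspan_J_tangent => //; first exact: tangentZ.
  by rewrite ipZl ipZr -{3}rr; move: (Num.sqrt _) r0 => r r0; field.
move: (Num.sqrt _) r0 tJ {rr} => r r0 tJ.
have -> : J u = r *: J (r^-1 *: u).
  by rewrite (JZ r^-1 u) (scalerA r r^-1 (J u)) divff// scale1r.
exact: tspanZ.
Qed.

(** The part of [N] in the span of [z] is open in [N] because the span is constant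
    along it, and closed as the zero set of a linear map. *)
Lemma totally_magnetic_tspan z : connected N -> N z -> N = S `&` tspan z.
Proof.
move=> coN Nz; have Sz := NS Nz.
have AE : N `&` tspan z = N.
  apply: coN.
  - by exists z; split=> //; exact: tspan_self.
  - exists (interior [set x | N x -> tspan z x]); first exact: open_interior.
    apply/seteqP; split=> y [Ny ty]; split=> //.
      have H := tspan_local Ny; rewrite /interior/=; apply: filterS H => x Hx Nx.
      exact: (tspan_eq Nz Ny ty) (Hx Nx).
    exact: (interior_subset ty).
  - have [U [H [oU Uz sH HN HE]]] := local_retraction sN Nz.
    pose phi w := 'd H z (orth_part z w) - orth_part z w.
    have phil : linear phi by exact: tspan_defect_lin.
    exists [set w | phi w = 0].
      apply: ((continuous_closedP phi).1 _ [set 0]); last exact: closed_zero.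
      exact: lin_continuous.
    apply/seteqP; split=> y [Ny ty]; split=> //.
      by rewrite /= /phi (retraction_fix oU sH HE)// subrr.
    have /eqP := ty; rewrite subr_eq0 => /eqP zE.
    by rewrite /tspan/= -zE; exact: (retraction_tangent oU sH HN HE).
apply/seteqP; split=> y.
  by move=> Ny; split; [exact: NS|rewrite -AE in Ny; case: Ny].
by move=> [Sy ty]; exact: tspan_sub ty.
Qed.

Lemma totally_magnetic_subsphere : N !=set0 -> connected N ->
  exists W : {vspace 'cV[C]_n.+1}, N = S `&` [set z | toC z \in W].
Proof.
move=> [z Nz] coN.
have ofC0 : ofC (0 : 'cV[C]_n.+1) = 0 by apply: toC_inj; rewrite ofCK toC0.
have ofCJ (c : C) (u : 'cV[C]_n.+1) :
    ofC (c *: u) = complex.Re c *: ofC u + complex.Im c *: J (ofC u).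
  rewrite JE; congr pair; apply/matrixP => i j; rewrite !mxE !cplxE; ring.
have [||W WP] := @vspace_of_closed R n.+1 [set w | tspan z (ofC w)].
- by rewrite /= ofC0; exact: tspan0.
- move=> c u v /= tu tv.
  have -> : ofC (c *: u + v) = ofC (c *: u) + ofC v.
    by have := ofC_lin 1 (c *: u) v; rewrite !scale1r.
  rewrite ofCJ -addrA; apply: tspan_comb => //; apply: tspan_comb => //.
  exact: tspan_J.
exists W; rewrite (totally_magnetic_tspan coN Nz); congr (_ `&` _).
apply/seteqP; split=> w /=; first by move=> tw; apply/WP; rewrite /= toCK.
by move=> /WP; rewrite /= toCK.
Qed.

End TotallyMagnetic.

(** * The classification *)

Section SubspheresOfSubspaces.
Context {R : realType} {n : nat}.
Local Notation C := (R[i])%C.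
Local Notation S := (@sphere R n).

Lemma subsphere_projection (W : {vspace 'cV[C]_n.+1}) :
  exists d (B : 'M[C]_(d, n.+1)), B *m B^t* = 1%:M /\
    S `&` [set z | toC z \in W] = S `&` [set z | cact (B^t* *m B) z = z].
Proof.
have [d [B [BB WB]]] := vspace_projection W; exists d, B; split=> //.
congr (_ `&` _); apply/seteqP; split=> z /=.
  by move=> /WB zB; rewrite /cact zB toCK.
by move=> zB; apply/WB; rewrite -[RHS](congr1 (@toC R n.+1 1) zB) ofCK.
Qed.

Lemma subspace_totally_magnetic (W : {vspace 'cV[C]_n.+1}) :
  totally_magnetic (@sphere_system R n) (S `&` [set z | toC z \in W]).
Proof.
have [d [B [_ ->]]] := subsphere_projection W.
rewrite (_ : [set z | _] = [set z | cact (B^t* *m B - 1%:M) z = 0]).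
  exact: subsphere_totally_magnetic.
have E z : cact (B^t* *m B - 1%:M) z = cact (B^t* *m B) z - z.
  rewrite /cact mulmxBl mul1mx; apply: toC_inj.
  have := toC_lin (-1) z (ofC (B^t* *m B *m toC z)).
  rewrite scaleN1r addrC => ->; rewrite !ofCK addrC rmorphN rmorph1.
  by rewrite scaleN1r.
apply/seteqP; split=> z /=; rewrite E; first by move=> ->; rewrite subrr.
by move=> /eqP; rewrite subr_eq0 => /eqP.
Qed.

Lemma subspace_magnetomorphic (W : {vspace 'cV[C]_n.+1}) (N : set (Cvec R n.+1)) :
  N = S `&` [set z | toC z \in W] -> N !=set0 ->
  exists (j : nat) (f : Cvec R n.+1 -> Cvec R j.+1),
    magnetomorphism (pullback_system (@sphere_system R n) N) (@sphere_system R j) f.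
Proof.
have [d [B [BB ->]]] := subsphere_projection W.
exact: subsphere_magnetomorphic.
Qed.

End SubspheresOfSubspaces.

Local Close Scope sesquilinear_scope.

Theorem corollary1p5 (R : realType) (n : nat) (hn : (1 <= n)%N) :
  let S := @sphere_system R n in
  let TS := tangent_bundle (carrier S) in
  [/\ (* Mag(S) = U(n+1), with U(n+1) acting faithfully *)
      Mag S = [set f | exists2 U : 'M[(R[i])%C]_n.+1, U \is unitarymx &
                 forall z : carrier S, \val (f z) = act_mx U (\val z)] /\
      (forall U U' : 'M[(R[i])%C]_n.+1, U \is unitarymx -> U' \is unitarymx ->
         (forall z, carrier S z -> act_mx U z = act_mx U' z) -> U = U'),
      (* the lifted action is Hamiltonian with moment map mu *)
      (forall U : 'M[(R[i])%C]_n.+1, U \is unitarymx ->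
         symplectomorphism TS (twisted_form S) (tangent_lift (carrier S) (act_mx U))) /\
      moment_map (twisted_form S) (@mu R n) &
      (* totally magnetic submanifolds *)
      forall (k : nat) (N : set (Cvec R n.+1)),
        (0 < k)%N -> submanifold k N -> N `<=` carrier S ->
        N !=set0 -> compact N -> connected N ->
        (totally_magnetic S N <->
         exists V : {vspace 'cV[(R[i])%C]_n.+1},
           N = carrier S `&` [set z | toC z \in V]) /\
        (totally_magnetic S N ->
         exists (j : nat) (f : Cvec R n.+1 -> Cvec R j.+1),
           magnetomorphism (pullback_system S N) (@sphere_system R j) f)].
Proof.
move=> S TS; split.
- split; first exact: Mag_sphere.
  by move=> U U' _ _ UU'; apply: cact_inj => z; exact: UU'.
- by split; [move=> U; exact: unitary_symplectomorphism|exact: sphere_moment_map].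
- move=> k N k0 sN NS N0 compN coN.
  have cN : closed N by apply: compact_closed compN; exact: norm_hausdorff.
  have tm : totally_magnetic S N -> exists V : {vspace 'cV[(R[i])%C]_n.+1},
      N = carrier S `&` [set z | toC z \in V].
    by move=> tmN; exact: (totally_magnetic_subsphere k0 sN NS cN tmN N0 coN).
  split; last by move=> /tm[V NV]; exact: subspace_magnetomorphic NV N0.
  by split=> // -[V ->]; exact: subspace_totally_magnetic.
Qed.
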